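(* For a positive integer $r$, let $a_1,\dots,a_r,b_1,\dots,b_r$ be positive real numbers satisfying, for all $1\leq i,j\leq r$, $b_j>a_i$ if $i\leq j$ and $b_j>a_i-1$ if $i\geq j+1$, and let $(P_n(x))_{n\in\mathbb N}$ be the $r$-orthogonal polynomial sequence defined by $$P_n(x)=\frac{(-1)^n(a_1)_n\cdots(a_r)_n}{\left(b_1^{(n-1)}\right)_n\cdots\left(b_r^{(n-1)}\right)_n}\;{}_{r+1}F_r\left(\left.\begin{matrix}-n,b_1^{(n-1)},\dots,b_r^{(n-1)}\\ a_1,\dots,a_r\end{matrix}\,\right|\,x\right),\qquad b_j^{(n-1)}=b_j+\left\lceil\frac{n-j}{r}\right\rceil.$$ Denote by $x^{(n)}_1,\dots,x^{(n)}_n$ the zeros of $P_n(x)$ for $n\geq1$. Then, the asymptotic zero distribution $\nu_r$ of $P_n(x)$, i.e. $$\int_0^1f(t)\,\nu_r(t)\,\mathrm dt=\lim_{n\to\infty}\frac1n\sum_{k=1}^{n}f\left(x^{(n)}_k\right)$$ for all bounded and continuous functions $f$ on $(0,1)$, is supported on $[0,1]$ with density $$\nu_r(x)=\frac{(r+1)\sin\phi\,\sin(r\phi)\,\sin((r+1)\phi)}{\pi\,x\left((r+1)^2\sin^2(r\phi)-2r(r+1)\sin((r+1)\phi)\sin(r\phi)\cos\phi+r^2\sin^2((r+1)\phi)\right)},$$ after the change of variables $$x=\frac{r^r\,\sin^{r+1}((r+1)\phi)}{(r+1)^{r+1}\,\sin\phi\,\sin^r(r\phi)}\qquad\text{wi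th }\phi\in\left(0,\frac\pi{r+1}\right).$$
   Context: $\mathbb N=\{0,1,2,\dots\}$; $(z)_0=1$, $(z)_n=z(z+1)\cdots(z+n-1)$ for $n\ge1$; ${}_pF_q\left(\left.\begin{matrix}c_1,\dots,c_p\\ d_1,\dots,d_q\end{matrix}\,\right|\,x\right)=\sum_{n\ge0}\frac{(c_1)_n\cdots(c_p)_n}{(d_1)_n\cdots(d_q)_n}\frac{x^n}{n!}$. The asymptotic zero distribution of $(P_n(x))$ is the weak limit of the normalised zero counting measures $\frac1n\sum_{k=1}^n\delta_{x_k^{(n)}}$. *)

(* Defs.v *)
From HB Require Import structures.
From mathcomp Require Import all_boot all_order all_algebra.
From mathcomp Require Import all_classical all_reals all_analysis.

Set Implicit Arguments.
Unset Strict Implicit.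
Unset Printing Implicit Defensive.

Import Order.TTheory GRing.Theory Num.Theory.
Import numFieldNormedType.Exports.

Local Open Scope classical_set_scope.
Local Open Scope ring_scope.

Section Hypergeometric.
Variable R : realType.

Definition poch (z : R) (n : nat) : R := \prod_(i < n) (z + i%:R).

(* The generalised hypergeometric series pFq, with p = size c, q = size d. *)
Definition hypF (c d : seq R) (x : R) : R :=
  limn (series (fun n : nat =>
    (\prod_(u <- c) poch u n) / (\prod_(v <- d) poch v n) * (x ^+ n / n`!%:R))).

(* b_j^(n-1) = b_j + ceil ((n - j) / r); parameters are indexed from 0, so the
   index j : 'I_r stands for the 1-based index j.+1. *)
Definition bshift (r : nat) (b : 'I_r -> R) (n : nat) (j : 'I_r) : R :=
  b j + (Num.ceil ((n%:R - j.+1%:R) / r%:R : R))%:~R.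

Definition Pseq (r : nat) (a b : 'I_r -> R) (n : nat) (x : R) : R :=
  (-1) ^+ n * (\prod_(i < r) poch (a i) n)
    / (\prod_(j < r) poch (bshift b n j) n)
  * hypF (- n%:R :: [seq bshift b n j | j : 'I_r]) [seq a i | i : 'I_r] x.

(* z lists, with multiplicity, all the zeros of the monic polynomial function
   p of degree n. *)
Definition zeros_of (p : R -> R) (n : nat) (z : 'I_n -> R) : Prop :=
  forall y : R, p y = \prod_(k < n) (y - z k).

(* Weak limit of the normalised zero counting measures on ]0, 1[, the limit
   measure having density nu with respect to the Lebesgue measure. *)
Definition asymptotic_zero_density (p : nat -> R -> R) (nu : R -> R) : Prop :=
  forall z : forall n : nat, 'I_n -> R,
    (forall n : nat, (0 < n)%N -> zeros_of (p n) (z n)) ->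
  forall f : R -> R,
    {within `]0, 1[, continuous f} ->
    (exists M : R, forall t : R, 0 < t < 1 -> `|f t| <= M) ->
  (fun n : nat => n%:R^-1 * \sum_(k < n) f (z n k)) @ \oo -->
    \int[lebesgue_measure]_(t in `[0, 1]) (f t * nu t).

Definition xphi (r : nat) (phi : R) : R :=
  r%:R ^+ r * sin (r.+1%:R * phi) ^+ r.+1
  / (r.+1%:R ^+ r.+1 * sin phi * sin (r%:R * phi) ^+ r).

Definition nuphi (r : nat) (phi : R) : R :=
  r.+1%:R * sin phi * sin (r%:R * phi) * sin (r.+1%:R * phi)
  / (pi * xphi r phi *
     (r.+1%:R ^+ 2 * sin (r%:R * phi) ^+ 2
      - 2 * r%:R * r.+1%:R * sin (r.+1%:R * phi) * sin (r%:R * phi) * cos phi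
      + r%:R ^+ 2 * sin (r.+1%:R * phi) ^+ 2)).

End Hypergeometric.

(* Main.v *)
Require Import Defs.
From HB Require Import structures.
From mathcomp Require Import all_boot all_order all_algebra.
From mathcomp Require Import all_classical all_reals all_analysis.
From mathcomp Require Import measurable_realfun zify ring lra complex.

Set Implicit Arguments.
Unset Strict Implicit.
Unset Printing Implicit Defensive.

Import Order.TTheory GRing.Theory Num.Theory.
Import numFieldNormedType.Exports.

Local Open Scope classical_set_scope.
Local Open Scope ring_scope.

(* Idea: with the parameters b shifted one at a time, the polynomials are part of
   a chain of hypergeometric polynomials linked by two-term contiguity relations
   with positive coefficients. For y in the upper half plane these relations keep
   the arguments of r + 1 consecutive members of the chain ordered, so the
   polynomials are real rooted; the sign of the coefficients and a supersolution
   of the same recurrence built from the orthogonality moments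
   \prod_i (a_i)_m / (b_i)_m place the roots in (0, 1).

   Let x_k be the roots of P_n and p(y) = \prod_k (y + x_k). The terms of p(y), seen
   as weights on {0, ..., n}, are the law of a sum of independent Bernoulli
   variables of mean n w, w = 1/n \sum_k y / (y + x_k), and of variance at most n.
   Averaging the first-order recurrence of hypergeometric coefficients against
   this law gives w^(r+1) = y (1 - w) (w + 1/r)^r in the limit, a curve with a
   rational parametrisation; expanding w in powers of -1/y shows that the m-th
   moment of the zeros tends to
   (r^r / (r+1)^(r+1))^m binomial((r+1) m, m). The density nu_r has the same
   moments, because x^m nu_r dx has an explicit trigonometric primitive in phi.
   Finally, a function that is bounded and continuous on the open interval
   differs from a Bernstein polynomial by at most eta + C (1 - 2t)^(2N), and the
   integral of the last term tends to 0. *)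

(** The inequalities between [a] and [b] are what makes the coefficients of the chain positive:
    raising [a_i] together with [b_j] produces the factor [b_j - a_i], and for [j < i] the parameter
    [b_j] has already been raised when the two meet. The algebraic curve is only ever used at real
    [y > 0], where all weights are positive; this replaces any saddle point or complex analysis. The
    density becomes transparent in the variable [phi]: [nu_r(x) dx] is the image of the uniform law
    [(r+1)/pi dphi] on [(0, pi/(r+1))]. Put [zeta = e^(i(r+1)phi) sin(phi) / sin(r phi)]. Then [1 +
    zeta = e^(i phi) sin((r+1)phi) / sin(r phi)], hence [x / kappa = (1 + zeta)^(r+1) / zeta], which
    is real along this curve, with [kappa = r^r / (r+1)^(r+1)]. The binomial in the [m]-th moment is
    the constant term of the [m]-th power of this Laurent polynomial, and the trigonometric
    primitive is its integral against [dzeta / zeta]. *)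

Section Contiguity.
Variable R : realType.
Implicit Types (z : R) (n k m r : nat).

(** * Pochhammer symbols and contiguity relations *)

Lemma poch0 z : poch z 0 = 1.
Proof. by rewrite /poch big_ord0. Qed.

Lemma pochSr z n : poch z n.+1 = poch z n * (z + n%:R).
Proof. by rewrite /poch big_ord_recr. Qed.

Lemma pochSl z n : poch z n.+1 = z * poch (z + 1) n.
Proof.
rewrite /poch big_ord_recl /= addr0; congr (_ * _).
by apply: eq_bigr => i _; rewrite /bump /= natrD addrA.
Qed.

Lemma pochD z m n : poch z (m + n) = poch z m * poch (z + m%:R) n.
Proof.
elim: n => [|n IH]; first by rewrite addn0 poch0 mulr1.
by rewrite addnS !pochSr IH natrD mulrA addrA.
Qed.

Lemma poch_gt0 z n : 0 < z -> 0 < poch z n.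
Proof. by move=> z0; apply: prodr_gt0 => i _; rewrite ltr_wpDr. Qed.

(** The quotient [(al)_n / (al)_k] is stored as [poch (al + k) (n - k)]: every factor stays
    positive, and at [k = n] the products are empty, so that the polynomial is monic. *)
Definition hcoef r n (al be : 'I_r -> R) k : R :=
  'C(n, k)%:R * ((\prod_i poch (al i + k%:R) (n - k)) /
                 (\prod_i poch (be i + k%:R) (n - k))).

(* [(-1) ^+ n * (hpoly n al be).[- x]] is the monic polynomial proportional to
   the hypergeometric polynomial with upper parameters -n, be and lower
   parameters al. *)
Definition hpoly r n (al be : 'I_r -> R) : {poly R} :=
  \poly_(k < n.+1) hcoef n al be k.

Lemma coef_hpoly r n (al be : 'I_r -> R) k : (hpoly n al be)`_k = hcoef n al be k.
Proof.
rewrite coef_poly; case: ltnP => // nk.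
by rewrite /hcoef bin_small ?mul0r.
Qed.

Definition incr r (al : 'I_r -> R) (i0 : 'I_r) : 'I_r -> R :=
  fun i => al i + (i == i0)%:R.

Lemma prod_poch_incr r (al : 'I_r -> R) i0 k m : 0 < al i0 ->
  \prod_i poch (incr al i0 i + k%:R) m =
  \prod_i poch (al i + k%:R) m * ((al i0 + k%:R + m%:R) / (al i0 + k%:R)).
Proof.
move=> a0; rewrite (bigD1 i0) //= [in RHS](bigD1 i0) //= /incr eqxx.
have nz : al i0 + k%:R != 0 by rewrite gt_eqF // ltr_wpDr.
have -> : \prod_(i < r | i != i0) poch (al i + (i == i0)%:R + k%:R) m =
          \prod_(i < r | i != i0) poch (al i + k%:R) m.
  by apply: eq_bigr => i /negPf ->; rewrite addr0.
have E : poch (al i0 + 1 + k%:R) m = poch (al i0 + k%:R) m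
   * ((al i0 + k%:R + m%:R) / (al i0 + k%:R)).
  apply: (mulfI nz); rewrite addrAC -pochSl pochSr; field.
  exact: nz.
by rewrite E mulrAC.
Qed.

Lemma prod_pochS r (al : 'I_r -> R) k m :
  \prod_i poch (al i + k%:R) m.+1 =
  \prod_i poch (al i + k%:R) m * \prod_i (al i + (k + m)%:R).
Proof.
rewrite -big_split /=; apply: eq_bigr => i _.
by rewrite pochSr natrD addrA.
Qed.

Lemma prod_poch_gt0 r (al : 'I_r -> R) k m : (forall i, 0 < al i) ->
  0 < \prod_i poch (al i + k%:R) m.
Proof. by move=> h; apply: prodr_gt0 => i _; rewrite poch_gt0 // ltr_wpDr. Qed.

Lemma prod_shift_gt0 r (al : 'I_r -> R) k : (forall i, 0 < al i) ->
  0 < \prod_i (al i + k%:R).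
Proof. by move=> h; apply: prodr_gt0 => i _; rewrite ltr_wpDr. Qed.

Lemma hpoly0 r (al be : 'I_r -> R) : hpoly 0 al be = 1.
Proof.
apply/polyP => -[|k]; rewrite coef_hpoly coef1 /= /hcoef ?bin0n ?mul0r //.
by rewrite !big1 ?divr1 ?mulr1 // => i _; rewrite poch0.
Qed.

Lemma hpoly1 r (al be : 'I_r -> R) :
  hpoly 1 al be = 'X + (\prod_i al i / \prod_i be i)%:P.
Proof.
apply/polyP => -[|[|k]]; rewrite coef_hpoly coefD coefX coefC /= /hcoef.
- rewrite mul1r add0r; congr (_ / _); apply: eq_bigr => i _;
    by rewrite pochSr poch0 mul1r !addr0.
- by rewrite mul1r addr0 !big1 ?divr1 // => i _; rewrite poch0.
- by rewrite mul0r addr0.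
Qed.

(** The two increments multiply coefficient [k] by a ratio that exceeds 1 by
    [(n+1-k)(be - al) / ((al+k)(be+n+1))]; the factor [n+1-k] turns ['C(n+1, k)] into
    [(n+1) 'C(n, k)]. The new term is positive exactly when [al i0 < be j0]. *)
Lemma hpoly_incr r n (al be : 'I_r -> R) i0 j0 :
  (forall i, 0 < al i) -> (forall j, 0 < be j) ->
  hpoly n.+1 (incr al i0) (incr be j0) = hpoly n.+1 al be +
  (n.+1%:R * (\prod_i (al i + n%:R) / \prod_j (be j + n%:R)) *
    ((be j0 - al i0) / ((be j0 + n.+1%:R) * (al i0 + n%:R)))) *:
    hpoly n (incr al i0) be.
Proof.
move=> hal hbe; apply/polyP => k; rewrite coefD coefZ !coef_hpoly /hcoef.
have [kn|nk] := leqP k n; last first.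
  rewrite (bin_small nk) mul0r mulr0 addr0.
  move: nk; rewrite leq_eqVlt => /orP[/eqP <-|nk]; last by rewrite bin_small // !mul0r.
  by rewrite subnn; congr (_ * (_ / _)); rewrite !big1 // => i _; rewrite poch0.
rewrite !prod_poch_incr // subSn // !prod_pochS subnKC //.
have := prod_poch_gt0 k (n - k) hal; have := prod_poch_gt0 k (n - k) hbe.
set T := \prod_i _; set S := \prod_i _ => T0 S0.
have := prod_shift_gt0 n hal; have := prod_shift_gt0 n hbe.
set A := \prod_i _; set B := \prod_i _ => A0 B0.
have E : 'C(n.+1, k)%:R = (n.+1%:R * 'C(n, k)%:R) / (n.+1 - k)%:R :> R.
  apply: (canRL (mulfK _)); first by rewrite pnatr_eq0 subn_eq0 -ltnNge.
  by rewrite -!natrM mulnC -mul_bin_down.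
rewrite E; move: (hal i0) (hbe j0); set a := al i0; set b := be j0 => a0 b0.
rewrite -[(n - k).+1]subSn // !natrB ?leqW //.
have k0 : 0 <= k%:R :> R by []. 
have nk : k%:R <= n%:R :> R by rewrite ler_nat.
rewrite -[n.+1]addn1 natrD.
field; rewrite !gt_eqF //; lra.
Qed.

(** Raising all parameters by one and multiplying by ['X] reproduces the Pochhammer tails at the
    next index, so only the binomials and the factor at [j0] remain to be balanced. *)
Lemma hpoly_step r n (al be : 'I_r -> R) j0 :
  (forall i, 0 < al i) -> (forall j, 0 < be j) ->
  hpoly n.+1 al (incr be j0) =
  'X * hpoly n (fun i => al i + 1) (fun j => be j + 1) +
  ((\prod_i (al i + n%:R) / \prod_j (be j + n%:R)) *
    (be j0 / (be j0 + n.+1%:R))) *: hpoly n al be.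
Proof.
move=> hal hbe; apply/polyP => -[|k].
  rewrite coefD coefXM coefZ !coef_hpoly /= add0r /hcoef !bin0 !mul1r !subn0.
  rewrite prod_poch_incr // !prod_pochS addr0 add0n -[n.+1]addn1 natrD.
  have := prod_poch_gt0 0 n hbe; have := prod_shift_gt0 n hbe; move: (hbe j0).
  set b := be j0; set S := \prod_i _; set B := \prod_i _ => b0 B0 S0.
  have n0 : 0 <= n%:R :> R by [].
  field; rewrite !gt_eqF //; lra.
rewrite coefD coefXM coefZ !coef_hpoly /= /hcoef.
have Es (g : 'I_r -> R) m : \prod_i poch (g i + 1 + k%:R) m = \prod_i poch (g i + k.+1%:R) m.
  by apply: eq_bigr => i _; rewrite -addrA [in RHS]mulrS.
rewrite !Es subSS.
have [kn|nk] := ltnP k n; last first.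
  rewrite (@bin_small n k.+1) // mul0r mulr0 addr0 binS (@bin_small n k.+1) // add0n.
  have -> : (n - k)%N = 0 by apply/eqP; rewrite subn_eq0.
  by congr (_ * (_ / _)); rewrite !big1 // => i _; rewrite poch0.
rewrite !prod_poch_incr // -[(n - k)%N]subSS subSn // !prod_pochS subnKC //.
have := prod_poch_gt0 k.+1 (n - k.+1) hal; have := prod_poch_gt0 k.+1 (n - k.+1) hbe.
set T := \prod_i _; set S := \prod_i _ => T0 S0.
have := prod_shift_gt0 n hal; have := prod_shift_gt0 n hbe.
set A := \prod_i _; set B := \prod_i _ => A0 B0.
have E : 'C(n, k)%:R = (k.+1%:R * 'C(n.+1, k.+1)%:R) / n.+1%:R :> R.
  apply: (canRL (mulfK _)); first by rewrite pnatr_eq0.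
  by rewrite -!natrM mulnC mul_bin_diag.
have E2 : 'C(n, k.+1)%:R = 'C(n.+1, k.+1)%:R - (k.+1%:R * 'C(n.+1, k.+1)%:R) / n.+1%:R :> R.
  by rewrite -E binS natrD addrK.
rewrite E E2 -subSn // !natrB ?leqW //.
move: (hbe j0); set b := be j0 => b0.
have k0 : 0 <= k%:R :> R by [].
have nk : k%:R <= n%:R :> R by rewrite ler_nat ltnW.
rewrite -[n.+1]addn1 natrD -[k.+1]addn1 natrD.
field; rewrite !gt_eqF //; lra.
Qed.

Lemma hcoef_gt0 r n (al be : 'I_r -> R) k :
  (forall i, 0 < al i) -> (forall j, 0 < be j) -> (k <= n)%N -> 0 < hcoef n al be k.
Proof.
move=> hal hbe kn; apply: mulr_gt0; first by rewrite ltr0n bin_gt0.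
by apply: divr_gt0; apply: prod_poch_gt0.
Qed.

Lemma hpoly_monic r n (al be : 'I_r -> R) : hpoly n al be \is monic.
Proof.
have cn : (hpoly n al be)`_n = 1.
  by rewrite coef_hpoly /hcoef binn subnn !big1 ?divr1 ?mulr1 // => i _; rewrite poch0.
have sz : size (hpoly n al be) = n.+1.
  apply/eqP; rewrite eqn_leq size_poly /=.
  by apply: contraTT isT; rewrite -leqNgt => /leq_sizeP/(_ n (leqnn n)); rewrite cn => /eqP; rewrite oner_eq0.
by rewrite monicE lead_coefE sz cn.
Qed.

Lemma size_hpoly r n (al be : 'I_r -> R) : size (hpoly n al be) = n.+1.
Proof.
apply/eqP; rewrite eqn_leq size_poly ltnNge; apply/negP => /leq_sizeP/(_ n (leqnn n)).
rewrite coef_hpoly /hcoef binn subnn !big1 ?divr1 ?mulr1 // => [/eqP|i _|i _]; rewrite ?poch0 //.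
by rewrite oner_eq0.
Qed.

End Contiguity.

(** * Ordering of arguments in the upper half plane *)

Section HalfPlane.
Variable (R : realType) (p q : R).
Hypothesis q_gt0 : 0 < q.
Implicit Types f g h : R * R.

(* Pairs stand for complex numbers and y = p + q i lies in the upper half
   plane: [ang f g] says that the argument of g / f lies in [0, arg y]. *)
Definition ang f g :=
  0 <= g.2 * f.1 - g.1 * f.2 /\
  0 <= p * (f.2 * g.1 - f.1 * g.2) + q * (f.1 * g.1 + f.2 * g.2).

Definition cmul f : R * R := (p * f.1 - q * f.2, p * f.2 + q * f.1).
Definition cadd (c : R) f g : R * R := (f.1 + c * g.1, f.2 + c * g.2).
Definition cnz f := 0 < f.1 ^+ 2 + f.2 ^+ 2.

Lemma ang_refl f : ang f f.
Proof.
case: f => a b; split => /=; first by rewrite mulrC subrr.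
rewrite [b * a]mulrC subrr mulr0 add0r.
by rewrite mulr_ge0 ?(ltW q_gt0) // addr_ge0 // -expr2 sqr_ge0.
Qed.

Lemma ang_addr c f g h : 0 <= c -> ang f g -> ang f h -> ang f (cadd c g h).
Proof.
move=> c0 [A B] [C D]; split => /=.
  have -> : (g.2 + c * h.2) * f.1 - (g.1 + c * h.1) * f.2 =
    (g.2 * f.1 - g.1 * f.2) + c * (h.2 * f.1 - h.1 * f.2) by ring.
  by rewrite addr_ge0 // mulr_ge0.
have := addr_ge0 B (mulr_ge0 c0 D); congr (0 <= _); ring.
Qed.

Lemma ang_addl c f g h : 0 <= c -> ang g f -> ang h f -> ang (cadd c g h) f.
Proof.
move=> c0 [A B] [C D]; split => /=.
  have := addr_ge0 A (mulr_ge0 c0 C); congr (0 <= _); ring.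
have := addr_ge0 B (mulr_ge0 c0 D); congr (0 <= _); ring.
Qed.

(** Since [arg(y f / g) = arg y - arg(g / f)], the two defining inequalities are exchanged, one of
    them up to the factor [|y|^2]. *)
Lemma ang_cmul f g : ang f g -> ang g (cmul f).
Proof.
move=> [A B]; split => /=; first by move: B; congr (0 <= _); ring.
have /mulr_ge0/(_ A) : 0 <= p ^+ 2 + q ^+ 2 by rewrite addr_ge0 // sqr_ge0.
congr (0 <= _); ring.
Qed.

(** A vanishing sum would make [g] opposite to [f], but [arg(g / f)] is at most [arg y < pi]. *)
Lemma cnz_add c f g : 0 < c -> ang f g -> cnz f -> cnz (cadd c g f).
Proof.
move=> c0 [A B]; rewrite /cnz /= => f0.
have N (x y : R) : 0 < x ^+ 2 + y ^+ 2 = ~~ ((x == 0) && (y == 0)).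
  by rewrite lt0r addr_ge0 ?sqr_ge0 // andbT paddr_eq0 ?sqr_ge0 // !sqrf_eq0.
rewrite N; apply/negP => /andP[/eqP E1 /eqP E2].
have e1 : g.1 = - (c * f.1) by rewrite -[LHS]addr0 -(subrr (c * f.1)) addrA E1 add0r.
have e2 : g.2 = - (c * f.2) by rewrite -[LHS]addr0 -(subrr (c * f.2)) addrA E2 add0r.
move: B; rewrite e1 e2.
have -> : p * (f.2 * - (c * f.1) - f.1 * - (c * f.2)) +
  q * (f.1 * - (c * f.1) + f.2 * - (c * f.2)) =
  - (q * c * (f.1 ^+ 2 + f.2 ^+ 2)) by ring.
by rewrite oppr_ge0 leNgt !mulr_gt0.
Qed.

(** A vanishing sum would give [arg(g / f) = arg y - pi < 0]. *)
Lemma cnz_cmul c f g : 0 < c -> ang f g -> cnz f -> cnz (cadd c (cmul f) g).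
Proof.
move=> c0 [A B]; rewrite /cnz /= => f0.
have N (x y : R) : 0 < x ^+ 2 + y ^+ 2 = ~~ ((x == 0) && (y == 0)).
  by rewrite lt0r addr_ge0 ?sqr_ge0 // andbT paddr_eq0 ?sqr_ge0 // !sqrf_eq0.
rewrite N; apply/negP => /andP[/eqP E1 /eqP E2].
have := mulr_ge0 (ltW c0) A.
have -> : c * (g.2 * f.1 - g.1 * f.2) =
  (p * f.2 + q * f.1 + c * g.2) * f.1 - (p * f.1 - q * f.2 + c * g.1) * f.2
   - q * (f.1 ^+ 2 + f.2 ^+ 2) by ring.
rewrite E1 E2 !mul0r subrr sub0r oppr_ge0 leNgt.
by rewrite mulr_gt0.
Qed.

Variable r : nat.
Hypothesis r_gt0 : (0 < r)%N.

(** Arguments decrease with the index and spread over at most [arg y]. Nonvanishing is a separate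
    clause because [ang] holds trivially for a zero vector. *)
Definition ordered_angles (G : nat -> R * R) :=
  (forall i j, (j <= i <= r)%N -> ang (G i) (G j)) /\
  (forall i, (i <= r)%N -> cnz (G i)).

Definition update (G : nat -> R * R) k v := fun i => if i == k then v else G i.

(** As the row spreads over at most [arg y], the rotated last member [y * G r] is ahead of every
    member; mixing it with the former leader [G 0] keeps the lead without exceeding the spread. *)
Lemma ordered_update0 d G : 0 < d -> ordered_angles G ->
  ordered_angles (update G 0 (cadd d (cmul (G r)) (G 0))).
Proof.
move=> d0 [oG nG]; have key i : (i <= r)%N -> ang (G i) (cadd d (cmul (G r)) (G 0)).
  move=> ir; apply: ang_addr; first exact: ltW.
    by apply: ang_cmul; apply: oG; rewrite ir leqnn.
  exact: oG.
split=> [i j|i]; rewrite /update.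
  case: eqVneq => [->|i0]; first by rewrite leqn0 => /andP[-> _]; exact: ang_refl.
  by case: eqVneq => [_|j0] // ij; [apply: key; case/andP: ij|apply: oG].
case: eqVneq => [_ _|_]; last exact: nG.
by apply: cnz_cmul => //; [apply: oG; rewrite leqnn|apply: nG].
Qed.

Lemma ordered_updateS c G k : 0 < c -> (k < r)%N -> ordered_angles G ->
  ordered_angles (update G k.+1 (cadd c (G k) (G k.+1))).
Proof.
move=> c0 kr [oG nG]; have [c0' kr'] := (ltW c0, ltnW kr).
split=> [i j|i]; rewrite /update.
  case: eqVneq => [->|ik]; case: eqVneq => [->|jk] // ij; last exact: oG.
  - exact: ang_refl.
  - move: ij; rewrite leq_eqVlt (negPf jk) /= ltnS => /andP[jk' _].
    by apply: ang_addl => //; apply: oG; rewrite ?jk' ?leqW.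
  - case/andP: ij => ki ir.
    by apply: ang_addr => //; apply: oG; rewrite ir ?andbT // ltnW.
case: eqVneq => [_ _|_]; last exact: nG.
by apply: cnz_add => //; [apply: oG; rewrite leqnSn|apply: nG].
Qed.

Variables (G : nat -> nat -> R * R) (d : nat -> R) (c : nat -> nat -> R).
Hypothesis G0 : forall k, (k <= r)%N -> G 0 k = (1, 0).
Hypothesis GS0 : forall n, G n.+1 0 = cadd (d n) (cmul (G n r)) (G n 0).
Hypothesis GSS : forall n k, (k < r)%N ->
  G n.+1 k.+1 = cadd (c n k) (G n.+1 k) (G n k.+1).
Hypothesis d_gt0 : forall n, 0 < d n.
Hypothesis c_gt0 : forall n k, (k < r)%N -> 0 < c n k.

Lemma ordered_chain n : ordered_angles (G n).
Proof.
elim: n => [|n IH].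
  split=> [i j /andP[ji ir]|i ir]; first by rewrite !G0 ?(leq_trans ji) //; exact: ang_refl.
  by rewrite G0 // /cnz /= expr1n expr0n addr0 ltr01.
(* Row [n] is overwritten by row [n.+1] one entry at a time; the intermediate rows mix both. *)
have step k : (k <= r)%N ->
    ordered_angles (fun i => if (i <= k)%N then G n.+1 i else G n i).
  elim: k => [|k IHk] kr.
    have := ordered_update0 (d_gt0 n) IH; congr ordered_angles; apply/funext => i.
    by rewrite /update -GS0 leqn0; case: eqVneq => [->|].
  have := ordered_updateS (c_gt0 n kr) kr (IHk (ltnW kr)).
  rewrite leqnn ltnn -GSS //; congr ordered_angles; apply/funext => i.
  by rewrite /update [(i <= k.+1)%N]leq_eqVlt ltnS; case: eqVneq => [->|].
have [oG nG] := step r (leqnn r).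
split=> [i j ij|i ir]; last by have := nG i ir; rewrite ir.
by have := oG i j ij; case/andP: ij => ji ir; rewrite ir (leq_trans ji ir).
Qed.

End HalfPlane.

(** * Real-rootedness of the chain *)

Section RealRoots.
Variable R : realType.

Local Notation evalC z p := (map_poly (real_complex R) p).[z].

Lemma split_real_rooted (p : {poly R}) n : p \is monic -> size p = n.+1 ->
  (forall z : R[i], root (map_poly (real_complex R) p) z -> complex.Im z = 0) ->
  exists z : 'I_n -> R, p = \prod_k ('X - (z k)%:P).
Proof.
move=> pm sp rp; set P := map_poly (real_complex R) p.
have [s Ps] := closed_field_poly_normal P.
have Pm : lead_coef P = 1.
  by rewrite lead_coef_map (monicP pm) rmorph1.
rewrite Pm scale1r in Ps.
have ss : size s = n.
  have : size P = n.+1 by rewrite size_map_poly.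
  by rewrite Ps size_prod_XsubC => -[].
exists (fun k => complex.Re s`_k).
apply: (map_inj_poly (@complexI R)) => //.
rewrite rmorph_prod /= -/P Ps (big_nth 0) ss big_mkord.
apply: eq_bigr => k _.
rewrite rmorphB /= map_polyX map_polyC /=; congr ('X - _%:P).
have : complex.Im s`_k = 0.
  by apply: rp; rewrite -/P Ps root_prod_XsubC mem_nth // ss.
by case: (s`_k) => a b /= ->.
Qed.

Variables (r : nat) (F : nat -> nat -> {poly R}).
Variables (d : nat -> R) (c : nat -> nat -> R).
Hypothesis F0 : forall k, (k <= r)%N -> F 0 k = 1.
Hypothesis FS0 : forall n, F n.+1 0 = 'X * F n r + d n *: F n 0.
Hypothesis FSS : forall n k, (k < r)%N -> F n.+1 k.+1 = F n.+1 k + c n k *: F n k.+1.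
Hypothesis d_gt0 : forall n, 0 < d n.
Hypothesis c_gt0 : forall n k, (k < r)%N -> 0 < c n k.

Let chain_upper n k (z : R[i]) : (k <= r)%N -> 0 < complex.Im z ->
  ~~ root (map_poly (real_complex R) (F n k)) z.
Proof.
case: z => p q kr /= q0; set z := Complex p q.
pose G n k := let w := evalC z (F n k) in (complex.Re w, complex.Im w).
have [|||_ nz] := @ordered_chain _ p q q0 r G d c _ _ _ d_gt0 c_gt0 n.
- by move=> j jr; rewrite /G F0 // rmorph1 hornerC.
- move=> m; rewrite /G FS0 rmorphD rmorphM /= map_polyX map_polyZ /=.
  rewrite hornerD hornerM hornerX hornerZ.
  case: (evalC z _) => a b; case: (evalC z _) => u v.
  by rewrite /cadd /cmul /=; simpc; congr (_, _); ring.
- move=> m j jr; rewrite /G FSS // rmorphD /= map_polyZ /= hornerD hornerZ.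
  case: (evalC z _) => a b; case: (evalC z _) => u v.
  by rewrite /cadd /=; simpc.
have := nz _ kr; rewrite /cnz /G /=; apply: contraL => /eqP ->.
by rewrite /= expr0n addr0 ltxx.
Qed.

Lemma chain_real_root n k (z : R[i]) : (k <= r)%N ->
  root (map_poly (real_complex R) (F n k)) z -> complex.Im z = 0.
Proof.
move=> kr rz; apply/eqP; case: (ltgtP (complex.Im z) 0) => // zi; last first.
  by have := chain_upper n kr zi; rewrite rz.
(* The coefficients are real, so a root in the lower half plane has its conjugate as a root in the
   upper one. *)
have zi' : 0 < complex.Im (z^*)%C by case: z zi {rz} => a b /=; rewrite oppr_gt0.
have := chain_upper n kr zi'; rewrite -complex_root_conj.
suff -> : map_poly conjc (map_poly (real_complex R) (F n k)) =
  map_poly (real_complex R) (F n k) by rewrite rz.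
by rewrite -map_poly_comp; apply: eq_map_poly => x /=; rewrite oppr0.
Qed.

End RealRoots.

(** * The linear functional with prescribed moments *)

Section MomentFunctional.
Variables (R : realType) (U : nat -> R).
Implicit Types (p q : {poly R}).

Definition momfun p : R := \sum_(j < size p) p`_j * U j.

Lemma momfun_wide N p : (size p <= N)%N -> momfun p = \sum_(j < N) p`_j * U j.
Proof.
move=> sN; rewrite /momfun (big_ord_widen N (fun j => p`_j * U j) sN) big_mkcond /=.
by apply: eq_bigr => j _; case: ltnP => // h; rewrite nth_default // mul0r.
Qed.

Lemma momfunD a p q : momfun (p + a *: q) = momfun p + a * momfun q.
Proof.
set N := maxn (size p) (size q).
rewrite !(@momfun_wide N) ?leq_maxl ?leq_maxr //; last first.
  by rewrite (leq_trans (size_polyD _ _)) // geq_max leq_maxl (leq_trans (size_scale_leq _ _)) ?leq_maxr.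
rewrite mulr_sumr -big_split /=; apply: eq_bigr => j _.
by rewrite coefD coefZ mulrDl mulrA.
Qed.

Lemma momfunMXn m : momfun 'X^m = U m.
Proof.
rewrite /momfun size_polyXn (bigD1 ord_max) //= coefXn eqxx mul1r big1 ?addr0 // => i.
by rewrite coefXn -val_eqE /= => /negPf ->; rewrite mul0r.
Qed.

Hypothesis U_bd : forall j, 0 <= U j <= 1.

(** The bound is uniform in [m], so that these values multiplied by [x ^- m] tend to 0 for
    [x > 1]. *)
Lemma momfun_bound p m : `|momfun ('X^m * p)| <= \sum_(j < size p) `|p`_j|.
Proof.
rewrite (@momfun_wide (m + size p)); last first.
  by rewrite mulrC (leq_trans (size_polyMleq _ _)) // size_polyXn addnS /= addnC.
rewrite big_split_ord /= big1 ?add0r => [|i _]; last first.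
  by rewrite coefXnM ltn_ord mul0r.
apply: (le_trans (ler_norm_sum _ _ _)); apply: ler_sum => j _.
rewrite coefXnM ltnNge leq_addr /= addKn normrM ler_piMr //.
by case/andP: (U_bd (m + j)) => U0 U1; rewrite ger0_norm.
Qed.

End MomentFunctional.

(** * Positivity of the chain on [[1, +oo[] *)

Section Positivity.
Variables (R : realType) (r : nat) (P : nat -> nat -> {poly R}).
Variables (d : nat -> R) (c : nat -> nat -> R) (U : nat -> R).
Hypothesis r_gt0 : (0 < r)%N.
Hypothesis P0 : forall k, (k <= r)%N -> P 0 k = 1.
Hypothesis PS0 : forall n, P n.+1 0 = 'X * P n r - d n *: P n 0.
Hypothesis PSS : forall n k, (k < r)%N -> P n.+1 k.+1 = P n.+1 k - c n k *: P n k.+1.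
Hypothesis d_gt0 : forall n, 0 < d n.
Hypothesis c_gt0 : forall n k, (k < r)%N -> 0 < c n k.
Hypothesis U_gt0 : forall j, 0 < U j.
Hypothesis U_le1 : forall j, U j <= 1.
Hypothesis U_ortho : forall n, momfun U (P n.+1 0) = 0.

Let A n k m := momfun U ('X^m * P n k).

Let A0 k m : (k <= r)%N -> A 0 k m = U m.
Proof. by move=> kr; rewrite /A P0 // mulr1 momfunMXn. Qed.

Let AS0 n m : A n r m.+1 = A n.+1 0 m + d n * A n 0 m.
Proof.
rewrite /A -momfunD PS0; congr momfun.
by rewrite -mul_polyC -mul_polyC exprS; ring.
Qed.

Let ASS n k m : (k < r)%N -> A n.+1 k m = A n.+1 k.+1 m + c n k * A n k.+1 m.
Proof.
by move=> kr; rewrite /A -momfunD PSS //; congr momfun; rewrite -!mul_polyC; ring.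
Qed.

Let row_ge0 m : (forall n, 0 <= A n r m) -> forall n k, (k <= r)%N -> 0 <= A n k m.
Proof.
move=> hr; elim=> [|n IHn] k kr; first by rewrite A0 // ltW.
move: {2}(r - k)%N (leqnn (r - k)) => j; elim: j k kr => [|j IHj] k kr rkj.
  by have /eqP -> : k == r by rewrite eqn_leq kr -subn_eq0 -leqn0.
move: kr; rewrite leq_eqVlt => /orP[/eqP -> //|kr].
rewrite ASS // addr_ge0 ?IHj ?leq_subLR //.
  by rewrite addSn -addnS -leq_subLR.
by rewrite mulr_ge0 ?IHn // ltW ?c_gt0.
Qed.

(** Induction on [m]: nonnegativity of column 0 at [m] gives column [r] at [m.+1] by [AS0], and
    [row_ge0] carries it back to all columns. Orthogonality to constants starts the induction, since
    [A n 0 0] is 0 for [n > 0]. *)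
Let A_ge0 m : (forall n, 0 <= A n 0 m) /\
  (forall n k, (k <= r)%N -> 0 <= A n k m.+1).
Proof.
have step l : (forall n, 0 <= A n 0 l) -> forall n k, (k <= r)%N -> 0 <= A n k l.+1.
  by move=> h0; apply: row_ge0 => n; rewrite AS0 addr_ge0 // mulr_ge0 // ltW.
elim: m => [|m [IH0 IH]].
  have h0 n : 0 <= A n 0 0.
    case: n => [|n]; first by rewrite A0 // ltW.
    by rewrite /A expr0 mul1r U_ortho.
  by split=> //; apply: step.
have h0 n : 0 <= A n 0 m.+1 by apply: IH.
by split=> //; apply: step.
Qed.

Let A_gt0 n k m : (k <= r)%N -> (n < m)%N -> 0 < A n k m.
Proof.
elim: n k m => [|n IH] k m kr nm; first by rewrite A0.
have key j l : (j < r)%N -> (n < l)%N -> 0 < A n.+1 j l.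
  case: l => // l jr nl; rewrite ASS // ltr_wpDl //.
    by apply: (A_ge0 l).2.
  by rewrite mulr_gt0 ?c_gt0 // IH.
move: kr; rewrite leq_eqVlt => /orP[/eqP ->|kr]; last by rewrite key // ltnW.
case: m nm => // m nm; rewrite AS0 ltr_wpDl //.
  by apply: (A_ge0 m).1.
by rewrite mulr_gt0 // key.
Qed.

(* The truncated functions of the second kind
   [l n k = \sum_m x ^- m * u (t ^+ m * P n k)] form a positive supersolution of
   the recurrence; the ratios (P n k).[x] / l n k are then nondecreasing. *)
Lemma chain_gt0 n k (x : R) : (k <= r)%N -> 1 < x -> 0 < (P n k).[x].
Proof.
move=> kr x1; have x0 : 0 < x := lt_trans ltr01 x1.
(* The first exponent for which [A_gt0] covers all rows up to [n]. *)
pose m0 := n.+1.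
(* The truncation [M] is taken so large that the term entering at [M] does not exceed the one
   leaving at [m0] when the sum is shifted by one. *)
have [M m0M HM] : exists2 M, (m0 < M)%N & forall i, (i <= n)%N ->
    x ^- M * A i r M <= x ^- m0 * A i r m0.
  pose B i := \sum_(j < size (P i r)) `|(P i r)`_j|.
  have : x ^- M @[M --> \oo] --> 0.
    have -> : (fun M : nat => x ^- M) = GRing.exp x^-1.
      by apply/funext => M; rewrite exprVn.
    by apply: cvg_expr; rewrite gtr0_norm ?invr_gt0 // invf_lt1.
  move=> /cvgrPdist_lt xM.
  have e_gt0 i : (i <= n)%N -> 0 < x ^- m0 * A i r m0 / (1 + B i).
    move=> ni; rewrite divr_gt0 // ?mulr_gt0 ?invr_gt0 ?exprn_gt0 //.
      by apply: A_gt0 => //; rewrite ltnS.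
    by rewrite ltr_pwDl // sumr_ge0.
  have /= : \forall M \near \oo, forall i : 'I_n.+1, x ^- M < x ^- m0 * A i r m0 / (1 + B i).
    apply: filter_forall => i.
    have := xM _ (e_gt0 i (ltn_ord i : i <= n)%N).
    apply: filterS => M /=; rewrite sub0r normrN gtr0_norm // invr_gt0 exprn_gt0 //.
  move=> [M0 _ HM0]; exists (maxn M0 m0.+1); first by rewrite leq_max leqnn orbT.
  move=> i ni; set M := maxn _ _.
  have := HM0 M (leq_maxl _ _) (Ordinal (ni : i < n.+1)%N) => /=.
  have Bi : 0 < 1 + B i by rewrite ltr_pwDl // sumr_ge0.
  rewrite ltr_pdivlMr // => /ltW; apply: le_trans.
  rewrite ler_wpM2l ?invr_ge0 ?exprn_ge0 ?(ltW x0) //.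
  apply: (le_trans (ler_norm _)); apply: (le_trans (momfun_bound _ _ _)).
    by move=> j; rewrite U_le1 ltW.
  by rewrite lerDr.
pose l i j := \sum_(m0 <= m < M) x ^- m * A i j m.
have lin a i1 j1 i2 j2 : l i1 j1 + a * l i2 j2 =
   \sum_(m0 <= m < M) x ^- m * (A i1 j1 m + a * A i2 j2 m).
  rewrite /l mulr_sumr -big_split /=; apply: eq_bigr => m _.
  by rewrite mulrDr mulrCA.
have l_gt0 i j : (i <= n)%N -> (j <= r)%N -> 0 < l i j.
  move=> ni jr; rewrite /l big_ltn // ltr_wpDr //.
    rewrite big_nat_cond sumr_ge0 // => m /andP[/andP[nm _] _].
    by rewrite mulr_ge0 ?invr_ge0 ?exprn_ge0 ?(ltW x0) // ltW // A_gt0 // (leq_ltn_trans ni) // ltnW.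
  by rewrite mulr_gt0 ?invr_gt0 ?exprn_gt0 // A_gt0.
(* Multiplication by [x] shifts the exponent; the two boundary terms are compared by [HM], whence an
   inequality here and an equality in [lSS]. *)
have lS0 i : (i < n)%N -> l i.+1 0 + d i * l i 0 <= x * l i r.
  move=> ni; rewrite lin.
  have -> : \sum_(m0 <= m < M) x ^- m * (A i.+1 0 m + d i * A i 0 m) =
     x * \sum_(m0.+1 <= m < M.+1) x ^- m * A i r m.
    rewrite [in RHS]big_add1 /= mulr_sumr; apply: eq_bigr => m _.
    rewrite AS0 exprS invfM !mulrA mulfV ?mul1r // gt_eqF //.
  rewrite ler_pM2l // big_nat_recr //= /l [leRHS]big_ltn // [leRHS]addrC lerD2l.
  by rewrite HM // ltnW.
have lSS i j : (i < n)%N -> (j < r)%N -> l i.+1 j = l i.+1 j.+1 + c i j * l i j.+1.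
  move=> ni jr; rewrite lin /l. by apply: eq_bigr => m _; rewrite ASS.
pose v i j := (P i j).[x].
have vS0 i : v i.+1 0 = x * v i r - d i * v i 0.
  by rewrite /v PS0 !hornerE.
have vSS i j : (j < r)%N -> v i.+1 j.+1 = v i.+1 j - c i j * v i j.+1.
  by move=> jr; rewrite /v PSS // !hornerE.
pose q i j := v i j / l i j.
have vq i j : (i <= n)%N -> (j <= r)%N -> v i j = q i j * l i j.
  by move=> ni jr; rewrite /q divfK // gt_eqF // l_gt0.
(* Invariant of the induction on rows: the last ratio of a row is its largest; the next row starts
   at or above it and increases. *)
suff [_ qn] : (forall j, (j <= r)%N -> q n j <= q n r) /\ forall j, (j <= r)%N -> 0 < q n j.
  by rewrite -/(v n k) vq // mulr_gt0 ?qn ?l_gt0.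
have: (n <= n)%N by []; elim: {-2}n => [|i IH] ni.
  have v0 j : (j <= r)%N -> v 0 j = 1 by move=> jr; rewrite /v P0 // hornerE.
  have l0 j : (j <= r)%N -> l 0 j = l 0 0.
    by move=> jr; rewrite /l; apply: eq_bigr => m _; rewrite !A0.
  split=> j jr; rewrite /q v0 ?l0 // ?v0 ?(l0 r) ?lexx //.
  by rewrite mul1r invr_gt0 l_gt0.
have [qr q0] := IH (ltnW ni); have ni' := ltnW ni.
have q'0 : q i r <= q i.+1 0.
  rewrite /q ler_pdivlMr ?l_gt0 // -/(q i r) vS0 !vq //.
  apply: (@le_trans _ _ (q i r * (x * l i r - d i * l i 0))).
    by rewrite ler_wpM2l ?(ltW (q0 _ _)) // lerBrDr lS0.
  rewrite mulrBr mulrCA lerB // [leRHS]mulrCA.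
  by rewrite ler_pM2l // ler_wpM2r ?(ltW (l_gt0 _ _ _ _)) // qr.
have q'S j : (j < r)%N -> q i r <= q i.+1 j -> q i.+1 j <= q i.+1 j.+1.
  move=> jr qj; rewrite [leRHS]/q ler_pdivlMr ?l_gt0 // vSS // !vq // ?(ltnW jr) //.
  rewrite (lSS i j) // mulrDr -addrA lerDl subr_ge0 [leRHS]mulrCA ler_pM2l ?c_gt0 //.
  by rewrite ler_wpM2r ?(ltW (l_gt0 _ _ _ _)) // (le_trans (qr _ _)).
have q'r j : (j <= r)%N -> q i r <= q i.+1 j.
  elim: j => // j IHj jr; apply: (le_trans (IHj (ltnW jr))).
  by apply: q'S => //; apply: IHj; apply: ltnW.
split=> [j jr|j jr]; last by rewrite (lt_le_trans (q0 r (leqnn r))) // q'r.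
move: {2}(r - j)%N (leqnn (r - j)) => e; elim: e j jr => [|e IHe] j jr rje.
  by have /eqP -> : j == r by rewrite eqn_leq jr -subn_eq0 -leqn0.
move: jr; rewrite leq_eqVlt => /orP[/eqP -> //|jr].
apply: (le_trans (q'S j jr (q'r _ (ltnW jr)))); apply: IHe => //.
by rewrite leq_subLR addSn -addnS -leq_subLR.
Qed.

(** Values at 1 are nonnegative because there is no root beyond 1. Strictness comes from the next
    member of the chain: its nonnegativity bounds the present value below by a positive multiple of
    a value already known to be positive. For [k = r] the next member is [P n.+2 0]. *)
Lemma chain_at1_gt0 n k : (k <= r)%N -> 0 < (P n k).[1].
Proof.
have ge0 i j : (j <= r)%N -> 0 <= (P i j).[1].
  move=> jr; rewrite leNgt; apply/negP => neg.
  have P2 : 0 < (P i j).[2] by apply: chain_gt0 => //; rewrite ltr1n.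
  have [||x x12 rx] := @poly_ivt R (P i j) 1 2; first by rewrite ler1n.
    by rewrite !ltW.
  move: x12; rewrite ?in_itv /= le_eqVlt => /andP[/orP[/eqP x1|x1] _].
    by move: neg; rewrite x1 (rootP rx) ltxx.
  by have := chain_gt0 i jr x1; rewrite (rootP rx) ltxx.
have vS0 i : (P i.+1 0).[1] = (P i r).[1] - d i * (P i 0).[1].
  by rewrite PS0 !hornerE.
have vSS i j : (j < r)%N -> (P i.+1 j.+1).[1] = (P i.+1 j).[1] - c i j * (P i j.+1).[1].
  by move=> jr; rewrite PSS // !hornerE.
elim: n k => [|n IH] k kr; first by rewrite P0 // hornerE.
have lt j : (j < r)%N -> 0 < (P n.+1 j).[1].
  move=> jr; have := ge0 n.+1 j.+1 jr; rewrite vSS // subr_ge0.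
  by apply: lt_le_trans; rewrite mulr_gt0 ?c_gt0 ?IH.
move: kr; rewrite leq_eqVlt => /orP[/eqP ->|]; last exact: lt.
have := ge0 n.+2 0 isT; rewrite vS0 subr_ge0; apply: lt_le_trans.
by rewrite mulr_gt0 // lt.
Qed.

End Positivity.

(** * Iterated finite differences of polynomials *)

Section FiniteDifferences.
Variable R : realType.

Lemma coef_XDC_exp (c : R) i j : (('X + c%:P) ^+ i)`_j = 'C(i, j)%:R * c ^+ (i - j).
Proof.
elim: i j => [|i IH] j; first by rewrite expr0 coef1 bin0n mulr1.
rewrite exprSr mulrDr coefD coefMX coefMC !IH; case: j => [|j] /=.
  by rewrite add0r !bin0 !subn0 exprSr mulrA.
rewrite binS natrD subSS mulrDl addrC; congr (_ + _).
have [ji|ij] := ltnP j i; last by rewrite bin_small // !mul0r.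
by rewrite -mulrA -exprSr subnSK.
Qed.

(** Replacing [q] by [q(X+1) - q] lowers the degree bound by one and multiplies the top coefficient
    by [n.+1]. It serves twice: for the orthogonality and for the alternating sums of [fuss]. *)
Lemma finite_difference (n : nat) (q : {poly R}) : (size q <= n.+1)%N ->
  \sum_(k < n.+1) (-1) ^+ (n - k) * 'C(n, k)%:R * q.[k%:R] = n`!%:R * q`_n.
Proof.
elim: n q => [|n IH] q sq.
  rewrite big_ord1 subnn expr0 !mul1r.
  by rewrite (size1_polyC sq) hornerC coefC.
pose Dq := q \Po ('X + 1) - q.
have cD j : Dq`_j = \sum_(i < n.+2) q`_i * ('C(i, j)%:R - (i == j :> nat)%:R).
  have Eq : q \Po ('X + 1) = \sum_(i < n.+2) q`_i *: ('X + 1) ^+ i.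
    rewrite comp_polyE (big_ord_widen _ (fun i => q`_i *: ('X + 1) ^+ i) sq) big_mkcond /=.
    by apply: eq_bigr => i _; case: ltnP => // h; rewrite nth_default // scale0r.
  have Eq' : q = \sum_(i < n.+2) q`_i *: 'X^i.
    rewrite -[LHS]coefK poly_def (big_ord_widen _ (fun i => q`_i *: 'X^i) sq) big_mkcond /=.
    by apply: eq_bigr => i _; case: ltnP => // h; rewrite nth_default // scale0r.
  rewrite /Dq {}Eq coefB {2}Eq' !coef_sum -sumrB; apply: eq_bigr => i _.
  by rewrite !coefZ -polyC1 coef_XDC_exp expr1n mulr1 coefXn eq_sym mulrBr.
have sD : (size Dq <= n.+1)%N.
  apply/leq_sizeP => j nj; rewrite cD big1 // => i _.
  have [ij|ji|->] := ltngtP i j; last by rewrite binn subrr mulr0.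
    by rewrite bin_small // subrr mulr0.
  by have := ltn_ord i; rewrite ltnS => /(leq_trans ji); rewrite ltnNge nj.
have cDn : Dq`_n = n.+1%:R * q`_n.+1.
  rewrite cD big_ord_recr big_ord_recr /= big1 => [|i _]; last first.
    by rewrite bin_small // (ltn_eqF (ltn_ord i)) subrr mulr0.
  by rewrite binn eqxx subrr mulr0 !add0r (gtn_eqF (ltnSn n)) subr0 binSn mulrC.
rewrite factS natrM mulrAC mulrC -cDn -IH //.
have -> : \sum_(k < n.+1) (-1) ^+ (n - k) * 'C(n, k)%:R * Dq.[k%:R] =
  \sum_(k < n.+1) (-1) ^+ (n - k) * 'C(n, k)%:R * q.[k.+1%:R] -
  \sum_(k < n.+1) (-1) ^+ (n - k) * 'C(n, k)%:R * q.[k%:R].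
  rewrite -sumrB; apply: eq_bigr => k _.
  by rewrite -mulrBr /Dq hornerD hornerN horner_comp !hornerE natr1.
rewrite big_ord_recl [in X in _ - X]big_ord_recl /= !bin0 !subn0 !mulr1.
have -> : \sum_(i < n.+1) (-1) ^+ (n.+1 - bump 0 i) * 'C(n.+1, bump 0 i)%:R * q.[(bump 0 i)%:R]
  = \sum_(i < n.+1) (-1) ^+ (n - i) * 'C(n, i)%:R * q.[i.+1%:R] +
    \sum_(i < n.+1) (-1) ^+ (n - i) * 'C(n, i.+1)%:R * q.[i.+1%:R].
  rewrite -big_split /=; apply: eq_bigr => i _.
  by rewrite /bump add1n subSS binS natrD; ring.
rewrite [X in _ + (_ + X)]big_ord_recr /= (@bin_small n n.+1) // mulr0 mul0r addr0.
have -> : \sum_(i < n) (-1) ^+ (n - bump 0 i) * 'C(n, bump 0 i)%:R * q.[(bump 0 i)%:R]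
  = - \sum_(i < n) (-1) ^+ (n - i) * 'C(n, i.+1)%:R * q.[i.+1%:R].
  rewrite -sumrN; apply: eq_bigr => i _; rewrite /bump add1n.
  by rewrite -[(n - i)%N]subSS subSn // exprS; ring.
by rewrite exprS; ring.
Qed.

End FiniteDifferences.

(** * Cyclic increments of the parameters [b] *)

Section Shifts.
Variable r : nat.
Hypothesis r_gt0 : (0 < r)%N.

(** This is [ceil((m - j) / r)] for [j < r]: how often parameter [j] has been raised after [m]
    single increments, where increment number [m] (from 0) acts on index [m %% r]. *)
Definition stepshift (m j : nat) : nat := ((m + (r.-1 - j)) %/ r)%N.

Lemma stepshift0 j : stepshift 0 j = 0%N.
Proof. by rewrite /stepshift add0n divn_small // (leq_ltn_trans (leq_subr _ _)) // prednK. Qed.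

Lemma stepshiftDr m j : stepshift (m + r) j = (stepshift m j).+1.
Proof. by rewrite /stepshift addnAC divnDr // divnn r_gt0 addn1. Qed.

Lemma stepshift_modn m : stepshift m (m %% r) = (m %/ r)%N.
Proof.
rewrite /stepshift {1}(divn_eq m r) -addnA divnMDl // subnKC; last first.
  by rewrite -ltnS (prednK r_gt0) ltn_mod.
by rewrite (@divn_small r.-1) ?addn0 // ltn_predL.
Qed.

Lemma stepshiftS m j : (j < r)%N -> stepshift m.+1 j = (stepshift m j + (j == m %% r))%N.
Proof.
move=> jr; rewrite /stepshift addSn divnS // addnC; congr (_ + _)%N; congr nat_of_bool.
have h : (m.+1 + (r.-1 - j) + j = m + r)%N.
  rewrite -addnA subnK; first by rewrite addSnnS prednK.
  by rewrite -ltnS prednK.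
rewrite /dvdn -addSn -[X in _ == X](mod0n r) -(eqn_modDr j) h modnDr add0n eq_sym.
by rewrite (modn_small jr).
Qed.

Lemma sum_shift m : (\sum_(j < r) stepshift m j = m)%N.
Proof.
elim: m => [|m IH]; first by rewrite big1 // => j _; rewrite stepshift0.
have mr : (m %% r < r)%N by rewrite ltn_mod.
rewrite (eq_bigr (fun j : 'I_r => (stepshift m j + (j == Ordinal mr))%N)); last first.
  by move=> j _; rewrite stepshiftS // -val_eqE.
rewrite big_split /= IH (bigD1 (Ordinal mr)) //= eqxx big1 ?addn0 ?addn1 // => j.
by move=> /negPf ->.
Qed.

End Shifts.

(** * The chain through the polynomials, and their orthogonality *)

Section ZerosInUnitInterval.
Variables (R : realType) (r : nat) (a b : 'I_r -> R).
Hypothesis r_gt0 : (0 < r)%N.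
Hypothesis a_gt0 : forall i : 'I_r, 0 < a i.
Hypothesis b_gt0 : forall j : 'I_r, 0 < b j.
Hypothesis ab_le : forall i j : 'I_r, (i <= j)%N -> a i < b j.
Hypothesis ab_gt : forall i j : 'I_r, (j.+1 <= i)%N -> a i - 1 < b j.

Definition sbeta m : 'I_r -> R := fun j => b j + (stepshift r m j)%:R.

Definition salpha k : 'I_r -> R := fun i => a i + (i < k)%:R.

Lemma sbeta_gt0 m j : 0 < sbeta m j.
Proof. by rewrite ltr_wpDr. Qed.

Lemma salpha_gt0 k i : 0 < salpha k i.
Proof. by rewrite ltr_wpDr. Qed.

Let res m : 'I_r := Ordinal (ltn_pmod m r_gt0).

Lemma sbetaS m : sbeta m.+1 = incr (sbeta m) (res m).
Proof.
apply/funext => j; rewrite /sbeta /incr stepshiftS // natrD addrA.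
by rewrite -val_eqE.
Qed.

Lemma salphaS k (kr : (k < r)%N) : salpha k.+1 = incr (salpha k) (Ordinal kr).
Proof.
apply/funext => i; rewrite /salpha /incr -addrA -natrD -val_eqE /=.
by rewrite ltnS leq_eqVlt; case: ltngtP.
Qed.

Lemma salpha0 : salpha 0 = a.
Proof. by apply/funext => i; rewrite /salpha addr0. Qed.

Lemma salphar : salpha r = fun i => a i + 1.
Proof. by apply/funext => i; rewrite /salpha ltn_ord. Qed.

Lemma sbetaDr m : sbeta (m + r) = fun j => sbeta m j + 1.
Proof. by apply/funext => i; rewrite /sbeta stepshiftDr // -natr1 addrA. Qed.

Lemma sbeta0 : sbeta 0 = b.
Proof. by apply/funext => i; rewrite /sbeta stepshift0 // addr0. Qed.

(** If the residue of [n + k] is at least [k], then [ab_le] applies. Otherwise [n + k >= r], so the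
    parameter [b] concerned has been raised at least once, and [ab_gt] suffices. *)
Lemma salpha_lt_sbeta n k (kr : (k < r)%N) :
  salpha k (Ordinal kr) < sbeta (n + k) (res (n + k)).
Proof.
rewrite /salpha /sbeta /= ltnn addr0 stepshift_modn //.
have [kj|jk] := leqP k ((n + k) %% r).
  by rewrite ltr_wpDr // ab_le.
have q1 : (0 < (n + k) %/ r)%N.
  rewrite divn_gt0 // leqNgt; apply/negP => /modn_small E.
  by move: jk; rewrite E ltnNge leq_addl.
rewrite (@lt_le_trans _ _ (b (res (n + k)) + 1)) //.
  by rewrite -ltrBlDr ab_gt.
by rewrite lerD2l ler1n.
Qed.

(** Within a row each step raises one [a] and one [b]; at [k = r] all [a] are raised, which is the
    polynomial multiplied by ['X] in [hpoly_step]. At [n = k = 0] the predecessor is truncated,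
    harmlessly since the polynomial is then 1. *)
Definition chain n k : {poly R} := hpoly n (salpha k) (sbeta (n + k).-1).

Lemma chain_rec : exists (d : nat -> R) (c : nat -> nat -> R),
  [/\ forall n, 0 < d n,
      forall n k, (k < r)%N -> 0 < c n k,
      forall n, chain n.+1 0 = 'X * chain n r + d n *: chain n 0 &
      forall n k, (k < r)%N -> chain n.+1 k.+1 = chain n.+1 k + c n k *: chain n k.+1].
Proof.
pose d n := if n is n'.+1 then
  (\prod_i (a i + n%:R) / \prod_j (sbeta n' j + n%:R)) *
    (sbeta n' (res n') / (sbeta n' (res n') + n.+1%:R))
  else \prod_i a i / \prod_i b i.
pose c n k := if insub k is Some i then
  (n.+1%:R * (\prod_i (salpha k i + n%:R) / \prod_j (sbeta (n + k) j + n%:R)) *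
    ((sbeta (n + k) (res (n + k)) - salpha k i) /
     ((sbeta (n + k) (res (n + k)) + n.+1%:R) * (salpha k i + n%:R)))) else 0.
have sg m := sbeta_gt0 m; have ag k := salpha_gt0 k.
exists d, c; split.
- case=> [|n]; first by rewrite /d divr_gt0 // prodr_gt0.
  by rewrite /d mulr_gt0 ?divr_gt0 ?prod_shift_gt0 // ltr_wpDr.
- move=> n k kr; rewrite /c insubT mulr_gt0 //.
    by rewrite mulr_gt0 ?divr_gt0 ?prod_shift_gt0.
  by rewrite divr_gt0 ?subr_gt0 ?salpha_lt_sbeta // mulr_gt0 // ltr_wpDr.
- case=> [|n]; rewrite /chain salpha0 salphar !addn0 /=.
    by rewrite !hpoly0 hpoly1 mulr1 alg_polyC sbeta0.
  by rewrite sbetaS hpoly_step // sbetaDr.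
- move=> n k kr; rewrite /chain /c insubT /= (salphaS kr) !addnS /= sbetaS.
  exact: hpoly_incr.
Qed.

Definition hmonic n k : {poly R} := (-1) ^+ n *: (chain n k \Po (- 'X)).

Lemma coef_hmonic n k j : (hmonic n k)`_j = (-1) ^+ (n + j) * (chain n k)`_j.
Proof.
have E : forall p : {poly R}, (p \Po (- 'X))`_j = (-1) ^+ j * p`_j.
  move=> p; rewrite comp_polyE coef_sum.
  rewrite (eq_bigr (fun i : 'I__ => (if j == i then (-1) ^+ j * p`_j else 0))); last first.
    move=> i _; rewrite -scaleN1r exprZn !coefZ coefXn.
    by case: eqP => [->|_]; [rewrite mulr1 mulrC|rewrite !mulr0].
  have [jp|pj] := ltnP j (size p).
    rewrite (bigD1 (Ordinal jp)) //= eqxx big1 ?addr0 // => i.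
    by rewrite -val_eqE /= eq_sym => /negPf ->.
  by rewrite (nth_default _ pj) mulr0 big1 // => i _; case: eqP.
by rewrite /hmonic coefZ E mulrA -exprD.
Qed.

(** Moments of a product of independent Beta variables with parameters [a i] and [b i - a i]. *)
Definition ratio_moment m : R := \prod_i (poch (a i) m / poch (b i) m).

Lemma ratio_moment_gt0 m : 0 < ratio_moment m.
Proof. by apply: prodr_gt0 => i _; rewrite divr_gt0 ?poch_gt0. Qed.

Lemma ratio_moment_le1 m : ratio_moment m <= 1.
Proof.
rewrite -[1](@big1_eq _ _ *%R 'I_r (index_enum 'I_r) xpredT); apply: ler_prod => i _.
rewrite divr_ge0 ?(ltW (poch_gt0 _ _)) //= ler_pdivrMr ?poch_gt0 // mul1r.
apply: ler_prod => j _; rewrite addr_ge0 ?(ltW (a_gt0 _)) //=.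
by rewrite lerD2r ltW // ab_le.
Qed.

(** Because [(b+s)_k / (b)_k = (b+k)_s / (b)_s], coefficient times moment is a signed binomial times
    a polynomial [q] in [k]. Its degree is at most the total shift, which is [n] by [sum_shift], so
    its difference of order [n.+1] vanishes. *)
Lemma momfun_hmonic n : momfun ratio_moment (hmonic n.+1 0) = 0.
Proof.
pose s (i : 'I_r) := stepshift r n i.
pose q : {poly R} := \prod_i \prod_(l < s i) ('X + (b i + l%:R)%:P).
have sq : (size q <= n.+1)%N.
  have /= : (size q <= (\sum_(i < r) s i).+1)%N.
    rewrite /q; elim/big_rec2: _ => [|i m p _ H]; first by rewrite size_poly1.
    have B : (size (\prod_(l < s i) ('X + (b i + l%:R)%:P) : {poly R})%R <= (s i).+1)%N.
      elim: (s i) => [|l IH]; first by rewrite big_ord0 size_poly1.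
      rewrite big_ord_recr /= (leq_trans (size_polyMleq _ _)) // size_XaddC addn2 /=.
      by rewrite ltnS.
    rewrite (leq_trans (size_polyMleq _ _)) // -subn1 leq_subLR.
    by rewrite (leq_trans (leq_add B H)) // addSn addnS.
  by rewrite sum_shift.
have := @finite_difference R n.+1 q (leqW sq).
rewrite (nth_default _ sq) mulr0 => FD.
rewrite (@momfun_wide _ _ n.+2); last first.
  by apply/leq_sizeP => j nj; rewrite coef_hmonic coef_hpoly /hcoef bin_small // mul0r mulr0.
pose K : R := \prod_i poch (a i) n.+1 / \prod_i poch (sbeta n i) n.+1 / \prod_i poch (b i) (s i).
suff E : forall k : 'I_n.+2, (hmonic n.+1 0)`_k * ratio_moment k =
    K * ((-1) ^+ (n.+1 - k) * 'C(n.+1, k)%:R * q.[k%:R]).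
  by under eq_bigr do rewrite E; rewrite -mulr_sumr FD mulr0.
move=> k; have kn : (k <= n.+1)%N by rewrite -ltnS.
rewrite coef_hmonic coef_hpoly /hcoef salpha0 addn0 /= /ratio_moment big_split /= prodfV.
have -> : (-1) ^+ (n.+1 + k) = (-1) ^+ (n.+1 - k) :> R.
  by rewrite -(signr_odd _ (_ + _)) -(signr_odd _ (_ - _)) oddD oddB.
have sp (g : 'I_r -> R) : \prod_i poch (g i) n.+1 =
   \prod_i poch (g i) k * \prod_i poch (g i + k%:R) (n.+1 - k).
  by rewrite -big_split /=; apply: eq_bigr => i _; rewrite -pochD subnKC.
have qE : q.[k%:R] = \prod_i poch (b i + k%:R) (s i).
  rewrite /q horner_prod; apply: eq_bigr => i _; rewrite horner_prod /poch.
  by apply: eq_bigr => l _; rewrite hornerD hornerX hornerC addrA addrC [RHS]addrAC addrC; ring.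
have bE : \prod_i poch (b i) (s i) * \prod_i poch (sbeta n i) k =
   \prod_i poch (b i) k * \prod_i poch (b i + k%:R) (s i).
  rewrite -!big_split /=; apply: eq_bigr => i _.
  by rewrite -!pochD addnC.
have pos (g : 'I_r -> R) m : (forall i, 0 < g i) -> \prod_i poch (g i) m != 0.
  by move=> hg; rewrite gt_eqF // prodr_gt0 // => i _; rewrite poch_gt0.
rewrite qE /K !sp.
have h1 := pos _ k b_gt0; have h2 := pos _ k (sbeta_gt0 n).
have h3 : \prod_i poch (sbeta n i + k%:R) (n.+1 - k) != 0.
  by apply: pos => i; rewrite ltr_wpDr ?sbeta_gt0.
have h4 : \prod_i poch (b i) (s i) != 0.
  by rewrite gt_eqF // prodr_gt0 // => i _; rewrite poch_gt0.
rewrite -(mulKf h1 (\prod_i poch (b i + k%:R) (s i))) -bE.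
field; rewrite h1 h2 h3 h4 //.
Qed.

End ZerosInUnitInterval.

(** * The given sequence: identification with the chain and location of its zeros *)

Section PseqZeros.
Variables (R : realType) (r : nat) (a b : 'I_r -> R).
Hypothesis r_gt0 : (0 < r)%N.
Hypothesis a_gt0 : forall i : 'I_r, 0 < a i.
Hypothesis b_gt0 : forall j : 'I_r, 0 < b j.
Hypothesis ab_le : forall i j : 'I_r, (i <= j)%N -> a i < b j.
Hypothesis ab_gt : forall i j : 'I_r, (j.+1 <= i)%N -> a i - 1 < b j.

Lemma bshiftE n j : bshift b n.+1 j = sbeta b n j.
Proof.
rewrite /bshift /sbeta; congr (_ + _).
suff -> : Num.ceil ((n.+1%:R - j.+1%:R) / r%:R : R) = (stepshift r n j)%:Z.
  by [].
have r0 : 0 < r%:R :> R by rewrite ltr0n.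
have i1 k : (Posz k - 1)%:~R = k%:R - 1 :> R by rewrite intrB.
have i2 k : (Posz k)%:~R = k%:R :> R by [].
apply: ceil_def; rewrite ltr_pdivlMr // ler_pdivrMr // i1 i2.
have jr := ltn_ord j.
have := divn_eq (n + (r.-1 - j)) r; rewrite -/(stepshift r n j).
have := ltn_pmod (n + (r.-1 - j)) r_gt0.
set s := stepshift r n j; set m := (_ %% r)%N => mr E.
have E' : (n + r = s * r + m + j.+1)%N by lia.
have {}E' : n%:R + r%:R = s%:R * r%:R + m%:R + j.+1%:R :> R.
  by rewrite -natrM -!natrD E'.
have mr' : m%:R + 1 <= r%:R :> R by rewrite natr1 ler_nat.
have m0 : 0 <= m%:R :> R by [].
rewrite mulrBl mul1r; move: E' => /=; rewrite -!natr1 => E'.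
by apply/andP; split; lra.
Qed.

Lemma poch_opp n k : poch (- n%:R : R) k = (-1) ^+ k * (n ^_ k)%:R.
Proof.
elim: k => [|k IH]; first by rewrite poch0 ffactn0 mulr1.
rewrite pochSr IH ffactnSr exprS.
have [kn|nk] := leqP k n; last by rewrite ffact_small // mul0n mulr0 mul0r mulr0.
rewrite natrM natrB //; ring.
Qed.

(** The upper parameter [-n] makes the series terminate: its partial sums are constant from index
    [n.+1] on. *)
Lemma Pseq_hmonic n x : (0 < n)%N -> Pseq a b n x = (hmonic a b n 0).[x].
Proof.
case: n => // n _; rewrite /Pseq.
have bE : [seq bshift b n.+1 j | j : 'I_r] = [seq sbeta b n j | j : 'I_r].
  by apply: eq_map => j; rewrite bshiftE.
have -> : \prod_(j < r) poch (bshift b n.+1 j) n.+1 = \prod_j poch (sbeta b n j) n.+1.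
  by apply: eq_bigr => j _; rewrite bshiftE.
rewrite bE.
pose t k := (\prod_(u <- - n.+1%:R :: [seq sbeta b n j | j : 'I_r]) poch u k) /
  (\prod_(v <- [seq a i | i : 'I_r]) poch v k) * (x ^+ k / k`!%:R).
have tE k : t k = (-1) ^+ k * 'C(n.+1, k)%:R * 
   (\prod_i poch (sbeta b n i) k / \prod_i poch (a i) k) * x ^+ k.
  rewrite /t big_cons !big_image /= poch_opp -bin_ffact natrM.
  have k0 : k`!%:R != 0 :> R by rewrite pnatr_eq0 -lt0n fact_gt0.
  have p0 : \prod_i poch (a i) k != 0.
    by rewrite gt_eqF // prodr_gt0 // => i _; rewrite poch_gt0.
  by field; rewrite k0 p0.
have -> : hypF (- n.+1%:R :: [seq sbeta b n j | j : 'I_r]) [seq a i | i : 'I_r] x =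
    \sum_(k < n.+2) t k.
  apply: cvg_lim => //; apply: cvg_near_cst; exists n.+2 => // N /= nN.
  rewrite /series /= -/t -(big_mkord xpredT t) (@big_cat_nat _ _ _ n.+2) //=.
  rewrite [X in _ + X]big_nat_cond [X in _ + X]big1 ?addr0 // => k /andP[/andP[nk _] _].
  by rewrite -/(t k) tE bin_small // mulr0 !mul0r.
have sz : (size (hmonic a b n.+1 0) <= n.+2)%N.
  by apply/leq_sizeP => j nj; rewrite coef_hmonic coef_hpoly /hcoef bin_small // mul0r mulr0.
rewrite (horner_coef_wide _ sz) mulr_sumr; apply: eq_bigr => k _.
have kn : (k <= n.+1)%N by rewrite -ltnS.
rewrite coef_hmonic coef_hpoly tE /hcoef salpha0 addn0 /= exprD.
have sp (g : 'I_r -> R) : \prod_i poch (g i) n.+1 =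
   \prod_i poch (g i) k * \prod_i poch (g i + k%:R) (n.+1 - k).
  by rewrite -big_split /=; apply: eq_bigr => i _; rewrite -pochD subnKC.
have pos (g : 'I_r -> R) m : (forall i, 0 < g i) -> \prod_i poch (g i) m != 0.
  by move=> hg; rewrite gt_eqF // prodr_gt0 // => i _; rewrite poch_gt0.
rewrite !sp.
have sg i := sbeta_gt0 b_gt0 n i.
have h1 := pos _ k a_gt0; have h2 := pos _ k sg.
have h3 : \prod_i poch (sbeta b n i + k%:R) (n.+1 - k) != 0.
  by apply: pos => i; rewrite ltr_wpDr ?sg.
by field; rewrite h1 h2 h3.
Qed.

Lemma hmonic_split n : exists2 z : 'I_n -> R,
  hmonic a b n 0 = \prod_k ('X - (z k)%:P) & forall k, 0 < z k < 1.
Proof.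
have [d [c [d0 c0 F0 FS]]] := chain_rec r_gt0 a_gt0 b_gt0 ab_le ab_gt.
have c1 k : (k <= r)%N -> chain a b 0 k = 1 by move=> _; rewrite /chain hpoly0.
have real (z : R[i]) : root (map_poly (real_complex R) (chain a b n 0)) z ->
    complex.Im z = 0.
  exact: (@chain_real_root R r (chain a b) d c c1 F0 FS d0 c0).
have [w wE] := split_real_rooted (hpoly_monic _ _ _) (size_hpoly _ _ _) real.
rewrite -/(chain a b n 0) in wE.
have hE : hmonic a b n 0 = \prod_k ('X - (- w k)%:P).
  rewrite /hmonic wE rmorph_prod /= -mul_polyC rmorph_sign -[n in _ ^+ n]card_ord.
  rewrite -prodrN; apply: eq_bigr => k _.
  by rewrite rmorphB /= comp_polyX comp_polyC polyCN opprB !opprK addrC.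
exists (fun k => - w k) => [|k]; first exact: hE.
have zk : root (hmonic a b n 0) (- w k).
  by rewrite hE /root horner_prod (bigD1 k) //= !hornerE subrr mul0r.
apply/andP; split.
  (* The chain polynomial has positive coefficients, hence no root in [[0, +oo[]. *)
  rewrite oppr_gt0 ltNge; apply/negP => wk.
  have : root (chain a b n 0) (w k) by rewrite wE /root horner_prod (bigD1 k) //= !hornerE subrr mul0r.
  rewrite rootE horner_coef gt_eqF // size_hpoly big_ord_recl /=.
  have hp j : (j <= n)%N -> 0 < (chain a b n 0)`_j.
    by move=> jn; rewrite coef_hpoly hcoef_gt0 // => i; rewrite ?salpha_gt0 ?sbeta_gt0.
  rewrite ltr_wpDr ?sumr_ge0 // ?mulr_gt0 ?hp // => i _.
  by rewrite mulr_ge0 ?exprn_ge0 // ltW // hp.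
rewrite ltNge; apply/negP => z1.
(* The substitution of [- 'X] turns the recurrences with plus signs into those required for
   positivity beyond 1. *)
have P0 k' : (k' <= r)%N -> hmonic a b 0 k' = 1.
  by move=> kr; rewrite /hmonic c1 // expr0 scale1r comp_polyC.
have PS0 m : hmonic a b m.+1 0 = 'X * hmonic a b m r - d m *: hmonic a b m 0.
  rewrite /hmonic F0 rmorphD /= rmorphM /= comp_polyX comp_polyZ exprS.
  by rewrite -!mul_polyC rmorphM rmorphN1 /=; ring.
have PSS m k' : (k' < r)%N -> hmonic a b m.+1 k'.+1 = hmonic a b m.+1 k' - c m k' *: hmonic a b m k'.+1.
  move=> kr; rewrite /hmonic FS // rmorphD /= comp_polyZ exprS.
  by rewrite -!mul_polyC rmorphM rmorphN1 /=; ring.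
have ug := ratio_moment_gt0 a_gt0 b_gt0; have u1 := ratio_moment_le1 a_gt0 b_gt0 ab_le.
have uo m : momfun (ratio_moment a b) (hmonic a b m.+1 0) = 0 by exact: momfun_hmonic.
suff : 0 < (hmonic a b n 0).[- w k] by rewrite (rootP zk) ltxx.
move: z1; rewrite le_eqVlt => /orP[/eqP <-|z1].
  exact: (@chain_at1_gt0 R r (hmonic a b) d c _ r_gt0 P0 PS0 PSS d0 c0 ug u1 uo).
exact: (@chain_gt0 R r (hmonic a b) d c _ r_gt0 P0 PS0 PSS d0 c0 ug u1 uo).
Qed.

End PseqZeros.

(** * Second moment of the Bernoulli sum *)

Section Concentration.
Variable R : realType.

(* The weights [p`_k * y ^+ k / p.[y]] are the law of a sum of independent
   Bernoulli variables with parameters [y / (y + x k)]. *)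
Lemma coef_second_moment n (x : 'I_n -> R) (y c : R) : 0 < y -> (forall k, 0 < x k) ->
  let p := \prod_k ('X + (x k)%:P) in
  \sum_(k < n.+1) p`_k * y ^+ k * (k%:R - c) ^+ 2 =
  p.[y] * (\sum_k y * x k / (y + x k) ^+ 2 + (\sum_k y / (y + x k) - c) ^+ 2).
Proof.
move=> y0; elim: n x c => [|n IH] x c x0 /=.
  rewrite !big_ord0 big_ord1 coef1 expr0 (_ : (1 : {poly R}).[y] = 1) ?hornerE //=.
  ring.
set x' := fun k : 'I_n => x (widen_ord (leqnSn n) k).
set t := x ord_max; pose q := \prod_(k < n) ('X + (x' k)%:P).
have -> : \prod_(k < n.+1) ('X + (x k)%:P) = q * ('X + t%:P) by rewrite big_ord_recr.
have -> : \sum_(k < n.+1) y * x k / (y + x k) ^+ 2 =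
  \sum_(k < n) y * x' k / (y + x' k) ^+ 2 + y * t / (y + t) ^+ 2 by rewrite big_ord_recr.
have -> : \sum_(k < n.+1) y / (y + x k) = \sum_(k < n) y / (y + x' k) + y / (y + t).
  by rewrite big_ord_recr.
have IH' e := IH x' e (fun k => x0 (widen_ord (leqnSn n) k)).
have t0 : 0 < t by apply: x0.
have sq : (size q <= n.+1)%N.
  rewrite /q (eq_bigr (fun k => 'X - (- x' k)%:P)); last first.
    by move=> k _; rewrite polyCN opprK.
  by rewrite size_prod_XsubC [index_enum _]unlock -enumT size_enum_ord.
have -> : \sum_(k < n.+2) (q * ('X + t%:P))`_k * y ^+ k * (k%:R - c) ^+ 2 =
   y * \sum_(k < n.+1) q`_k * y ^+ k * (k%:R - (c - 1)) ^+ 2 +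
   t * \sum_(k < n.+1) q`_k * y ^+ k * (k%:R - c) ^+ 2.
  under eq_bigr do rewrite mulrDr coefD coefMX coefMC 2!mulrDl.
  rewrite big_split /=; congr (_ + _).
    rewrite big_ord_recl /= mul0r mul0r add0r mulr_sumr; apply: eq_bigr => k _.
    by rewrite /bump add1n /= exprS -natr1; ring.
  rewrite big_ord_recr /= (nth_default _ sq) !mul0r addr0 mulr_sumr.
  by apply: eq_bigr => k _; ring.
rewrite !IH' hornerM hornerD hornerX hornerC -/q.
set V := \sum_(k < n) _; set M := \sum_(k < n) _.
have yt : y + t != 0 by rewrite gt_eqF // addr_gt0.
by field.
Qed.

Lemma prod_perturb m (B : R) (u v : 'I_m -> R) : 1 <= B ->
  (forall i, `|u i| <= B) -> (forall i, `|v i| <= B) ->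
  `|\prod_i u i - \prod_i v i| <= B ^+ m * \sum_i `|u i - v i|.
Proof.
move=> B1; have B0 : 0 <= B := le_trans ler01 B1.
elim: m u v => [|m IH] u v uB vB; first by rewrite !big_ord0 subrr normr0 mulr0.
rewrite !big_ord_recr /=.
set U := \prod_(i < m) _; set V := \prod_(i < m) _; set S := \sum_(i < m) _.
have IH' : `|U - V| <= B ^+ m * S by apply: IH.
have VB : `|V| <= B ^+ m.
  rewrite normr_prod -[m in leRHS]card_ord -prodr_const ler_prod // => i _.
  by rewrite normr_ge0 vB.
have -> : U * u ord_max - V * v ord_max = (U - V) * u ord_max + V * (u ord_max - v ord_max) by ring.
rewrite (le_trans (ler_normD _ _)) // !normrM exprS mulrDr lerD //.
  by rewrite mulrC -mulrA ler_pM.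
rewrite ler_wpM2r // (le_trans VB) // ler_peMl // exprn_ge0 //.
Qed.

End Concentration.

(** * The approximate algebraic equation for [w] *)

Section AlgebraicEquation.
Variables (R : realType) (r : nat) (a b : 'I_r -> R).
Hypothesis r_gt0 : (0 < r)%N.
Hypothesis a_gt0 : forall i : 'I_r, 0 < a i.
Hypothesis b_gt0 : forall j : 'I_r, 0 < b j.

Lemma hcoef_rec n (al be : 'I_r -> R) k : (forall i, 0 < al i) -> (forall i, 0 < be i) ->
  (k < n)%N ->
  k.+1%:R * \prod_i (al i + k%:R) * hcoef n al be k.+1 =
  (n - k)%:R * \prod_i (be i + k%:R) * hcoef n al be k.
Proof.
move=> al0 be0 kn; rewrite /hcoef.
have sp (g : 'I_r -> R) : \prod_i poch (g i + k%:R) (n - k) =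
   \prod_i (g i + k%:R) * \prod_i poch (g i + k.+1%:R) (n - k.+1).
  rewrite -big_split /=; apply: eq_bigr => i _.
  by rewrite -[(n - k)%N]subSS subSn // pochSl -addrA natr1.
rewrite !sp.
have B : k.+1%:R * 'C(n, k.+1)%:R = (n - k)%:R * 'C(n, k)%:R :> R.
  by rewrite -!natrM -mul_bin_left mulnC.
have := prod_shift_gt0 k be0; have := prod_poch_gt0 k.+1 (n - k.+1) be0.
set S := \prod_i poch _ _; set T := \prod_i _ => S0 T0.
transitivity (k.+1%:R * 'C(n, k.+1)%:R * (\prod_i (al i + k%:R) * (\prod_i poch (al i + k.+1%:R) (n - k.+1) / S))).
  by ring.
by rewrite B; field; rewrite !gt_eqF.
Qed.

(** [hcoef_rec] times [y ^+ k.+1], summed over [k]: the index shift rewrites [al + k] as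
    [al - 1 + k.+1], and the end terms vanish through the factors [k] and [n - k]. *)
Lemma weighted_balance n (al be : 'I_r -> R) (y : R) :
  (forall i, 0 < al i) -> (forall i, 0 < be i) ->
  \sum_(k < n.+1) hcoef n al be k * y ^+ k * (k%:R * \prod_i (al i - 1 + k%:R)) =
  y * \sum_(k < n.+1) hcoef n al be k * y ^+ k * ((n%:R - k%:R) * \prod_i (be i + k%:R)).
Proof.
move=> al0 be0; rewrite big_ord_recl /= mul0r mulr0 add0r.
rewrite big_ord_recr /= subrr mul0r mulr0 addr0 mulr_sumr.
apply: eq_bigr => k _; have kn := ltn_ord k.
rewrite /bump add1n -natrB ?(ltnW kn) //.
have -> : \prod_i (al i - 1 + k.+1%:R) = \prod_i (al i + k%:R).
  by apply: eq_bigr => i _; rewrite -natr1; ring.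
transitivity (y ^+ k.+1 * (k.+1%:R * \prod_i (al i + k%:R) * hcoef n al be k.+1)); first by ring.
by rewrite hcoef_rec // exprS; ring.
Qed.

(** Formal limit of [weighted_balance] divided by [n ^+ r.+1]: [k / n] concentrates at [w], [al / n]
    tends to 0 and [be / n] to [1 / r]. *)
Definition heq (y w : R) : R := w ^+ r.+1 - y * (1 - w) * (w + r%:R^-1) ^+ r.

Lemma sbeta_approx n j : `|sbeta b n j / n.+1%:R - r%:R^-1| <= (b j + 1) / n.+1%:R.
Proof.
have r0 : 0 < r%:R :> R by rewrite ltr0n.
have -> : sbeta b n j / n.+1%:R - r%:R^-1 = (b j + ((stepshift r n j)%:R - n.+1%:R / r%:R)) / n.+1%:R.
  have : 0 < n.+1%:R :> R by rewrite ltr0n.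
  by rewrite /sbeta; set N := n.+1%:R => N0; field; rewrite !gt_eqF.
rewrite normrM [`|_^-1|]gtr0_norm ?invr_gt0 ?ltr0n // ler_pM2r ?invr_gt0 ?ltr0n //.
rewrite (le_trans (ler_normD _ _)) // gtr0_norm // lerD2l.
have := divn_eq (n + (r.-1 - j)) r; rewrite -/(stepshift r n j).
have := ltn_pmod (n + (r.-1 - j)) r_gt0; have jr := ltn_ord j.
set s := stepshift r n j; set m := (_ %% r)%N => mr E.
have E' : (n.+1 + r = s * r + m + j.+2)%N by lia.
have {}E' : n.+1%:R + r%:R = s%:R * r%:R + m%:R + j.+2%:R :> R.
  by rewrite -natrM -!natrD E'.
have -> : s%:R - n.+1%:R / r%:R = (r%:R - m%:R - j.+2%:R) / r%:R :> R.
  by rewrite -[n.+1%:R](addrK r%:R) E'; field; rewrite gt_eqF.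
have mr' : m%:R + 1 <= r%:R :> R by rewrite natr1 ler_nat.
have m0 : 0 <= m%:R :> R by [].
have j0 : 0 <= j%:R :> R by [].
have jr' : j%:R + 1 <= r%:R :> R by rewrite natr1 ler_nat.
rewrite ler_norml ler_pdivlMr // ler_pdivrMr // mulN1r mul1r -[j.+2]addn2 natrD.
by apply/andP; split; lra.
Qed.

(** Here [eta] is the threshold of a Chebyshev-type estimate: deviations of [k / N] from [w] below
    it cost at most [eta], larger ones at most variance over [eta]. Leaving it free avoids square
    roots, and [C] is uniform in [n], the roots and [eta]. *)
Lemma weight_equation (y : R) : 0 < y -> exists C : R, forall n (x : 'I_n.+1 -> R) (eta : R),
  (forall k, 0 < x k < 1) -> hpoly n.+1 a (sbeta b n) = \prod_k ('X + (x k)%:P) ->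
  0 < eta <= 1 ->
  `|heq y ((\sum_k y / (y + x k)) / n.+1%:R)| <= C * (eta + (eta * n.+1%:R)^-1).
Proof.
move=> y0; pose K : R := 1 + \sum_i (a i + b i + 2).
have r0 : 0 < r%:R :> R by rewrite ltr0n.
have ir1 : r%:R^-1 <= 1 :> R by rewrite invf_le1 // ler1n.
have Kab i : a i + b i + 2 <= K.
  rewrite /K (bigD1 i) //=; set S := \sum_(_ | _) _.
  have : 0 <= S by apply: sumr_ge0 => j _; rewrite !addr_ge0 // ltW.
  lra.
have Ka i : `|a i - 1| <= K.
  by have := Kab i; have := a_gt0 i; have := b_gt0 i; rewrite ler_norml => *; apply/andP; split; lra.
have Kb i : b i + 1 <= K by have := Kab i; have := a_gt0 i; lra.
have K1 : 1 <= K.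
  by rewrite /K lerDl sumr_ge0 // => i _; rewrite !addr_ge0 // ltW.
(* [B] bounds all factors of both products: a parameter part at most [K], plus at most 1 from
   [k / N] and 1 from [1 / r]. *)
pose B := K + 2; have B1 : 1 <= B by rewrite /B; lra.
have B0 : 0 <= B := le_trans ler01 B1.
have Br : 0 <= B ^+ r by rewrite exprn_ge0.
pose C1 := B ^+ r * (r%:R * K) + 1; pose C2 := B ^+ r * (r%:R * K) + B ^+ r.
exists ((C1 + y * C2) * 2) => n x eta x01 px /andP[eta0 eta1]; set w := _ / n.+1%:R.
set N : R := n.+1%:R; have N0 : 0 < N by rewrite ltr0n.
pose q k := hcoef n.+1 a (sbeta b n) k; pose W k := q k * y ^+ k.
have W0 k : (k <= n.+1)%N -> 0 <= W k.
  move=> kn; rewrite mulr_ge0 ?exprn_ge0 ?(ltW y0) // ltW // hcoef_gt0 // => j.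
  by rewrite sbeta_gt0.
pose Q := \sum_(k < n.+2) W k.
have x0 k : 0 < x k by case/andP: (x01 k).
have QE : Q = (hpoly n.+1 a (sbeta b n)).[y].
  by rewrite horner_coef size_hpoly; apply: eq_bigr => k _; rewrite coef_hpoly.
have Q0 : 0 < Q.
  rewrite QE px horner_prod prodr_gt0 // => k _; rewrite !hornerE.
  by rewrite addr_gt0.
have yx k : 0 < y + x k by rewrite addr_gt0.
have w01 : 0 <= w <= 1.
  rewrite /w divr_ge0 ?sumr_ge0 ?(ltW N0) //=; last first.
    by move=> k _; rewrite divr_ge0 ?ltW.
  rewrite ler_pdivrMr // mul1r -[leRHS]/(n.+1%:R) -[n.+1 in leRHS]card_ord -sumr_const.
  by apply: ler_sum => k _; rewrite ler_pdivrMr // mul1r lerDl ltW.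
have [w0 w1] := andP w01.
have var : \sum_(k < n.+2) W k * (k%:R / N - w) ^+ 2 <= Q / N.
  have /= := @coef_second_moment R n.+1 x y (\sum_k y / (y + x k)) y0 x0.
  rewrite -px -QE subrr expr0n addr0 => V.
  have -> : \sum_(k < n.+2) W k * (k%:R / N - w) ^+ 2 =
     (\sum_(k < n.+2) (hpoly n.+1 a (sbeta b n))`_k * y ^+ k *
       (k%:R - \sum_k y / (y + x k)) ^+ 2) / N ^+ 2.
    rewrite mulr_suml; apply: eq_bigr => k _; rewrite /W /q -coef_hpoly /w -/N.
    by field; rewrite gt_eqF.
  rewrite V ler_pdivrMr ?exprn_gt0 //.
  have -> : Q / N * N ^+ 2 = Q * N by field; rewrite gt_eqF.
  rewrite ler_pM2l // /N -[n.+1 in leRHS]card_ord -sumr_const; apply: ler_sum => k _.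
  rewrite ler_pdivrMr ?exprn_gt0 // mul1r.
  by have := x0 k; nra.
have [T TE] : exists T : nat -> R, forall k, T k = k%:R / N by eexists.
have T01 k : (k <= n.+1)%N -> 0 <= T k <= 1.
  by move=> kn; rewrite TE divr_ge0 ?(ltW N0) //= ler_pdivrMr // mul1r ler_nat.
pose del k : R := `|T k - w| + N^-1.
have Ni0 : 0 <= N^-1 by rewrite invr_ge0 ltW.
have Ni1 : N^-1 <= 1 by rewrite invf_le1 // ler1n.
have del_ge k : `|T k - w| <= del k by rewrite /del lerDl.
have del_geN k : N^-1 <= del k by rewrite /del lerDr.
have sumdel : \sum_(k < n.+2) W k * del k <= Q * 2 * (eta + (eta * N)^-1).
  (* Either the deviation is at most [eta], or it is at most its square divided by [eta]. *)
  have h k : del k <= eta + (T k - w) ^+ 2 / eta + (eta * N)^-1.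
    rewrite /del; apply: lerD; last first.
      by rewrite lef_pV2 ?posrE ?mulr_gt0 // ler_piMl // ltW.
    have [le|/ltW le] := leP `|T k - w| eta.
      by rewrite ler_wpDr // divr_ge0 ?sqr_ge0 ?ltW.
    by rewrite ler_wpDl ?(ltW eta0) // ler_pdivlMr // -(@real_normK _ (T k - w)) ?num_real // expr2 ler_wpM2l.
  apply: (@le_trans _ _ (\sum_(k < n.+2) (W k * (eta + (eta * N)^-1) + (W k * (k%:R / N - w) ^+ 2) / eta))).
    apply: ler_sum => k _; have := ler_wpM2l (W0 k (ltn_ord k)) (h k).
    by rewrite -TE => /le_trans; apply; rewrite le_eqVlt; apply/orP; left; apply/eqP; ring.
  rewrite big_split /= -!mulr_suml -/Q.
  apply: (@le_trans _ _ (Q * (eta + (eta * N)^-1) + Q / N / eta)).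
    by rewrite lerD2l ler_pM2r ?invr_gt0.
  have -> : Q / N / eta = Q * (eta * N)^-1 by field; rewrite !gt_eqF.
  rewrite -mulrDr -mulrA ler_pM2l //.
  have : 0 < (eta * N)^-1 by rewrite invr_gt0 mulr_gt0.
  by set i := (eta * N)^-1 => i0; lra.
pose G1 k := T k * \prod_i ((a i - 1 + k%:R) / N).
pose G2 k := (1 - T k) * \prod_i ((sbeta b n i + k%:R) / N).
have bal : \sum_(k < n.+2) W k * G1 k = y * \sum_(k < n.+2) W k * G2 k.
  have := @weighted_balance n.+1 a (sbeta b n) y a_gt0 (sbeta_gt0 b_gt0 n) => H.
  have E1 k : W k * G1 k = (W k * (k%:R * \prod_i (a i - 1 + k%:R))) / N ^+ r.+1.
    rewrite /G1 TE big_split /= prodr_const card_ord exprS exprVn.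
    by field; rewrite !gt_eqF ?exprn_gt0.
  have E2 k : W k * G2 k = (W k * ((N - k%:R) * \prod_i (sbeta b n i + k%:R))) / N ^+ r.+1.
    rewrite /G2 TE big_split /= prodr_const card_ord exprS exprVn.
    by field; rewrite !gt_eqF ?exprn_gt0.
  under eq_bigr do rewrite E1; under [in RHS]eq_bigr do rewrite E2.
  by rewrite -!mulr_suml H mulrA.
have bound1 k : (k <= n.+1)%N -> `|G1 k - w ^+ r.+1| <= C1 * del k.
  move=> kn; have /andP[T0 T1] := T01 k kn.
  rewrite /G1; set P := \prod_i _; rewrite exprS.
  have -> : T k * P - w * w ^+ r = T k * (P - w ^+ r) + (T k - w) * w ^+ r by ring.
  rewrite (le_trans (ler_normD _ _)) // !normrM /C1 mulrDl mul1r lerD //; last first.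
    by rewrite (le_trans _ (del_ge k)) // ler_piMr // ger0_norm ?exprn_ge0 // exprn_ile1.
  apply: (@le_trans _ _ `|P - w ^+ r|); first by rewrite (ger0_norm T0) ler_piMl.
  rewrite /P -[r in w ^+ r]card_ord -prodr_const.
  apply: (le_trans (@prod_perturb R r B _ _ B1 _ _)).
  - move=> i; have -> : (a i - 1 + k%:R) / N = (a i - 1) / N + T k by rewrite TE mulrDl.
    rewrite (le_trans (ler_normD _ _)) // [`|T k|]ger0_norm // normrM [`|N^-1|]ger0_norm //.
    have : `|a i - 1| * N^-1 <= `|a i - 1| by rewrite ler_piMr.
    by move: (Ka i); rewrite /B; move: (_ / N) => z; lra.
  - by move=> i; rewrite ger0_norm // /B; lra.
  rewrite -!mulrA ler_wpM2l // -[r in leRHS]card_ord mulr_natl -sumr_const.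
  apply: ler_sum => i _.
  have -> : (a i - 1 + k%:R) / N - w = (T k - w) + (a i - 1) / N by rewrite TE; ring.
  rewrite (le_trans (ler_normD _ _)) // normrM [`|N^-1|]ger0_norm // /del mulrDr lerD //.
    by rewrite ler_peMl.
  by rewrite ler_wpM2r.
have bound2 k : (k <= n.+1)%N -> `|G2 k - (1 - w) * (w + r%:R^-1) ^+ r| <= C2 * del k.
  move=> kn; have /andP[T0 T1] := T01 k kn.
  rewrite /G2; set P := \prod_i _; set V := w + _.
  have ri0 : 0 <= r%:R^-1 :> R by rewrite invr_ge0 ltW.
  have VB : `|V| <= B by rewrite ger0_norm /V ?addr_ge0 // /B; lra.
  have -> : (1 - T k) * P - (1 - w) * V ^+ r = (1 - T k) * (P - V ^+ r) - (T k - w) * V ^+ r by ring.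
  rewrite (le_trans (ler_normB _ _)) // !normrM /C2 mulrDl lerD //; last first.
    by rewrite mulrC ler_pM // normrX lerXn2r ?nnegrE.
  apply: (@le_trans _ _ `|P - V ^+ r|).
    by rewrite ger0_norm ?subr_ge0 // ler_piMl // gerBl.
  rewrite /P -[r in V ^+ r]card_ord -prodr_const.
  apply: (le_trans (@prod_perturb R r B _ _ B1 _ _)) => //.
  - move=> i; have -> : (sbeta b n i + k%:R) / N = (sbeta b n i / N - r%:R^-1) + (r%:R^-1 + T k) by rewrite TE; ring.
    rewrite (le_trans (ler_normD _ _)) // [`|_ + T k|]ger0_norm ?addr_ge0 //.
    have : (b i + 1) / N <= b i + 1 by rewrite ler_piMr // addr_ge0 // ltW.
    have := sbeta_approx n i; rewrite -/N; have := Kb i; rewrite /B.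
    by move: ((b i + 1) / N) `|sbeta b n i / N - r%:R^-1| => u z; lra.
  rewrite -!mulrA ler_wpM2l // -[r in leRHS]card_ord mulr_natl -sumr_const.
  apply: ler_sum => i _.
  have -> : (sbeta b n i + k%:R) / N - V = (T k - w) + (sbeta b n i / N - r%:R^-1) by rewrite TE /V; ring.
  rewrite (le_trans (ler_normD _ _)) // /del mulrDr lerD //.
    by rewrite ler_peMl.
  by rewrite (le_trans (sbeta_approx n i)) // ler_wpM2r.
rewrite -(ler_pM2l Q0).
(* By [bal] the weighted sum of [G1 - y * G2] is zero, so it can be subtracted for free. *)
have -> : Q * `|heq y w| = `|\sum_(k < n.+2) W k * ((w ^+ r.+1 - G1 k) - y * ((1 - w) * (w + r%:R^-1) ^+ r - G2 k))|.
  rewrite -[Q in LHS]gtr0_norm // -normrM; congr `|_|.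
  have -> : \sum_(k < n.+2) W k * ((w ^+ r.+1 - G1 k) - y * ((1 - w) * (w + r%:R^-1) ^+ r - G2 k)) =
     \sum_(k < n.+2) (W k * heq y w - (W k * G1 k - y * (W k * G2 k))).
    by apply: eq_bigr => k _; rewrite /heq; ring.
  by rewrite sumrB -mulr_suml sumrB -mulr_sumr bal subrr subr0.
apply: (le_trans (ler_norm_sum _ _ _)).
apply: (@le_trans _ _ (\sum_(k < n.+2) (C1 + y * C2) * (W k * del k))).
  apply: ler_sum => k _; have kn : (k <= n.+1)%N by rewrite -ltnS.
  rewrite normrM (ger0_norm (W0 _ kn)) mulrCA ler_wpM2l ?W0 //.
  rewrite (le_trans (ler_normB _ _)) // [leRHS]mulrDl lerD //.
    by rewrite distrC bound1.
  by rewrite normrM gtr0_norm // -mulrA ler_pM2l // distrC bound2.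
rewrite -mulr_sumr -mulrA mulrCA ler_wpM2l //.
  rewrite /C1 /C2; have : 0 <= B ^+ r * (r%:R * K) by rewrite !mulr_ge0 //; lra.
  by move=> h; rewrite addr_ge0 ?mulr_ge0 ?addr_ge0 // ltW.
by rewrite mulrA.
Qed.

End AlgebraicEquation.

(** * The limit curve, and coefficients of its power series *)

Section FussCatalan.
Variables (R : realType) (r : nat).
Hypothesis r_gt0 : (0 < r)%N.

Definition fuss j : nat := 'C(r.+1 * j, j).

Definition kappa : R := r%:R ^+ r / r.+1%:R ^+ r.+1.

(* A rational parametrisation of the curve [heq r y w = 0]. *)
Definition heq_w (s : R) : R := (1 - s) / (1 + r%:R * s).
Definition heq_y (s : R) : R := kappa * ((1 - s) ^+ r.+1 / s).

(** Quantitative uniqueness of the root [W] in [[0, 1]]. After eliminating [y] by the equation for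
    [W], the sign of [heq] is governed by [w / (w + 1/r)], which increases with [w]; the inequality
    [q] in each case is this monotonicity. *)
Lemma heq_inverse (s w : R) : 0 < s < 1 -> 0 <= w <= 1 ->
  (heq_w s / r.+1%:R) ^+ r * `|w - heq_w s| <= `|heq r (heq_y s) w|.
Proof.
move=> /andP[s0 s1] /andP[w0 w1]; set W := heq_w s; set y := heq_y s.
have r0 : 0 < r%:R :> R by rewrite ltr0n.
have r1 : r.+1%:R = r%:R + 1 :> R by rewrite -natr1.
have rs : 0 < 1 + r%:R * s by rewrite addr_gt0 // mulr_gt0.
have W0 : 0 < W by rewrite /W divr_gt0 // subr_gt0.
pose P := W + r%:R^-1; pose p := w + r%:R^-1.
have ri : 0 < r%:R^-1 :> R by rewrite invr_gt0.
have P0 : 0 < P by rewrite addr_gt0.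
have p0 : 0 < p by rewrite ltr_wpDl.
have W1E : 1 - W = r.+1%:R * s / (1 + r%:R * s).
  by rewrite /W /heq_w r1; field; rewrite gt_eqF.
have W1 : 0 < 1 - W by rewrite W1E divr_gt0 // mulr_gt0.
have W1' : 1 - W <= 1 by rewrite gerBl ltW.
have PE : P = r.+1%:R / (r%:R * (1 + r%:R * s)).
  by rewrite /P /W /heq_w r1; field; rewrite !gt_eqF.
have yW : y * (1 - W) * P ^+ r = W ^+ r.+1.
  rewrite W1E PE /y /heq_y /kappa /W /heq_w !expr_div_n exprMn ![_ ^+ r.+1]exprS r1.
  by field; rewrite !gt_eqF ?exprn_gt0 ?addr_gt0 ?mulr_gt0.
clearbody W y.
have hE : (1 - W) * P ^+ r * heq r y w = (1 - W) * P ^+ r * w ^+ r.+1 - W ^+ r.+1 * (1 - w) * p ^+ r.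
  by rewrite -yW /heq -/p; ring.
have Pr : 0 < P ^+ r by rewrite exprn_gt0.
have pr : 0 < p ^+ r by rewrite exprn_gt0.
have Wr : 0 < W ^+ r by rewrite exprn_gt0.
have wr : 0 <= w ^+ r by rewrite exprn_ge0.
have W1r : (W / r.+1%:R) ^+ r <= W ^+ r.
  rewrite lerXn2r ?nnegrE ?divr_ge0 ?(ltW W0) // ler_pdivrMr ?ltr0n //.
  by rewrite ler_peMr ?(ltW W0) // ler1n.
have [Ww|wW] := leP W w.
  have q : p * W <= w * P.
    rewrite /p /P; have : W * r%:R^-1 <= w * r%:R^-1 by rewrite ler_pM2r.
    by rewrite !mulrDl !mulrDr; lra.
  have {}q : p ^+ r * W ^+ r <= w ^+ r * P ^+ r.
    by rewrite -!exprMn lerXn2r // ?nnegrE ?mulr_ge0 // ltW.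
  have key : P ^+ r * (w ^+ r * (w - W)) <= (1 - W) * P ^+ r * heq r y w.
    rewrite hE !exprS.
    have := ler_wpM2l (_ : 0 <= W * (1 - w)) q; rewrite mulr_ge0 ?subr_ge0 ?(ltW W0) // => /(_ isT).
    by move: (p ^+ r) (P ^+ r) (w ^+ r) (W ^+ r) => *; lra.
  have {}key : w ^+ r * (w - W) <= (1 - W) * heq r y w.
    by rewrite -(ler_pM2l Pr) (le_trans key) // mulrCA mulrA.
  have h0 : 0 <= heq r y w.
    rewrite -(pmulr_rge0 _ W1); apply: le_trans key.
    by rewrite mulr_ge0 // subr_ge0.
  rewrite (ger0_norm h0) ger0_norm ?subr_ge0 //.
  apply: (@le_trans _ _ ((1 - W) * heq r y w)); last by rewrite ler_piMl.
  apply: le_trans key; rewrite ler_wpM2r ?subr_ge0 //; apply: (le_trans W1r).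
  by rewrite lerXn2r // nnegrE // ltW.
have wW' := ltW wW.
have q : w * P <= p * W.
  rewrite /p /P; have : w * r%:R^-1 <= W * r%:R^-1 by rewrite ler_pM2r.
  by rewrite !mulrDl !mulrDr; lra.
have {}q : w ^+ r * P ^+ r <= p ^+ r * W ^+ r.
  by rewrite -!exprMn lerXn2r // ?nnegrE ?mulr_ge0 // ltW.
have key : p ^+ r * (W ^+ r * (W - w)) <= (1 - W) * P ^+ r * - heq r y w.
  rewrite mulrN hE !exprS.
  have := ler_wpM2l (_ : 0 <= (1 - W) * w) q; rewrite mulr_ge0 // ?(ltW W1) // => /(_ isT).
  by move: (p ^+ r) (P ^+ r) (w ^+ r) (W ^+ r) => *; lra.
(* From [P <= 1 + 1/r] and [p >= 1/r]; this is the origin of the divisor [r.+1] in the constant. *)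
have pP : r.+1%:R^-1 * P <= p.
  rewrite mulrC ler_pdivrMr // /P /p r1.
  have : w * r%:R + w * 1 >= 0 by rewrite addr_ge0 // mulr_ge0 // ltW.
  have : r%:R^-1 * r%:R = 1 :> R by rewrite mulVf // gt_eqF.
  rewrite mulrDl !mulrDr; lra.
have {}pP : r.+1%:R^-1 ^+ r * P ^+ r <= p ^+ r.
  by rewrite -exprMn lerXn2r // nnegrE ?mulr_ge0 // ltW.
have {}key : (W / r.+1%:R) ^+ r * (W - w) <= (1 - W) * - heq r y w.
  rewrite -(ler_pM2l Pr); apply: (@le_trans _ _ (p ^+ r * (W ^+ r * (W - w)))).
    rewrite exprMn mulrA mulrA ler_wpM2r ?subr_ge0 // mulrCA mulrC ler_wpM2r ?(ltW Wr) //.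
    by rewrite mulrC.
  by rewrite (le_trans key) // mulrCA mulrA.
have h0 : 0 <= - heq r y w.
  rewrite -(pmulr_rge0 _ W1); apply: le_trans key.
  by rewrite mulr_ge0 ?subr_ge0 // exprn_ge0 // divr_ge0 // ltW.
rewrite distrC ger0_norm ?subr_ge0 // -[`|heq _ _ _|]normrN (ger0_norm h0).
by apply: (le_trans key); rewrite ler_piMl.
Qed.

Variable M : nat.
Implicit Types p q : {poly R}.

(** Congruence modulo ['X^M], standing for equality of truncated power series; the witness [e]
    becomes an explicit analytic remainder. *)
Definition eqmX (p q : {poly R}) := exists e, p = q + 'X^M * e.

Lemma eqmX_coef p q : (forall i, (i < M)%N -> p`_i = q`_i) -> eqmX p q.
Proof.
move=> h; exists (drop_poly M (p - q)).
apply/polyP => i; rewrite coefD coefXnM coef_drop_poly coefB.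
by case: ltnP => [iM|Mi]; [rewrite h ?addr0|rewrite subnK // addrC subrK].
Qed.

Lemma eqmX_refl p : eqmX p p.
Proof. by exists 0; rewrite mulr0 addr0. Qed.

Lemma eqmX_trans q p (s : {poly R}) : eqmX p q -> eqmX q s -> eqmX p s.
Proof. by move=> [e ->] [f ->]; exists (f + e); ring. Qed.

Lemma eqmX_sym p q : eqmX p q -> eqmX q p.
Proof. by move=> [e ->]; exists (- e); ring. Qed.

Lemma eqmXD p q (p' q' : {poly R}) : eqmX p q -> eqmX p' q' -> eqmX (p + p') (q + q').
Proof. by move=> [e ->] [f ->]; exists (e + f); ring. Qed.

Lemma eqmXM p q (p' q' : {poly R}) : eqmX p q -> eqmX p' q' -> eqmX (p * p') (q * q').
Proof. by move=> [e ->] [f ->]; exists (e * q' + q * f + e * 'X^M * f); ring. Qed.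

Lemma eqmX_exp p q n : eqmX p q -> eqmX (p ^+ n) (q ^+ n).
Proof.
move=> h; elim: n => [|n IH]; first exact: eqmX_refl.
by rewrite !exprS; apply: eqmXM.
Qed.

Lemma eqmX_sum n (F G : 'I_n -> {poly R}) : (forall i, eqmX (F i) (G i)) ->
  eqmX (\sum_i F i) (\sum_i G i).
Proof. by move=> h; elim/big_ind2: _ => //; [exact: eqmX_refl|move=> *; exact: eqmXD]. Qed.

Definition geom : {poly R} := \poly_(i < M) 1.

Lemma geom_inv : (1 - 'X) * geom = 1 - 'X^M.
Proof.
rewrite /geom; apply/polyP => i; rewrite mulrBl mul1r coefB coefXM !coef_poly coefB coef1 coefXn.
case: i => [|i] /=; first by case: (M) => [|m]; rewrite ?subrr ?subr0.
rewrite sub0r; case: (ltngtP i.+1 M) => h.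
- by rewrite subrr oppr0.
- by rewrite subrr oppr0.
- by rewrite sub0r.
Qed.

Lemma coef_geom_exp m i : (i < M)%N -> (geom ^+ m)`_i = 'C(m + i - 1, i)%:R.
Proof.
elim: m i => [|m IHm] i iM.
  rewrite expr0 coef1 add0n; case: i iM => [|i] _ //=.
  by rewrite subn1 /= bin_small.
elim: i iM => [|i IHi] iM.
  rewrite bin0 exprS coef0M IHm // bin0 mulr1 /geom coef_poly.
  by rewrite iM.
have E : geom ^+ m.+1 = 'X * geom ^+ m.+1 + geom ^+ m - 'X^M * geom ^+ m.
  apply/eqP; rewrite -subr_eq0 exprS; apply/eqP.
  transitivity (((1 - 'X) * geom - (1 - 'X^M)) * geom ^+ m); first by ring.
  by rewrite geom_inv subrr mul0r.
rewrite E coefB coefD coefXM coefXnM iM subr0 /= IHi ?(ltnW iM) // IHm //.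
rewrite -natrD; congr _%:R.
have -> : (m.+1 + i - 1 = m + i)%N by rewrite addSn subn1.
have -> : (m + i.+1 - 1 = m + i)%N by rewrite addnS subn1.
have -> : (m.+1 + i.+1 - 1 = (m + i).+1)%N by rewrite addnS addSn subn1.
by rewrite binS addnC.
Qed.

(** Multiplied by [n!], the summand becomes [(-1)^(n-j) 'C(n, j) q(j)], where [q] is [(r+1) X] times
    the product of [r X + l] for [0 < l < n]. The sum is thus a difference of order [n], given by
    the leading coefficient of [q]. *)
Lemma fuss_coef n : (0 < n)%N ->
  \sum_(j < n.+1) (-1) ^+ (n - j) * (fuss j * 'C(r * j + n - 1, n - j))%:R =
  (r.+1 * r ^ n.-1)%:R :> R.
Proof.
case: n => // n _.
pose q : {poly R} := r.+1%:R *: 'X * \prod_(l < n) (r%:R *: 'X + l.+1%:R%:P).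
have r0 : r%:R != 0 :> R by rewrite pnatr_eq0 -lt0n.
have szl (l : nat) : size (r%:R *: 'X + l.+1%:R%:P : {poly R}) = 2.
  by rewrite size_addl size_scale ?size_polyX // size_polyC; case: (_ != _).
have lp : size (\prod_(l < n) (r%:R *: 'X + l.+1%:R%:P) : {poly R}) = n.+1 /\
   lead_coef (\prod_(l < n) (r%:R *: 'X + l.+1%:R%:P) : {poly R}) = r%:R ^+ n.
  elim: n {q} => [|n [IH1 IH2]]; first by rewrite big_ord0 size_poly1 lead_coef1.
  rewrite big_ord_recr /= size_mul ?lead_coefM.
  - rewrite IH1 IH2 szl addn2 exprSr; split=> //; congr (_ * _).
    rewrite lead_coefDl ?lead_coefZ ?lead_coefX ?mulr1 //.
    by rewrite size_scale // size_polyX size_polyC; case: (_ != _).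
  - by rewrite -size_poly_gt0 IH1.
  - by rewrite -size_poly_gt0 szl.
have r1 : r.+1%:R != 0 :> R by rewrite pnatr_eq0.
have sq : size q = n.+2.
  rewrite /q -scalerAl size_scale // mulrC size_mulX ?lp.1 //.
  by rewrite -size_poly_gt0 lp.1.
have cq : q`_n.+1 = (r.+1 * r ^ n)%:R.
  rewrite /q -scalerAl coefZ coefXM /= natrM natrX; congr (_ * _).
  by rewrite -lp.2 lead_coefE lp.1.
have := @finite_difference R n.+1 q; rewrite sq cq => /(_ (leqnn _)) FD.
have nf : n.+1`!%:R != 0 :> R by rewrite pnatr_eq0 -lt0n fact_gt0.
apply: (mulfI nf); rewrite -FD mulr_sumr; apply: eq_bigr => j _.
rewrite [LHS]mulrCA -mulrA; congr (_ * _).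
rewrite -natrM; have -> : q.[j%:R] = (r.+1 * j * \prod_(l < n) (r * j + l.+1))%:R.
  rewrite /q hornerM hornerZ hornerX horner_prod !natrM natr_prod; congr (_ * _).
  by apply: eq_bigr => l _; rewrite !hornerE natrD natrM.
rewrite -natrM; congr _%:R.
have jn : (j <= n.+1)%N by rewrite -ltnS.
(* At [j = 0] both sides vanish: the binomial is ['C(n, n.+1)] and [q] has the factor ['X]. *)
case: (nat_of_ord j) jn => [|k] kn.
  rewrite [('C(r * 0 + _ - 1, _))%N]bin_small; first by rewrite !(muln0, mul0n).
  by rewrite muln0 add0n subn0 subn1.
rewrite /fuss.
have rise m l : (m`! * \prod_(i < l) (m + i.+1) = (m + l)`!)%N.
  elim: l => [|l IH]; first by rewrite big_ord0 muln1 addn0.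
  by rewrite big_ord_recr /= mulnA IH addnS factS mulnC.
have b1 : ('C(r.+1 * k.+1, k.+1) * (k.+1`! * (r * k.+1)`!) = (r * k.+1 + k.+1)`!)%N.
  have := @bin_fact (r * k.+1 + k.+1) k.+1 (leq_addl _ _).
  by rewrite addnK mulSn [(k.+1 + _)%N]addnC.
have b2 : ('C(r * k.+1 + n.+1 - 1, n.+1 - k.+1) * ((n.+1 - k.+1)`! * (r * k.+1 + k)`!) = (r * k.+1 + n)`!)%N.
  have -> : (r * k.+1 + n.+1 - 1 = r * k.+1 + n)%N by rewrite addnS subn1.
  have nk : (n - k <= r * k.+1 + n)%N by rewrite (leq_trans (leq_subr _ _)) // leq_addl.
  by have := bin_fact nk; rewrite subSS -addnBA ?leq_subr // subKn.
have b3 := bin_fact kn; have b4 := rise (r * k.+1)%N n.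
have b5 : ((r * k.+1 + k.+1)`! = (r.+1 * k.+1) * (r * k.+1 + k)`!)%N.
  by rewrite addnS factS -addnS mulSn [(k.+1 + _)%N]addnC.
set A := 'C(r.+1 * k.+1, _) in b1 *; set B := 'C(r * _ + _ - 1, _) in b2 *.
set D := 'C(_, _) in b3 *; set E := \prod_(_ < _) _ in b4 *.
have p1 := fact_gt0 k.+1; have p2 := fact_gt0 (r * k.+1).
have p3 := fact_gt0 (n.+1 - k.+1); have p4 := fact_gt0 (r * k.+1 + k).
apply/eqP; rewrite -(eqn_pmul2r (_ : 0 < (k.+1`! * (r * k.+1)`!) * ((n.+1 - k.+1)`! * (r * k.+1 + k)`!))%N); last first.
  have pos m l : (0 < m -> 0 < l -> 0 < m * l)%N by rewrite muln_gt0 => -> ->.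
  exact: pos (pos _ _ p1 p2) (pos _ _ p3 p4).
apply/eqP; transitivity (n.+1`! * ((A * (k.+1`! * (r * k.+1)`!)) * (B * ((n.+1 - k.+1)`! * (r * k.+1 + k)`!))))%N; first by ring.
rewrite b1 b2 b5 -b3 -b4; ring.
Qed.

End FussCatalan.

(** * Expansion of [w] at infinite [y] *)

Section Expansion.
Variables (R : realType) (r : nat).
Hypothesis r_gt0 : (0 < r)%N.

(** The Fuss series at [- X / (1 - X)^(r+1)], that is at [- kappa / y], truncated. *)
Let fser M : {poly R} := \sum_(j < M) (fuss r j)%:R *: ((-1) ^+ j *: 'X^j * geom R M ^+ (r.+1 * j)).

(** The power series of [(1 - X) / (1 + r X)], which is [heq_w], truncated. *)
Let kser M : {poly R} := \poly_(n < M)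
  (if n is n'.+1 then (-1) ^+ n * (r.+1 * r ^ n')%:R else 1).

Let fser_kser M : eqmX M (fser M) (kser M).
Proof.
apply: eqmX_coef => n nM; rewrite coef_poly nM /fser coef_sum.
have E (j : 'I_M) : ((fuss r j)%:R *: ((-1) ^+ j *: 'X^j * geom R M ^+ (r.+1 * j)))`_n =
   if (j < n.+1)%N then (-1) ^+ n * ((-1) ^+ (n - j) * (fuss r j * 'C(r * j + n - 1, n - j))%:R) else 0.
  rewrite coefZ -scalerAl coefZ coefXnM ltnS; case: (leqP j n) => [jn|nj]; last by rewrite !mulr0.
  rewrite coef_geom_exp; last by rewrite (leq_ltn_trans (leq_subr _ _)).
  have -> : (r.+1 * j + (n - j) - 1 = r * j + n - 1)%N by rewrite mulSn; lia.
  have -> : (-1) ^+ j = (-1) ^+ n * (-1) ^+ (n - j) :> R.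
    by rewrite -exprD -[RHS]signr_odd oddD oddB // addbA addbb /= signr_odd.
  by rewrite natrM; ring.
rewrite (eq_bigr _ (fun j _ => E j)) -big_mkcond /=.
rewrite -(big_ord_widen M (fun j => (-1) ^+ n * ((-1) ^+ (n - j) * (fuss r j * 'C(r * j + n - 1, n - j))%:R))) //.
rewrite -mulr_sumr; case: n nM {E} => [|n] nM.
  by rewrite big_ord1 /fuss muln0 !bin0 !mul1r muln1.
by rewrite fuss_coef.
Qed.

Let kser_inv M : eqmX M ((1 + r%:R *: 'X) * kser M) (1 - 'X).
Proof.
apply: eqmX_coef => n nM; rewrite mulrDl mul1r -scalerAl coefD coefZ coefXM coefB coef1 coefX.
rewrite !coef_poly nM; case: n nM => [|[|n]] nM /=.
- by rewrite mulr0 addr0 subr0.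
- by rewrite (ltnW nM) expr1 expn0 muln1 mulr1 -natr1; ring.
- rewrite (ltnW nM) !natrM !natrX !exprS; ring.
Qed.

Let horner_bound (p : {poly R}) s : `|s| <= 1 -> `|p.[s]| <= \sum_(i < size p) `|p`_i|.
Proof.
move=> s1; rewrite horner_coef (le_trans (ler_norm_sum _ _ _)) //; apply: ler_sum => i _.
by rewrite normrM normrX ler_piMr // exprn_ile1.
Qed.

(** Multiplying by [(1 + r s)(1 - s)^N] with [N = (r+1) M] clears all denominators, and the
    congruence modulo ['X^M] becomes a polynomial identity. Dividing back costs at most [2 ^+ N], as
    [1 - s >= 1/2]. *)
Lemma fuss_expansion M : exists C : R, forall s : R, 0 < s <= 2^-1 ->
  `|heq_w r s - \sum_(j < M) (fuss r j)%:R * (- (s / (1 - s) ^+ r.+1)) ^+ j| <= C * s ^+ M.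
Proof.
pose N := (r.+1 * M)%N; pose U : {poly R} := 1 - 'X.
pose D1 := (1 + r%:R *: 'X) * \sum_(j < M) (fuss r j)%:R *: ((-1) ^+ j *: 'X^j * U ^+ (r.+1 * (M - j))).
have [e De] : eqmX M D1 (U ^+ N * U).
  have Ug m : eqmX M (U ^+ m * geom R M ^+ m) 1.
    rewrite -exprMn -[1](@expr1n {poly R} m); apply: eqmX_exp; rewrite geom_inv.
    by exists (-1); rewrite mulrN1.
  apply: (@eqmX_trans _ _ ((1 + r%:R *: 'X) * (U ^+ N * fser M))).
    apply: eqmXM; first exact: eqmX_refl.
    rewrite /fser mulr_sumr; apply: eqmX_sum => j.
    have -> : (fuss r j)%:R *: ((-1) ^+ j *: 'X^j * U ^+ (r.+1 * (M - j))) =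
       (fuss r j)%:R *: ((-1) ^+ j *: 'X^j) * (U ^+ (r.+1 * (M - j)) * 1) :> {poly R}.
      by rewrite mulr1 -!scalerAl.
    have -> : U ^+ N * ((fuss r j)%:R *: ((-1) ^+ j *: 'X^j * geom R M ^+ (r.+1 * j))) =
       (fuss r j)%:R *: ((-1) ^+ j *: 'X^j) * (U ^+ (r.+1 * (M - j)) * (U ^+ (r.+1 * j) * geom R M ^+ (r.+1 * j))).
      have -> : N = (r.+1 * (M - j) + r.+1 * j)%N by rewrite -mulnDr subnK // ltnW.
      by rewrite exprD -!mul_polyC; ring.
    apply: eqmXM; first exact: eqmX_refl.
    by apply: eqmXM; [exact: eqmX_refl|apply: eqmX_sym].
  rewrite mulrCA; apply: eqmXM; first exact: eqmX_refl.
  apply: eqmX_trans (kser_inv M); apply: eqmXM; first exact: eqmX_refl.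
  exact: fser_kser.
exists (2 ^+ N * \sum_(i < size e) `|e`_i|) => s /andP[s0 s2].
have h2 : 0 < 2^-1 :> R by rewrite invr_gt0.
have s1 : s < 1 by rewrite (le_lt_trans s2) // invf_lt1 // ltr1n.
have u0 : 0 < 1 - s by rewrite subr_gt0.
have rs : 0 < 1 + r%:R * s by rewrite ltr_wpDr // mulr_ge0 // ltW.
have := congr1 (horner^~ s) De.
rewrite /= /D1 hornerM hornerD hornerM hornerM horner_exp hornerXn.
have -> : U.[s] = 1 - s by rewrite /U !hornerE.
have -> : (1 + r%:R *: 'X : {poly R}).[s] = 1 + r%:R * s by rewrite !hornerE.
rewrite horner_sum.
have -> : \sum_(j < M) ((fuss r j)%:R *: ((-1) ^+ j *: 'X^j * U ^+ (r.+1 * (M - j)))).[s] =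
  (1 - s) ^+ N * \sum_(j < M) (fuss r j)%:R * (- (s / (1 - s) ^+ r.+1)) ^+ j.
  rewrite mulr_sumr; apply: eq_bigr => j _.
  rewrite hornerZ hornerM hornerZ hornerXn horner_exp.
  have -> : U.[s] = 1 - s by rewrite /U !hornerE.
  have -> : N = (r.+1 * (M - j) + r.+1 * j)%N by rewrite -mulnDr subnK // ltnW.
  rewrite exprD [(- (_ / _)) ^+ _]exprNn expr_div_n -exprM.
  by field; rewrite expf_neq0 // gt_eqF.
set S := \sum_(j < M) _ => E.
have -> : heq_w r s - S = - (s ^+ M * e.[s] / ((1 + r%:R * s) * (1 - s) ^+ N)).
  have nz : (1 - s) ^+ N != 0 by rewrite expf_neq0 // gt_eqF.
  have nz2 : 1 + r%:R * s != 0 by rewrite gt_eqF.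
  have -> : s ^+ M * e.[s] = (1 + r%:R * s) * ((1 - s) ^+ N * S) - (1 - s) ^+ N * (1 - s).
    by rewrite E addrC addKr.
  by rewrite /heq_w; field; rewrite nz nz2.
rewrite normrN normrM normrM (ger0_norm (_ : 0 <= s ^+ M)) ?exprn_ge0 ?(ltW s0) //.
rewrite -mulrA mulrC ler_wpM2r ?exprn_ge0 ?(ltW s0) // mulrC ler_pM ?normr_ge0 //.
  have [rs' u0'] := (ltW rs, ltW u0).
  rewrite ger0_norm; last by rewrite invr_ge0 mulr_ge0 ?exprn_ge0.
  rewrite invfM -[leRHS]mul1r ler_pM ?invr_ge0 ?exprn_ge0 //.
    by rewrite invf_le1 // lerDl mulr_ge0 // ltW.
  rewrite -exprVn lerXn2r ?nnegrE ?invr_ge0 ?(ltW u0) //.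
  by rewrite -[leRHS]invrK lef_pV2 ?posrE //; lra.
by apply: horner_bound; rewrite ger0_norm ltW.
Qed.

End Expansion.

(** * Convergence of the moments of the zeros *)

Section MomentLimit.
Variables (R : realType) (r : nat) (a b : 'I_r -> R).
Hypothesis r_gt0 : (0 < r)%N.
Hypothesis a_gt0 : forall i : 'I_r, 0 < a i.
Hypothesis b_gt0 : forall j : 'I_r, 0 < b j.
Variable z : forall n : nat, 'I_n -> R.
Hypothesis z01 : forall n k, (0 < n)%N -> 0 < @z n k < 1.
Hypothesis zP : forall n, (0 < n)%N ->
  hpoly n a (sbeta b n.-1) = \prod_k ('X + (@z n k)%:P).

Definition zmean (g : R -> R) (n : nat) : R := n%:R^-1 * \sum_(k < n) g (@z n k).

Lemma zmeanD (c : R) g h n : zmean (fun t => g t + c * h t) n = zmean g n + c * zmean h n.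
Proof. by rewrite /zmean big_split /= -mulr_sumr mulrDr mulrCA. Qed.

Lemma zmean_le g h n : (forall t, 0 < t < 1 -> g t <= h t) -> zmean g n <= zmean h n.
Proof.
move=> gh; rewrite /zmean ler_wpM2l ?invr_ge0 //; apply: ler_sum => k _.
by apply/gh/z01; rewrite (leq_ltn_trans _ (ltn_ord k)).
Qed.

Lemma zmean_cst c n : (0 < n)%N -> zmean (fun=> c) n = c.
Proof.
move=> n0; rewrite /zmean sumr_const card_ord -[c *+ n]mulr_natl mulKf //.
by rewrite pnatr_eq0 -lt0n.
Qed.

Lemma zmean_norm g n M : (0 < n)%N -> (forall t, 0 < t < 1 -> `|g t| <= M) -> `|zmean g n| <= M.
Proof.
move=> n0 gM; rewrite ler_norml -[M in - M](zmean_cst _ n0) -{2}(zmean_cst M n0).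
have -> : - zmean (fun=> M) n = zmean (fun=> - M) n.
  by rewrite !zmean_cst.
by apply/andP; split; apply: zmean_le => t /gM; rewrite ler_norml => /andP[].
Qed.

(** Up to the factor [y], this is the Stieltjes transform at [- y]; [weight_equation] nearly puts it
    on the curve and [heq_inverse] identifies the point. *)
Lemma stieltjes_cvg (s : R) : 0 < s < 1 ->
  zmean (fun t => heq_y r s / (heq_y r s + t)) n @[n --> \oo] --> heq_w r s.
Proof.
move=> s01; have [s0 s1] := andP s01; set y := heq_y r s; set W := heq_w r s.
have r0 : 0 < r%:R :> R by rewrite ltr0n.
have y0 : 0 < y.
  by rewrite /y /heq_y /kappa mulr_gt0 ?divr_gt0 ?exprn_gt0 ?subr_gt0.
have W0 : 0 < W.
  by rewrite /W /heq_w divr_gt0 ?subr_gt0 // addr_gt0 // mulr_gt0.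
have [C HC] := weight_equation r_gt0 a_gt0 b_gt0 y0.
pose D := (W / r.+1%:R) ^+ r; have D0 : 0 < D by rewrite exprn_gt0 // divr_gt0.
pose C' := (`|C| + 1) / D; have C0 : 0 < C' by rewrite divr_gt0 // ltr_wpDl.
apply/cvgrPdist_lt => e e0.
(* [C' * eta] is then at most [e / 4], and with [eta] fixed the other term [C' / (eta * n)] vanishes
   as [n] grows. *)
pose eta := Num.min 1 (e / (4 * C')).
have eta0 : 0 < eta by rewrite lt_min ltr01 divr_gt0 // mulr_gt0.
have eta1 : eta <= 1 by rewrite ge_min lexx.
have etae : C' * eta <= e / 4.
  rewrite -ler_pdivlMl //; apply: (@le_trans _ _ (e / (4 * C'))); first by rewrite ge_min lexx orbT.
  by rewrite invfM mulrA mulrC.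
near=> n.
have n0 : (0 < n)%N by near: n; exists 1.
have nlarge : C' * (eta * n%:R)^-1 < e / 4.
  rewrite invfM mulrA mulrC -ltr_pdivlMr ?divr_gt0 //.
  rewrite -[ltRHS]invrK ltf_pV2 ?posrE ?invr_gt0 ?divr_gt0 ?ltr0n //.
  by near: n; apply: nbhs_infty_gtr.
have w01 : 0 <= zmean (fun t => y / (y + t)) n <= 1.
  apply/andP; split.
    rewrite -(zmean_cst 0 n0); apply: zmean_le => t /andP[t0 _].
    by rewrite divr_ge0 ?addr_ge0 ?ltW.
  rewrite -[leRHS](zmean_cst 1 n0); apply: zmean_le => t /andP[t0 _].
  by rewrite ler_pdivrMr ?addr_gt0 // mul1r lerDl ltW.
have := heq_inverse r_gt0 s01 w01; rewrite -/W -/y -/D => H.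
have zn := zP n0; have zn01 k := z01 k n0.
have := @HC n.-1; rewrite prednK // => /(_ (@z n) eta zn01 zn); rewrite eta0 eta1 => /(_ isT).
have -> : (\sum_k y / (y + @z n k)) / n%:R = zmean (fun t => y / (y + t)) n.
  by rewrite /zmean mulrC.
move=> {}HC; rewrite distrC.
have : `|zmean (fun t => y / (y + t)) n - W| <= C' * (eta + (eta * n%:R)^-1).
  rewrite /C' mulrAC ler_pdivlMr // mulrC (le_trans H) // (le_trans HC) //.
  rewrite ler_wpM2r // ?addr_ge0 ?invr_ge0 ?mulr_ge0 ?(ltW eta0) //.
  by rewrite (le_trans (ler_norm _)) // lerDl.
rewrite mulrDr => /le_lt_trans; apply; lra.
Unshelve. all: by end_near. Qed.

Lemma geometric_remainder m (x : R) : 1 - x != 0 ->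
  (1 - x)^-1 = \sum_(j < m) x ^+ j + x ^+ m / (1 - x).
Proof.
move=> nz; elim: m => [|m IH]; first by rewrite big_ord0 expr0 mul1r add0r.
by rewrite big_ord_recr /= -addrA {1}IH exprS; congr (_ + _); field.
Qed.

Lemma zmean_sum m (c : 'I_m -> R) (g : 'I_m -> R -> R) n :
  zmean (fun t => \sum_(j < m) c j * g j t) n = \sum_(j < m) c j * zmean (g j) n.
Proof.
rewrite /zmean exchange_big /= mulr_sumr; apply: eq_bigr => j _.
by rewrite -mulr_sumr mulrCA.
Qed.

(** Strong induction on [m]. With [v = 1 / y], [v ^+ m] times the error of moment [m] is bounded by
    the Stieltjes error, the errors of lower moments, and two remainders of order [m.+1]. A small
    [s] is fixed first to control the remainders; then [n] grows. *)
Lemma moment_cvg m : zmean (fun t => t ^+ m) n @[n --> \oo] --> kappa R r ^+ m * (fuss r m)%:R.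
Proof.
have r0 : 0 < r%:R :> R by rewrite ltr0n.
have k0 : 0 < kappa R r by rewrite /kappa divr_gt0 ?exprn_gt0.
pose mu j := kappa R r ^+ j * (fuss r j)%:R.
elim/ltn_ind: m => m IH; rewrite -/(mu m).
have [C HC] := fuss_expansion R r_gt0 m.+1.
(* Divided by [v ^+ m], the remainders are at most [s * K]: the first summand covers the geometric
   tail, the second the tail of the Fuss series, and 1 makes [K] positive. *)
pose K := 2 ^+ r.+1 / kappa R r + `|C| * kappa R r ^+ m + 1.
have K0 : 0 < K.
  by rewrite ltr_wpDl // addr_ge0 ?mulr_ge0 ?exprn_ge0 ?(ltW k0) // invr_ge0 ltW.
apply/cvgrPdist_lt => e e0.
pose s := Num.min 2^-1 (e / (2 * K)).
have s0 : 0 < s by rewrite lt_min invr_gt0 ltr0n divr_gt0 // mulr_gt0.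
have s2 : s <= 2^-1 by rewrite ge_min lexx.
have s1 : s < 1 by rewrite (le_lt_trans s2) // invf_lt1 // ltr1n.
have Ks : s * K <= e / 2.
  rewrite -ler_pdivlMr // (@le_trans _ _ (e / (2 * K))) ?ge_min ?lexx ?orbT //.
  by rewrite invfM mulrA.
have u0 : 0 < 1 - s by rewrite subr_gt0.
have y0 : 0 < heq_y r s by rewrite /heq_y mulr_gt0 // divr_gt0 ?exprn_gt0.
pose v := (heq_y r s)^-1; have v0 : 0 < v by rewrite invr_gt0.
have vE : v = s / (1 - s) ^+ r.+1 / kappa R r.
  by rewrite /v /heq_y; field; rewrite !gt_eqF ?exprn_gt0.
have us : (1 - s) ^+ r.+1 <= 1 by rewrite exprn_ile1 ?(ltW u0) // gerBl (ltW s0).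
have v_ge : s / kappa R r <= v.
  rewrite vE ler_pM2r ?invr_gt0 // ler_peMr ?(ltW s0) //.
  by rewrite invf_ge1 // exprn_gt0.
have v_le : v <= s * (2 ^+ r.+1 / kappa R r).
  rewrite vE -mulrA ler_pM2l // ler_pM2r ?invr_gt0 //.
  rewrite -exprVn lerXn2r ?nnegrE ?invr_ge0 ?(ltW u0) //.
  by rewrite -[leRHS]invrK lef_pV2 ?posrE //; lra.
pose q j n := zmean (fun t => t ^+ j) n.
pose T n := `|zmean (fun t => heq_y r s / (heq_y r s + t)) n - heq_w r s| +
  \sum_(j < m) v ^+ j * `|q j n - mu j|.
have T0 : T n @[n --> \oo] --> 0.
  have h1 : `|zmean (fun t => heq_y r s / (heq_y r s + t)) n - heq_w r s| @[n --> \oo] --> 0.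
    rewrite -[X in _ --> X](normr0 R) -[X in `|X|](subrr (heq_w r s)).
    by apply: cvg_norm; apply: cvgB; [apply: stieltjes_cvg; rewrite s0 s1|exact: cvg_cst].
  have h2 : \sum_(j < m) v ^+ j * `|q j n - mu j| @[n --> \oo] --> \sum_(j < m) (0 : R).
    apply: cvg_big => [|j _]; first exact: add_continuous.
     rewrite -[X in _ --> X](mulr0 (v ^+ j)) -[X in _ * X](normr0 R).
    rewrite -[X in `|X|](subrr (mu j)); apply: cvgMr; apply: cvg_norm.
    by apply: cvgB; [exact: IH|exact: cvg_cst].
  by rewrite big1 // in h2; rewrite -[X in _ --> X](addr0 0); apply: cvgD.
move/cvgrPdist_lt : T0 => T0.
have e'0 : 0 < v ^+ m * (e / 2) by rewrite mulr_gt0 ?exprn_gt0 ?divr_gt0.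
near=> n.
have n0 : (0 < n)%N by near: n; exists 1.
have Tn : T n < v ^+ m * (e / 2).
  have : `|0 - T n| < v ^+ m * (e / 2).
    by near: n; exact: (T0 _ e'0).
  by rewrite sub0r normrN => /(le_lt_trans (ler_norm _)).
rewrite distrC -/(q m n).
have E : (- v) ^+ m * (q m n - mu m) =
   (zmean (fun t => heq_y r s / (heq_y r s + t)) n - heq_w r s)
   - \sum_(j < m) (- v) ^+ j * (q j n - mu j)
   - zmean (fun t => (- v * t) ^+ m.+1 * (heq_y r s / (heq_y r s + t))) n
   + (heq_w r s - \sum_(j < m.+1) (fuss r j)%:R * (- (s / (1 - s) ^+ r.+1)) ^+ j).
  have -> : zmean (fun t => heq_y r s / (heq_y r s + t)) n =
      \sum_(j < m.+1) (- v) ^+ j * q j n +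
      zmean (fun t => (- v * t) ^+ m.+1 * (heq_y r s / (heq_y r s + t))) n.
    rewrite /q -(zmean_sum (fun j : 'I_m.+1 => (- v) ^+ j) (fun j t => t ^+ j)).
    rewrite -[X in _ + X]mul1r -zmeanD /zmean; congr (_ * _); apply: eq_bigr => k _.
    have /andP[t0 _] := z01 k n0; set t := @z n k in t0 *.
    have nz : 1 - - v * t != 0 by rewrite mulNr opprK gt_eqF // addr_gt0 ?mulr_gt0.
    have ny : heq_y r s != 0 by rewrite gt_eqF.
    have nyt : heq_y r s + t != 0 by rewrite gt_eqF // addr_gt0.
    have -> : heq_y r s / (heq_y r s + t) = (1 - - v * t)^-1.
      by rewrite /v; field; rewrite ny mulN1r opprK.
    rewrite mul1r {1}(@geometric_remainder m.+1) //; congr (_ + _).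
    by apply: eq_bigr => j _; rewrite exprMn.
  have -> : \sum_(j < m.+1) (fuss r j)%:R * (- (s / (1 - s) ^+ r.+1)) ^+ j =
     \sum_(j < m.+1) (- v) ^+ j * mu j.
    apply: eq_bigr => j _; rewrite /mu.
    have -> : - (s / (1 - s) ^+ r.+1) = - v * kappa R r.
      by rewrite vE mulNr divfK // gt_eqF.
    by rewrite exprMn; ring.
  under [X in _ = _ - X - _ + _]eq_bigr do rewrite mulrBr.
  rewrite sumrB !big_ord_recr /=; ring.
have vm0 : 0 < v ^+ m by rewrite exprn_gt0.
rewrite -(ltr_pM2l vm0).
have -> : v ^+ m * `|q m n - mu m| = `|(- v) ^+ m * (q m n - mu m)|.
  by rewrite normrM normrX normrN (gtr0_norm v0).
rewrite E; set R1 := zmean (fun t => (- v * t) ^+ _ * _) n; set R2 := heq_w r s - \sum_(_ < _) _.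
have b1 : `|R1| <= v ^+ m.+1.
  apply: zmean_norm => // t /andP[t0 t1]. rewrite normrM normrX mulNr normrN.
  have yt : 0 < heq_y r s + t by rewrite addr_gt0.
  rewrite -[leRHS]mulr1 ler_pM ?exprn_ge0 //.
    by rewrite lerXn2r ?nnegrE ?(ltW v0) // ger0_norm ?mulr_ge0 ?ltW // gtr_pMr.
  by rewrite ger0_norm ?divr_ge0 ?ltW // ltr_pdivrMr // mul1r ltrDl.
have b2 : `|R2| <= `|C| * s ^+ m.+1.
  apply: (le_trans (HC s _)); first by rewrite s0 s2.
  by rewrite ler_wpM2r ?exprn_ge0 ?(ltW s0) // ler_norm.
have b3 : `|\sum_(j < m) (- v) ^+ j * (q j n - mu j)| <= \sum_(j < m) v ^+ j * `|q j n - mu j|.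
  apply: (le_trans (ler_norm_sum _ _ _)); apply: ler_sum => j _.
  by rewrite normrM normrX normrN (gtr0_norm v0).
have b4 : v ^+ m.+1 + `|C| * s ^+ m.+1 <= v ^+ m * (e / 2).
  apply: (@le_trans _ _ (v ^+ m * (s * K))); last by rewrite ler_pM2l.
  have sk : s ^+ m <= v ^+ m * kappa R r ^+ m.
    rewrite -exprMn lerXn2r ?nnegrE ?mulr_ge0 ?(ltW s0) ?(ltW v0) ?(ltW k0) //.
    by rewrite -ler_pdivrMr.
  have h1 : v ^+ m * v <= v ^+ m * (s * (2 ^+ r.+1 / kappa R r)) by rewrite ler_pM2l.
  have h2 : `|C| * s * s ^+ m <= `|C| * s * (v ^+ m * kappa R r ^+ m).
    by rewrite ler_wpM2l ?mulr_ge0 ?(ltW s0).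
  have h3 : 0 < v ^+ m * s by rewrite mulr_gt0.
  have -> : v ^+ m * (s * K) = v ^+ m * (s * (2 ^+ r.+1 / kappa R r)) + `|C| * s * (v ^+ m * kappa R r ^+ m) + v ^+ m * s.
    by rewrite /K; ring.
  have -> : v ^+ m.+1 = v ^+ m * v by rewrite exprSr.
  have -> : `|C| * s ^+ m.+1 = `|C| * s * s ^+ m by rewrite exprS mulrA.
  by move: h1 h2 h3; set x1 := v ^+ m * v; set x2 := v ^+ m * (s * _); set x3 := `|C| * s * s ^+ m;
    set x4 := `|C| * s * (_ * _); set x5 := v ^+ m * s; move: x1 x2 x3 x4 x5 => *; lra.
have -> : v ^+ m * e = v ^+ m * (e / 2) + v ^+ m * (e / 2).
  by rewrite -mulrDr -splitr.
rewrite (le_lt_trans (ler_normD _ _)) // (le_lt_trans (lerD (ler_normB _ _) b2)) //.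
rewrite -addrA ltr_leD //; last by rewrite (le_trans _ b4) // lerD2r.
by apply: le_lt_trans Tn; rewrite (le_trans (ler_normB _ _)) // lerD2l.
Unshelve. all: by end_near. Qed.

End MomentLimit.

(** * The change of variables [xphi] *)

Section Trigonometry.
Variables (R : realType) (r : nat).
Hypothesis r_gt0 : (0 < r)%N.
Implicit Types (x : R) (k : nat).

Local Notation T := (pi / r.+1%:R : R).

(** The quotient [sin(k x) / sin x], a Chebyshev polynomial of the second kind in [cos x]; the
    recursive form is also meaningful and continuous at [x = 0]. *)
Fixpoint sinquo k x : R := if k is k'.+1 then sinquo k' x * cos x + cos (k'%:R * x) else 0.

Lemma sinquoE k x : sin (k%:R * x) = sinquo k x * sin x.
Proof.
elim: k => [|k IH]; first by rewrite !mul0r sin0.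
by rewrite -natr1 mulrDl mul1r sinD IH /=; ring.
Qed.

Lemma sinquo_0 k : sinquo k 0 = k%:R.
Proof. by elim: k => //= k IH; rewrite IH mulr0 cos0 mulr1 natr1. Qed.

Lemma continuous_sinquo k : continuous (sinquo k).
Proof.
elim: k => [|k IH] x; first exact: cvg_cst.
have C : continuous (fun y : R => cos (k%:R * y)).
  by move=> y; apply: continuous_comp; [exact: mulrl_continuous|exact: continuous_cos].
by apply: (@cvgD _ _ _ (nbhs x) _ (fun y => sinquo k y * cos y) (fun y => cos (k%:R * y)));
  [apply: cvgM; [exact: IH|exact: continuous_cos]|exact: C].
Qed.

Lemma T_gt0 : 0 < T.
Proof. by rewrite divr_gt0 // pi_gt0. Qed.

Lemma sin_mul_gt0 k x : (0 < k <= r.+1)%N -> 0 < x < T -> 0 < sin (k%:R * x).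
Proof.
move=> /andP[k0 kr] /andP[x0 xT]; apply: sin_gt0_pi; rewrite mulr_gt0 ?ltr0n //=.
have : r.+1%:R * x < pi by rewrite mulrC -ltr_pdivlMr.
by apply: le_lt_trans; rewrite ler_pM2r // ler_nat.
Qed.

Lemma sin_pos x : 0 < x < T -> [/\ 0 < sin x, 0 < sin (r%:R * x) & 0 < sin (r.+1%:R * x)].
Proof.
move=> xT; split; first by rewrite -[x]mul1r; exact: (@sin_mul_gt0 1).
- by apply: sin_mul_gt0; rewrite // r_gt0 leqnSn.
- by apply: sin_mul_gt0; rewrite // leqnn.
Qed.

Lemma sinquo_r_gt0 x : 0 <= x <= T -> 0 < sinquo r x.
Proof.
move=> /andP[]; rewrite le_eqVlt => /orP[/eqP <- _|x0 xT]; first by rewrite sinquo_0 ltr0n.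
have xpi : r%:R * x < pi.
  rewrite (@lt_le_trans _ _ (r.+1%:R * x)) // ?ltr_pM2r // ?ltr_nat //.
  by rewrite mulrC -ler_pdivlMr.
have s0 : 0 < sin (r%:R * x) by apply: sin_gt0_pi; rewrite xpi mulr_gt0 ?ltr0n.
have s1 : 0 < sin x.
  apply: sin_gt0_pi; rewrite x0 (le_lt_trans _ xpi) // ler_peMl ?(ltW x0) //.
  by rewrite ler1n.
by move: s0; rewrite sinquoE pmulr_lgt0.
Qed.

(** [xphi] with the [r.+1] factors [sin x] cancelled, hence continuous up to both ends of
    [[0, T]]. *)
Definition xext x := kappa R r * (sinquo r.+1 x ^+ r.+1 / sinquo r x ^+ r).

Lemma xphi_ext x : 0 < x < T -> xphi r x = xext x.
Proof.
move=> xT; have [s0 _ _] := sin_pos xT.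
have := sinquo_r_gt0; move: (xT) => /andP[/ltW x0 /ltW x1] /(_ x); rewrite x0 x1 => /(_ isT) v0.
rewrite /xphi /xext /kappa !sinquoE !exprMn [sin x ^+ r.+1]exprS.
by field; rewrite !gt_eqF ?exprn_gt0.
Qed.

Lemma xext_continuous x : 0 <= x <= T -> {for x, continuous xext}.
Proof.
move=> xT; have C k : {for x, continuous (fun y => sinquo k y ^+ k)}.
  apply: (@continuous_comp _ _ _ (sinquo k) (fun y => y ^+ k)); first exact: continuous_sinquo.
  exact: exprn_continuous.
apply: cvgM; first exact: cvg_cst.
apply: cvgM; first exact: C.
by apply: cvgV; [rewrite expf_neq0 // gt_eqF // sinquo_r_gt0|exact: C].
Qed.

Definition xden x :=
  r.+1%:R ^+ 2 * sin (r%:R * x) ^+ 2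
  - 2 * r%:R * r.+1%:R * sin (r.+1%:R * x) * sin (r%:R * x) * cos x
  + r%:R ^+ 2 * sin (r.+1%:R * x) ^+ 2.

(** [xden x] is the squared modulus of [(r+1) sin(r x) - r sin((r+1) x) e^(i x)], whose imaginary
    part does not vanish. *)
Lemma xden_gt0 x : 0 < x < T -> 0 < xden x.
Proof.
move=> xT; have [s0 _ sr] := sin_pos xT.
have -> : xden x = (r.+1%:R * sin (r%:R * x) - r%:R * sin (r.+1%:R * x) * cos x) ^+ 2
  + (r%:R * sin (r.+1%:R * x) * sin x) ^+ 2.
  have -> : (r%:R * sin (r.+1%:R * x) * sin x) ^+ 2 = (r%:R * sin (r.+1%:R * x)) ^+ 2 * (1 - cos x ^+ 2).
    by rewrite -sin2cos2 exprMn.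
  by rewrite /xden; ring.
by rewrite ltr_wpDl ?sqr_ge0 // exprn_gt0 // !mulr_gt0 // ltr0n.
Qed.

Definition xder x := - (xphi r x * xden x / (sin x * sin (r%:R * x) * sin (r.+1%:R * x))).

Lemma is_derive_sin_mul k x : is_derive x 1 (fun y => sin (k%:R * y)) (k%:R * cos (k%:R * x)).
Proof.
have h : is_derive x 1 (fun y : R => k%:R * y) k%:R.
  have := is_deriveZ k%:R (is_derive_id x (1 : R)); rewrite -[k%:R *: 1]/(k%:R * 1) mulr1.
  by [].
by have := is_derive1_comp (is_derive_sin (k%:R * x)) h; rewrite mulrC.
Qed.

Lemma is_derive_fctX (f : R -> R) n x df : is_derive x 1 f df ->
  is_derive x 1 (fun y => f y ^+ n) (n%:R * f x ^+ n.-1 * df).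
Proof. by move=> h; have := is_deriveX n h; rewrite exprfctE. Qed.

Lemma is_derive_fctM (f g : R -> R) x df dg : is_derive x 1 f df -> is_derive x 1 g dg ->
  is_derive x 1 (fun y => f y * g y) (f x * dg + g x * df).
Proof. by move=> h k; exact: (is_deriveM h k). Qed.

Lemma is_derive_fctV (f : R -> R) x df : f x != 0 -> is_derive x 1 f df ->
  is_derive x 1 (fun y => (f y)^-1) (- df / f x ^+ 2).
Proof.
move=> fx h; have := is_deriveV fx h; congr is_derive.
by rewrite -[_ *: _]/(_ * _) mulrC mulrN mulNr.
Qed.

Lemma is_derive_fctZ (c : R) (f : R -> R) x df : is_derive x 1 f df ->
  is_derive x 1 (fun y => c * f y) (c * df).
Proof. by move=> h; exact: (is_deriveZ c h). Qed.

(** The logarithmic derivative is [(r+1)^2 cot((r+1)x) - r^2 cot(r x) - cot x]; over the common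
    denominator its numerator is [- xden x] by the addition formulas. *)
Lemma is_derive_xphi x : 0 < x < T -> is_derive x 1 (xphi r) (xder x).
Proof.
move=> xT; have [s0 s1 s2] := sin_pos xT.
have d0 := is_derive_sin x.
have d1 := is_derive_sin_mul r x; have d2 := is_derive_sin_mul r.+1 x.
pose den := fun y : R => sin y * sin (r%:R * y) ^+ r.
have den0 : den x != 0 by rewrite /den mulf_neq0 ?expf_neq0 ?gt_eqF.
have dd : is_derive x 1 den _ := is_derive_fctM d0 (is_derive_fctX r d1).
have := is_derive_fctZ (kappa R r) (is_derive_fctM (is_derive_fctX r.+1 d2) (is_derive_fctV den0 dd)).
have -> : (fun y => kappa R r * (sin (r.+1%:R * y) ^+ r.+1 * (den y)^-1)) = xphi r.
  apply/funext => y; rewrite /xphi /kappa /den !invfM; ring.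
congr is_derive; rewrite /xder.
set A := sin x; set B := sin (r%:R * x); set C := sin (r.+1%:R * x).
set ca := cos x; set cb := cos (r%:R * x); set cc := cos (r.+1%:R * x).
have C_E : C = B * ca + cb * A by rewrite /C -natr1 mulrDl mul1r sinD.
have cc_E : cc = cb * ca - B * A by rewrite /cc -natr1 mulrDl mul1r cosD.
have A2 : A ^+ 2 = 1 - ca ^+ 2 by rewrite /A sin2cos2.
have h1 : A * cc = C * ca - B.
  transitivity (A * cb * ca - B * A ^+ 2); first by rewrite cc_E; ring.
  by rewrite A2 C_E; ring.
have h2 : A * cb = C - B * ca by rewrite C_E; ring.
have -> : xden x = B * C * ca + r%:R ^+ 2 * (A * C * cb) - r.+1%:R ^+ 2 * (A * B * cc).
  transitivity (B * C * ca + r%:R ^+ 2 * (C * (A * cb)) - r.+1%:R ^+ 2 * (B * (A * cc))); last by ring.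
  by rewrite h1 h2 /xden -/A -/B -/C -/ca -natr1; ring.
rewrite /xphi /kappa /den -/A -/B -/C -/ca.
have -> : B ^+ r = B ^+ r.-1 * B by rewrite -exprSr prednK.
have -> : C ^+ r.+1 = C ^+ r * C by rewrite exprSr.
have [A0 B0 C0] : [/\ A != 0, B != 0 & C != 0] by split; rewrite gt_eqF.
have P0 : B ^+ r.-1 != 0 by rewrite expf_neq0.
have Q0 : r.+1%:R ^+ r.+1 != 0 :> R by rewrite expf_neq0.
move: (B ^+ r.-1) (C ^+ r) (r.+1%:R ^+ r.+1) P0 Q0 => P Q S P0 Q0 /=.
by field; rewrite A0 B0 C0 P0 Q0.
Qed.

Lemma xphi_gt0 x : 0 < x < T -> 0 < xphi r x.
Proof.
move=> xT; have [s0 s1 s2] := sin_pos xT.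
by rewrite /xphi; apply: divr_gt0; rewrite !mulr_gt0 ?exprn_gt0 ?ltr0n.
Qed.

Lemma xder_lt0 x : 0 < x < T -> xder x < 0.
Proof.
move=> xT; have [s0 s1 s2] := sin_pos xT.
rewrite /xder oppr_lt0; apply: divr_gt0; first exact: mulr_gt0 (xphi_gt0 xT) (xden_gt0 xT).
exact: mulr_gt0 (mulr_gt0 s0 s1) s2.
Qed.

(** In other words, the density is the image under [xphi] of the uniform law on []0, T[]; the sign
    reflects that [xphi] decreases. *)
Lemma nuphiE x : 0 < x < T -> nuphi r x = - (r.+1%:R / (pi * xder x)).
Proof.
move=> xT; have [s0 s1 s2] := sin_pos xT.
have d0 := xden_gt0 xT; have p0 := pi_gt0 R.
have x0 := xphi_gt0 xT.
rewrite /nuphi -/(xden x) /xder.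
move: (pi : R) (xden x) (xphi r x) (sin x) (sin (r%:R * x)) (sin (r.+1%:R * x)) p0 d0 x0 s0 s1 s2.
by move=> p D X A B C p0 D0 X0 A0 B0 C0; field; rewrite !gt_eqF.
Qed.

Lemma xext_decr : {in `[0, T] &, forall x y, x < y -> xext y < xext x}.
Proof.
have ext x : x \in `]0, T[ -> is_derive x 1 xext (xder x).
  rewrite in_itv /= => xT; have := is_derive_xphi xT.
  apply: near_eq_is_derive; near=> y; apply: xphi_ext.
  by near: y; have := @near_in_itvoo R 0 T x; rewrite in_itv; apply.
move=> x y; rewrite !in_itv /= => /andP[x0 xT] /andP[y0 yT] xy.
apply: (@ltr0_derive1_decr R xext 0 T) => //.
- by move=> z /ext [].
- move=> z zT; rewrite derive1E; have [_ ->] := ext z zT; apply: xder_lt0.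
  by move: zT; rewrite in_itv.
- by apply: continuous_in_subspaceT => z; rewrite inE /= in_itv /= => /xext_continuous.
Unshelve. all: by end_near. Qed.

Lemma xext0 : xext 0 = 1.
Proof.
rewrite /xext !sinquo_0 /kappa.
have r0 : r%:R ^+ r != 0 :> R by rewrite expf_neq0 // pnatr_eq0 -lt0n.
have r1 : r.+1%:R ^+ r.+1 != 0 :> R by rewrite expf_neq0.
by field; rewrite r0 r1.
Qed.

Lemma xextT : xext T = 0.
Proof.
have h : sinquo r.+1 T * sin T = 0 by rewrite -sinquoE mulrC divfK // sinpi.
have T0 := T_gt0; have sT : 0 < sin T.
  apply: sin_gt0_pi; rewrite T0 /= ltr_pdivrMr // ltr_pMr ?pi_gt0 //.
  by rewrite ltr1n ltnS.
move/eqP: h; rewrite mulf_eq0 (gt_eqF sT) orbF => /eqP E.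
by rewrite /xext E expr0n /= mul0r mulr0.
Qed.

Lemma xphi_bij : set_bij `]0, T[ `]0, (1 : R)[ (xphi r).
Proof.
have T0 := T_gt0.
have cc x : 0 < x < T -> (x \in `[0, T]) by move=> /andP[x0 xT]; rewrite in_itv /= !ltW.
have m0 : 0 \in `[0, T] by rewrite in_itv /= lexx ltW.
have mT : T \in `[0, T] by rewrite in_itv /= lexx ltW.
split.
- move=> x /= ; rewrite in_itv /= => xT; rewrite in_itv /= xphi_ext //.
  have /andP[x0 x1] := xT.
  have h0 := xext_decr m0 (cc _ xT) x0; have h1 := xext_decr (cc _ xT) mT x1.
  by move: h0 h1; rewrite xext0 xextT => -> ->.
- move=> x y; rewrite !inE /= !in_itv /= => xT yT; rewrite !xphi_ext // => E.
  case: (ltgtP x y) => // xy.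
  + by have := xext_decr (cc _ xT) (cc _ yT) xy; rewrite E ltxx.
  + by have := xext_decr (cc _ yT) (cc _ xT) xy; rewrite E ltxx.
- move=> v /=; rewrite in_itv /= => /andP[v0 v1].
  have cont : {within `[0, T], continuous xext}.
    by apply: continuous_in_subspaceT => z; rewrite inE /= in_itv /= => /xext_continuous.
  have [|x xT xv] := @IVT R xext 0 T v (ltW T0) cont.
    by rewrite xext0 xextT ge_min le_max (ltW v0) (ltW v1) orbT.
  have x0T : 0 < x < T.
    move: xT; rewrite in_itv /= => /andP[x0 xT].
    rewrite !lt_neqAle x0 xT !andbT; apply/andP; split; apply/eqP => E.
      by move: v1; rewrite -xv -E xext0 ltxx.
    by move: v0; rewrite -xv E xextT ltxx.
  by exists x; rewrite /= ?in_itv //= xphi_ext.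
Qed.

End Trigonometry.

(** * A primitive for the powers of [xphi] *)

Section Antiderivative.
Variables (R : realType) (r : nat).
Hypothesis r_gt0 : (0 < r)%N.
Implicit Types (x : R) (k : nat).

Local Notation T := (pi / r.+1%:R : R).

(** Real form of [(1 + rho e^(i th))^N = S^N e^(i N ph)], applied below to [cos] and [sin]; the
    hypothesis is the case [N = 1]. *)
Lemma binomial_phase (f : R -> R) (rho S th ph : R) N A :
  (forall B, f B + rho * f (B + th) = S * f (B + ph)) ->
  \sum_(j < N.+1) 'C(N, j)%:R * rho ^+ j * f (j%:R * th + A) = S ^+ N * f (N%:R * ph + A).
Proof.
move=> H; elim: N A => [|N IH] A.
  by rewrite big_ord1 /= bin0 !mul0r add0r !mul1r.
have -> : S ^+ N.+1 * f (N.+1%:R * ph + A) = S ^+ N * f (N%:R * ph + A) + rho * (S ^+ N * f (N%:R * ph + (A + th))).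
  have -> : N.+1%:R * ph + A = N%:R * ph + A + ph by rewrite -natr1; ring.
  by rewrite exprSr -mulrA -H -addrA; ring.
rewrite -!IH big_ord_recl /= bin0 mul0r add0r.
have -> : \sum_(i < N.+1) 'C(N.+1, bump 0 i)%:R * rho ^+ bump 0 i * f ((bump 0 i)%:R * th + A) =
  \sum_(i < N.+1) 'C(N, i.+1)%:R * rho ^+ i.+1 * f (i.+1%:R * th + A) +
  rho * \sum_(i < N.+1) 'C(N, i)%:R * rho ^+ i * f (i%:R * th + (A + th)).
  rewrite mulr_sumr -big_split /=; apply: eq_bigr => i _.
  rewrite /bump add1n binS natrD exprS.
  have -> : i%:R * th + (A + th) = i.+1%:R * th + A by rewrite -natr1; ring.
  ring.
rewrite addrA; congr (_ + _).
rewrite [RHS]big_ord_recl /= bin0 mul0r add0r; congr (_ + _).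
rewrite big_ord_recr /= bin_small // !mul0r addr0.
by apply: eq_bigr => i _.
Qed.

(** Imaginary part of the integral of [((1 + zeta)^(r+1) / zeta)^m] against [dzeta / zeta], with
    [zeta = e^(i(r+1)x) / sinquo r x]. The linear term is the logarithm coming from [j = m]; in the
    sum that index contributes 0, as division by 0 gives 0. *)
Definition fuss_prim m x : R :=
  r.+1%:R * 'C(r.+1 * m, m)%:R * x +
  \sum_(j < (r.+1 * m).+1) 'C(r.+1 * m, j)%:R *
    (sinquo r x ^+ m / sinquo r x ^+ j * (sin ((j%:R - m%:R) * (r.+1%:R * x)) / (j%:R - m%:R))).

Lemma fuss_prim0 m : fuss_prim m 0 = 0.
Proof.
rewrite /fuss_prim mulr0 add0r big1 // => j _.
by rewrite !mulr0 sin0 mul0r !mulr0.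
Qed.

Lemma sin_natpi k : sin (k%:R * pi) = 0 :> R.
Proof.
elim: k => [|k IH]; first by rewrite mul0r sin0.
by rewrite -natr1 mulrDl mul1r sinDpi IH oppr0.
Qed.

Lemma fuss_primT m : fuss_prim m T = pi * (fuss r m)%:R.
Proof.
have E : r.+1%:R * T = pi by rewrite mulrC divfK.
rewrite /fuss_prim E big1 ?addr0; first by rewrite mulrAC E.
move=> j _; suff -> : sin ((j%:R - m%:R) * pi) = 0 :> R by rewrite mul0r !mulr0.
have [mj|/ltnW jm] := leqP m j; first by rewrite -natrB // sin_natpi.
by rewrite -opprB mulNr sinN -natrB // sin_natpi oppr0.
Qed.

Lemma continuous_sin_scale (c d x : R) : {for x, continuous (fun y => sin (c * (d * y)))}.
Proof.
have -> : (fun y => sin (c * (d * y))) = (fun y => sin ((c * d) * y)).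
  by apply/funext => y; rewrite mulrA.
by apply: continuous_comp; [exact: mulrl_continuous|exact: continuous_sin].
Qed.

Lemma continuousX_for (f : R -> R) n x : {for x, continuous f} -> {for x, continuous (fun y => f y ^+ n)}.
Proof.
move=> h; apply: (@continuous_comp _ _ _ f (fun y => y ^+ n)); first exact: h.
exact: exprn_continuous.
Qed.

Lemma fuss_prim_continuous m x : 0 <= x <= T -> {for x, continuous (fuss_prim m)}.
Proof.
move=> xT; have w0 : sinquo r x != 0 by rewrite gt_eqF // sinquo_r_gt0.
have cw k : {for x, continuous (fun y => sinquo r y ^+ k)}.
  by apply: continuousX_for; exact: continuous_sinquo.
apply: cvgD; first by apply: mulrl_continuous.
apply: cvg_big => [|j _]; first exact: add_continuous.
apply: cvgM; first exact: cvg_cst.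
apply: cvgM.
  by apply: cvgM; [exact: cw|apply: cvgV; [rewrite expf_neq0|exact: cw]].
by apply: cvgM; [exact: continuous_sin_scale|exact: cvg_cst].
Qed.

Lemma is_derive_sin_scale (c d x : R) :
  is_derive x 1 (fun y => sin (c * (d * y))) (c * d * cos (c * (d * x))).
Proof.
have h : is_derive x 1 (fun y : R => c * (d * y)) (c * d).
  have := is_deriveZ (c * d) (is_derive_id x (1 : R)).
  have -> : (c * d) \*: id = (fun y => c * (d * y)) by apply/funext => y /=; rewrite mulrA.
  by rewrite -[(c * d) *: 1]/((c * d) * 1) mulr1.
have := @is_derive1_comp _ sin (fun y => c * (d * y)) x _ _ (is_derive_sin _) h.
by rewrite mulrC.
Qed.

Lemma is_derive_fctsum n (h : 'I_n -> R -> R) (dh : 'I_n -> R) x :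
  (forall i, is_derive x 1 (h i) (dh i)) ->
  is_derive x 1 (fun y => \sum_i h i y) (\sum_i dh i).
Proof.
move=> hh; have := is_derive_sum hh; congr is_derive; apply/funext => y.
by rewrite fct_sumE.
Qed.

Lemma is_derive_fuss_prim m x : 0 < x < T ->
  is_derive x 1 (fuss_prim m) (r.+1%:R * (xphi r x / kappa R r) ^+ m).
Proof.
move=> xT; have [s0 s1 s2] := sin_pos r_gt0 xT.
have [x0 x1] := andP xT.
have W0 : 0 < sinquo r x by rewrite sinquo_r_gt0 // !ltW.
pose L := r%:R * cos (r%:R * x) / sin (r%:R * x) - cos x / sin x.
have dw : is_derive x 1 (sinquo r) (L * sinquo r x).
  have wE y : 0 < y < T -> sin (r%:R * y) / sin y = sinquo r y.
    by move=> yT; have [t0 _ _] := sin_pos r_gt0 yT; rewrite sinquoE mulfK // gt_eqF.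
  have s0' : sin x != 0 by rewrite gt_eqF.
  have : is_derive x 1 (fun y => sin (r%:R * y) / sin y) (L * sinquo r x).
    have := is_derive_fctM (is_derive_sin_mul r x) (is_derive_fctV s0' (is_derive_sin x)).
    congr is_derive; rewrite -wE // /L; move: s0' (gt_eqF s1) => + /negbT.
    by move: (sin x) (sin (r%:R * x)) (cos x) (cos _) => A B C D A0 B0; field; rewrite A0 B0.
  apply: near_eq_is_derive; near=> y; apply: wE; near: y.
  by have := @near_in_itvoo R 0 T x; rewrite in_itv; apply.
have w0 : sinquo r x != 0 by rewrite gt_eqF.
pose w := sinquo r x; rewrite -/w in w0 W0 dw.
pose th := r.+1%:R * x.
(* The uniform derivative formula is wrong at [j = m], where the term is constantly 0; the
   correction is cancelled by the linear term. *)
have dterm (j : 'I_(r.+1 * m).+1) : is_derive x 1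
   (fun y => 'C(r.+1 * m, j)%:R * (sinquo r y ^+ m / sinquo r y ^+ j * (sin ((j%:R - m%:R) * (r.+1%:R * y)) / (j%:R - m%:R))))
   ('C(r.+1 * m, j)%:R * (w ^+ m / w ^+ j * (r.+1%:R * cos ((j%:R - m%:R) * th) - L * sin ((j%:R - m%:R) * th)))
      - (if j == m :> nat then r.+1%:R * 'C(r.+1 * m, j)%:R else 0)).
  have wj0 : w ^+ j != 0 by rewrite expf_neq0.
  have d1 := is_derive_fctM (is_derive_fctX m dw) (@is_derive_fctV R (fun y => sinquo r y ^+ j) x _ wj0 (is_derive_fctX j dw)).
  have dc : is_derive x (1 : R) (fun=> (j%:R - m%:R)^-1 : R) 0 := is_derive_cst _ _ _.
  have d2 : is_derive x 1 (fun y => sin ((j%:R - m%:R) * (r.+1%:R * y)) / (j%:R - m%:R)) _ :=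
    is_derive_fctM (is_derive_sin_scale (j%:R - m%:R) r.+1%:R x) dc.
  have := is_derive_fctZ 'C(r.+1 * m, j)%:R (is_derive_fctM d1 d2).
  congr is_derive; rewrite -/w -/th.
  have pw k : k%:R * w ^+ k.-1 * (L * w) = k%:R * L * w ^+ k.
    by case: k => [|k]; rewrite ?mul0r // exprS /=; ring.
  rewrite !pw; case: eqP => [->|/eqP jm].
    by rewrite subrr !mul0r cos0 sin0 invr0 (divff (expf_neq0 m w0)); ring.
  have jm0 : j%:R - m%:R != 0 :> R by rewrite subr_eq0 eqr_nat.
  have wm0 : w ^+ m != 0 by rewrite expf_neq0.
  rewrite subr0; move: (w ^+ m) (w ^+ j) wj0 wm0 (cos _) (sin _) => P Q Q0 P0 c s.
  by field; rewrite Q0 jm0.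
have d0 : is_derive x 1 (fun y => r.+1%:R * 'C(r.+1 * m, m)%:R * y) (r.+1%:R * 'C(r.+1 * m, m)%:R * 1).
  exact: (is_derive_fctZ _ (is_derive_id x (1 : R))).
have := is_deriveD d0 (is_derive_fctsum dterm).
congr is_derive; rewrite sumrB mulr1.
have -> : \sum_(j < (r.+1 * m).+1) (if j == m :> nat then r.+1%:R * 'C(r.+1 * m, j)%:R else 0) = r.+1%:R * 'C(r.+1 * m, m)%:R :> R.
  have mN : (m < (r.+1 * m).+1)%N by rewrite ltnS leq_pmull.
  by rewrite -big_mkcond /= (big_pred1 (Ordinal mN)).
rewrite addrC subrK.
have rhoE k : w ^- k = (w^-1) ^+ k by rewrite exprVn.
pose S := sin (r.+1%:R * x) / sin (r%:R * x).
have rho : w^-1 = sin x / sin (r%:R * x).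
  by rewrite /w sinquoE; field; rewrite w0 gt_eqF.
have B0 : sin (r%:R * x) != 0 by rewrite gt_eqF.
have Hcos B : cos B + w^-1 * cos (B + th) = S * cos (B + x).
  have -> : B + th = (B + x) + r%:R * x by rewrite /th -natr1; ring.
  have -> : cos B = cos ((B + x) - x) by rewrite addrK.
  move: (B + x) => D; rewrite rho /S -[r.+1%:R]natr1 mulrDl mul1r !cosD sinD cosN sinN.
  move: B0 (sin D) (cos D) (cos x) (sin x) (cos (r%:R * x)); move: (sin (r%:R * x)).
  by move=> ? B0 *; field.
have Hsin B : sin B + w^-1 * sin (B + th) = S * sin (B + x).
  have -> : B + th = (B + x) + r%:R * x by rewrite /th -natr1; ring.
  have -> : sin B = sin ((B + x) - x) by rewrite addrK.
  move: (B + x) => D; rewrite rho /S -[r.+1%:R]natr1 mulrDl mul1r !sinD cosN sinN.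
  move: B0 (sin D) (cos D) (cos x) (sin x) (cos (r%:R * x)); move: (sin (r%:R * x)).
  by move=> ? B0 *; field.
(* The total phase vanishes, which expresses that [(1 + zeta)^(r+1) / zeta] is real: the sine sum is
   0 and the cosine sum a pure power of [S]. *)
have phase : (r.+1 * m)%:R * x - m%:R * th = 0 by rewrite /th natrM; ring.
have := @binomial_phase cos _ _ _ _ (r.+1 * m) (- (m%:R * th)) Hcos.
have := @binomial_phase sin _ _ _ _ (r.+1 * m) (- (m%:R * th)) Hsin.
rewrite phase cos0 sin0 mulr0 mulr1 => Es Ec.
transitivity (w ^+ m * (r.+1%:R * \sum_(j < (r.+1 * m).+1) 'C(r.+1 * m, j)%:R * w^-1 ^+ j * cos (j%:R * th - m%:R * th)
   - L * \sum_(j < (r.+1 * m).+1) 'C(r.+1 * m, j)%:R * w^-1 ^+ j * sin (j%:R * th - m%:R * th))).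
  rewrite !mulr_sumr -sumrB mulr_sumr; apply: eq_bigr => j _.
  by rewrite -mulrBl rhoE; ring.
rewrite Es Ec mulr0 subr0 mulrCA; congr (_ * _).
rewrite exprM -exprMn; congr (_ ^+ _).
have k0 : kappa R r != 0 by rewrite /kappa mulf_neq0 ?invr_neq0 ?expf_neq0 // pnatr_eq0 -lt0n.
rewrite /xphi -[w]invrK rho /S expr_div_n [sin (r%:R * x) ^+ r.+1]exprS.
have -> : r%:R ^+ r * sin (r.+1%:R * x) ^+ r.+1 / (r.+1%:R ^+ r.+1 * sin x * sin (r%:R * x) ^+ r) =
  kappa R r * (sin (r.+1%:R * x) ^+ r.+1 / (sin x * sin (r%:R * x) ^+ r)).
  by rewrite /kappa !invfM; ring.
move: (sin (r.+1%:R * x) ^+ r.+1) (expf_neq0 r B0) k0 => Q.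
move: (sin (r%:R * x) ^+ r) => P P0 k0.
by field; rewrite k0 P0 B0 gt_eqF.
Unshelve. all: by end_near. Qed.

End Antiderivative.

(** * The limit density and its moments *)

Section LimitDensity.
Variables (R : realType) (r : nat).
Hypothesis r_gt0 : (0 < r)%N.
Implicit Types (x t c d : R) (m : nat).

Local Notation T := (pi / r.+1%:R : R).
Local Notation mu := (@lebesgue_measure R).

Lemma xphi_inverse : exists psi : R -> R,
  (forall t, 0 < t < 1 -> 0 < psi t < T /\ xphi r (psi t) = t) /\
  (forall x, 0 < x < T -> 0 < xphi r x < 1 /\ psi (xphi r x) = x).
Proof.
have [h1 h2 h3] := @xphi_bij R r r_gt0.
have : forall t, exists x, 0 < t < 1 -> 0 < x < T /\ xphi r x = t.
  move=> t; have [t01|] := boolP (0 < t < 1); last by exists 0.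
  have : `]0, 1[%classic t by rewrite /= in_itv.
  by move=> /h3[x]; rewrite /= in_itv /= => xT <-; exists x.
move=> /choice[psi psiP]; exists psi; split => // x xT.
have x01 : 0 < xphi r x < 1.
  have : `]0, T[%classic x by rewrite /= in_itv.
  by move=> /h1; rewrite /= in_itv.
split=> //; have [p1 p2] := psiP _ x01.
by apply: h2; rewrite // inE /= in_itv.
Qed.

Lemma continuous_nuphi x : 0 < x < T -> {for x, continuous (nuphi r)}.
Proof.
move=> xT; have [s0 s1 s2] := sin_pos r_gt0 xT.
have cs k : {for x, continuous (fun y : R => sin (k%:R * y))}.
  by apply: continuous_comp; [exact: mulrl_continuous|exact: continuous_sin].
have cs1 : {for x, continuous (@sin R)} by exact: continuous_sin.
have cX (f : R -> R) n : {for x, continuous f} -> {for x, continuous (fun y : R => f y ^+ n)}.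
  exact: continuousX_for.
have cx : {for x, continuous (xphi r)}.
  by apply/differentiable_continuous/derivable1_diffP; have [] := is_derive_xphi r_gt0 xT.
have cc (c : R) : {for x, continuous (fun=> c : R)} by exact: cvg_cst.
have cM (f g : R -> R) : {for x, continuous f} -> {for x, continuous g} -> {for x, continuous (fun y : R => f y * g y)}.
  by move=> *; exact: cvgM.
have cD (f g : R -> R) : {for x, continuous f} -> {for x, continuous g} -> {for x, continuous (fun y : R => f y + g y)}.
  by move=> *; exact: cvgD.
have cN (f : R -> R) : {for x, continuous f} -> {for x, continuous (fun y : R => - f y)}.
  by move=> *; exact: cvgN.
rewrite /nuphi; apply: (cM); first by do !apply: (cM) => //; exact: (cs).
apply: cvgV.
  rewrite -/(xden r x) mulf_neq0 ?(gt_eqF (xden_gt0 r_gt0 xT)) //.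
  by rewrite mulf_neq0 ?(gt_eqF (xphi_gt0 r_gt0 xT)) ?(gt_eqF (pi_gt0 R)).
apply: (cM (fun y => pi * xphi r y)); first exact: (cM).
apply: (cD); last by apply: (cM) => //; apply: (cX); exact: (cs).
apply: (cD); first by apply: (cM) => //; apply: (cX); exact: (cs).
apply: (cN); apply: (cM); last exact: continuous_cos.
by apply: (cM); [apply: (cM) => //; exact: (cs)|exact: (cs)].
Qed.

Variable psi : R -> R.
Hypothesis psiP : forall t, 0 < t < 1 -> 0 < psi t < T /\ xphi r (psi t) = t.
Hypothesis psiK : forall x, 0 < x < T -> 0 < xphi r x < 1 /\ psi (xphi r x) = x.

Definition nu_of t : R := if 0 < t < 1 then nuphi r (psi t) else 0.

Lemma nu_of_gt0 t : 0 < t < 1 -> 0 < nu_of t.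
Proof.
move=> t01; rewrite /nu_of t01; have [pT _] := psiP t01.
by rewrite nuphiE // oppr_gt0 pmulr_rlt0 // invr_lt0 pmulr_rlt0 ?pi_gt0 // xder_lt0.
Qed.

Lemma nu_of_ge0 t : 0 <= nu_of t.
Proof.
have [t01|t01] := boolP (0 < t < 1); first exact/ltW/nu_of_gt0.
by rewrite /nu_of (negPf t01).
Qed.

Lemma is_derive_psi t : 0 < t < 1 -> is_derive t 1 psi (xder r (psi t))^-1.
Proof.
move=> t01; have [pT E] := psiP t01; rewrite -{1}E.
have nearT : \forall y \near psi t, 0 < y < T.
  by have := @near_in_itvoo R 0 T (psi t); rewrite in_itv; apply.
apply: is_derive_inverse.
- by apply: filterS nearT => y /psiK[].
- apply: filterS nearT => y yT; apply/differentiable_continuous/derivable1_diffP.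
  by have [] := is_derive_xphi r_gt0 yT.
- exact: is_derive_xphi.
- by rewrite lt_eqF // xder_lt0.
Qed.

Lemma continuous_nu_of t : 0 < t < 1 -> {for t, continuous nu_of}.
Proof.
move=> t01; have [pT E] := psiP t01.
have cpsi : {for t, continuous psi}.
  by apply/differentiable_continuous/derivable1_diffP; have [] := is_derive_psi t01.
have c : {for t, continuous (nuphi r \o psi)}.
  by apply: continuous_comp => //; exact: continuous_nuphi.
have E0 : nu_of t = (nuphi r \o psi) t by rewrite /nu_of t01.
rewrite /prop_for /continuous_at E0; apply: cvg_trans c; apply: near_eq_cvg.
near=> u; rewrite /nu_of /= ifT //; near: u.
by have := @near_in_itvoo R 0 1 t; rewrite in_itv; apply.
Unshelve. all: by end_near. Qed.

Lemma measurable_nu_of : measurable_fun setT nu_of.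
Proof.
have -> : nu_of = nu_of \_ `]0, 1[.
  apply/funext => t; rewrite patchE; case: ifPn => //; rewrite notin_setE /= in_itv /= => /negP.
  by rewrite /nu_of => /negPf ->.
apply/(measurable_restrictT nu_of) => //.
apply: open_continuous_measurable_fun; first exact: interval_open.
by move=> t; rewrite inE /= in_itv /= => t01; exact: continuous_nu_of.
Qed.

Let prim m t : R := - (kappa R r ^+ m / pi) * fuss_prim r m (psi t).

Let is_derive_prim m t : 0 < t < 1 -> is_derive t 1 (prim m) (t ^+ m * nu_of t).
Proof.
move=> t01; have [pT E] := psiP t01.
have := is_derive_fctZ (- (kappa R r ^+ m / pi))
  (is_derive1_comp (is_derive_fuss_prim r_gt0 m pT) (is_derive_psi t01)).
congr is_derive; rewrite E /nu_of t01 nuphiE // [(t / _) ^+ m]expr_div_n.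
have k0 : kappa R r ^+ m != 0.
  by rewrite expf_neq0 // /kappa mulf_neq0 ?invr_neq0 ?expf_neq0 // pnatr_eq0 -lt0n.
have d0 : xder r (psi t) != 0 by rewrite lt_eqF // xder_lt0.
have p0 : pi != 0 :> R by rewrite gt_eqF // pi_gt0.
move: (pi : R) (kappa R r ^+ m) (t ^+ m) (xder _ _) p0 k0 d0 => P K Tm D P0 K0 D0.
by field; rewrite D0 P0 K0.
Qed.

Lemma integral_moment_cc m c d : 0 < c -> c < d -> d < 1 ->
  (\int[mu]_(t in `[c, d]) (t ^+ m * nu_of t)%:E = (prim m d)%:E - (prim m c)%:E)%E.
Proof.
move=> c0 cd d1.
have cc t : c <= t <= d -> 0 < t < 1.
  by move=> /andP[ct td]; rewrite (lt_le_trans c0 ct) (le_lt_trans td d1).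
have cprim t : 0 < t < 1 -> {for t, continuous (prim m)}.
  by move=> t01; apply/differentiable_continuous/derivable1_diffP; have [] := is_derive_prim m t01.
apply: continuous_FTC2 => //.
- apply: continuous_in_subspaceT => t; rewrite inE /= in_itv /= => /cc t01.
  by apply: cvgM; [exact: exprn_continuous|exact: continuous_nu_of].
- split.
  + move=> t; rewrite in_itv /= => /andP[ct td].
    have t01 : 0 < t < 1 by apply: cc; rewrite !ltW.
    by have [] := is_derive_prim m t01.
  + by apply: cvg_at_right_filter; apply: cprim; apply: cc; rewrite lexx ltW.
  + by apply: cvg_at_left_filter; apply: cprim; apply: cc; rewrite lexx ltW.
- move=> t; rewrite in_itv /= => /andP[ct td]; rewrite derive1E.
  have t01 : 0 < t < 1 by apply: cc; rewrite !ltW.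
  by have [_ ->] := is_derive_prim m t01.
Qed.

(** The offset 3 keeps [cut k] below [T - cut k] already at [k = 0]. *)
Let cut k : R := T / k.+3%:R.

Let cutP k : 0 < cut k /\ cut k < T - cut k.
Proof.
have T0 := T_gt0 R r; split; first by rewrite divr_gt0.
have -> : (cut k < T - cut k) = (T * (2 / k.+3%:R) < T * 1).
  by rewrite ltrBrDr mulr1 mulrCA mulr_natl mulr2n.
by rewrite ltr_pM2l // ltr_pdivrMr ?ltr0n // mul1r ltr_nat.
Qed.

Lemma xphi_decr x y : 0 < x -> x < y -> y < T -> xphi r y < xphi r x.
Proof.
move=> x0 xy yT; have xT := lt_trans xy yT; have y0 := lt_trans x0 xy.
rewrite !xphi_ext ?x0 ?yT ?y0 //; apply: xext_decr => //.
  by rewrite in_itv /= !ltW.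
by rewrite in_itv /= !ltW.
Qed.

Let slab k := `[xphi r (T - cut k), xphi r (cut k)]%classic.

Let cut_cvg : cut k @[k --> \oo] --> 0.
Proof.
rewrite -[X in _ --> X](mulr0 T); apply: cvgM; first exact: cvg_cst.
have := @cvg_harmonic R; rewrite -(cvg_shiftn 2) => h.
by apply: cvg_trans h; apply: near_eq_cvg; near=> k; rewrite /= addn2.
Unshelve. all: by end_near. Qed.

Let slab_bigcup : \bigcup_k slab k = `]0, 1[%classic.
Proof.
apply/seteqP; split => t /=.
  move=> [k _]; rewrite /slab /= !in_itv /= => /andP[ct td].
  have [k0 k1] := cutP k; have T0 := T_gt0 R r.
  have kT : cut k < T by rewrite (lt_trans k1) // ltrBlDr ltrDl.
  have kT' : 0 < T - cut k < T by rewrite (lt_trans k0 k1) ltrBlDr ltrDl.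
  have k0T : 0 < cut k < T by rewrite k0 kT.
  have [[/andP[c0 _] _] [/andP[_ d1] _]] := (psiK kT', psiK k0T).
  by rewrite (lt_le_trans c0 ct) (le_lt_trans td d1).
rewrite in_itv /= => t01; have [/andP[p0 p1] E] := psiP t01.
have e0 : 0 < Num.min (psi t) (T - psi t) by rewrite lt_min p0 subr_gt0.
have /cvgrPdist_lt/(_ _ e0) [k _ Hk] := cut_cvg.
exists k => //; rewrite /slab /= in_itv /= -E.
have := Hk k (leqnn k); have [k0 k1] := cutP k.
rewrite /= sub0r normrN gtr0_norm // lt_min => /andP[h1 h2].
rewrite !ltW //; apply: xphi_decr => //.
  by rewrite ltrBrDr addrC -ltrBrDr.
by rewrite ltrBlDr ltrDl.
Qed.

Let slab_nd : nondecreasing_seq slab.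
Proof.
apply/nondecreasing_seqP => k; rewrite subsetEset => t; rewrite /slab /= !in_itv /=.
have [k0 k1] := cutP k; have [l0 l1] := cutP k.+1; have T0 := T_gt0 R r.
have kl : cut k.+1 < cut k.
  by rewrite /cut ltr_pM2l // ltf_pV2 ?posrE ?ltr0n // ltr_nat.
move=> /andP[h1 h2]; apply/andP; split.
  apply: le_trans h1; apply/ltW/xphi_decr; first exact: lt_trans k0 k1.
    by rewrite ltrD2l ltrN2.
  by rewrite ltrBlDr ltrDl.
apply: (le_trans h2); apply/ltW/xphi_decr => //.
by rewrite (lt_trans k1) // ltrBlDr ltrDl.
Qed.

(** The primitive is differentiable only inside the interval, so the fundamental theorem is applied
    on the increasing slabs; the integrand being nonnegative, monotone convergence and continuity of
    [fuss_prim] at 0 and [T] give the limit. *)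
Lemma integral_moment m :
  (\int[mu]_(t in `]0%R, 1%R[) (t ^+ m * nu_of t)%:E = (kappa R r ^+ m * (fuss r m)%:R)%:E)%E.
Proof.
have T0 := T_gt0 R r; have mnu := measurable_nu_of.
have mf : measurable_fun setT (fun t : R => (t ^+ m * nu_of t)%:E).
  apply/measurable_EFinP; apply: measurable_funM => //; exact: exprn_measurable.
rewrite -slab_bigcup.
have cv : (\int[mu]_(t in slab k) (t ^+ m * nu_of t)%:E @[k --> \oo] -->
    \int[mu]_(t in \bigcup_k slab k) (t ^+ m * nu_of t)%:E)%E.
  apply: ge0_nondecreasing_set_cvg_integral => //.
  - by move=> k; exact: measurable_itv.
  - by move=> k; apply: measurable_funS mf.
  - move=> k t; rewrite /slab /= in_itv /= => /andP[ct _]; rewrite lee_fin.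
    rewrite mulr_ge0 ?nu_of_ge0 // exprn_ge0 // (le_trans _ ct) // ltW // xphi_gt0 //.
    by have [k0 k1] := cutP k; rewrite (lt_trans k0 k1) ltrBlDr ltrDl.
apply: (cvg_unique _ cv) => //.
have -> : (fun k => \int[mu]_(t in slab k) (t ^+ m * nu_of t)%:E)%E =
   EFin \o (fun k => kappa R r ^+ m / pi * (fuss_prim r m (T - cut k) - fuss_prim r m (cut k))).
  apply/funext => k; have [k0 k1] := cutP k.
  have kT : cut k < T by rewrite (lt_trans k1) // ltrBlDr ltrDl.
  have kT' : 0 < T - cut k < T by rewrite (lt_trans k0 k1) ltrBlDr ltrDl.
  have k0T : 0 < cut k < T by rewrite k0 kT.
  have [/andP[c0 _] c2] := psiK kT'; have [/andP[_ d1] d2] := psiK k0T.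
  rewrite integral_moment_cc //; last by apply: xphi_decr => //; case/andP: kT'.
  by rewrite /prim c2 d2 -EFinB /=; congr EFin; ring.
apply/cvg_EFin; first by near=> k.
have -> : kappa R r ^+ m * (fuss r m)%:R = kappa R r ^+ m / pi * (fuss_prim r m T - fuss_prim r m 0).
  rewrite fuss_prim0 fuss_primT subr0.
  have p0 : pi != 0 :> R by rewrite gt_eqF // pi_gt0.
  by rewrite -mulrA mulKf.
apply: cvgM; first exact: cvg_cst.
have cT : {for T, continuous (fuss_prim r m)}.
  by apply: fuss_prim_continuous; rewrite // lexx ltW.
have c0 : {for (0 : R), continuous (fuss_prim r m)}.
  by apply: fuss_prim_continuous; rewrite // lexx ltW.
have hT : T - cut k @[k --> \oo] --> T.
  by rewrite -[X in _ --> X](subr0 T); apply: cvgB; [exact: cvg_cst|exact: cut_cvg].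
by apply: cvgB; [exact: (cvg_comp _ _ hT cT)|exact: (cvg_comp _ _ cut_cvg c0)].
Unshelve. all: by end_near. Qed.

End LimitDensity.

(** * Pointwise Bernstein approximation *)

Section Bernstein.
Variable R : realType.
Implicit Types (h : R -> R) (t : R).

Definition bernstein N h : {poly R} :=
  \sum_(k < N.+1) (h (k%:R / N%:R) * 'C(N, k)%:R) *: ('X^k * (1 - 'X) ^+ (N - k)).

Definition bweight N t (k : nat) : R := 'C(N, k)%:R * t ^+ k * (1 - t) ^+ (N - k).

Lemma horner_bernstein N h t :
  (bernstein N h).[t] = \sum_(k < N.+1) bweight N t k * h (k%:R / N%:R).
Proof.
rewrite /bernstein horner_sum; apply: eq_bigr => k _.
rewrite /bweight hornerZ hornerM hornerXn horner_exp.
have -> : (1 - 'X : {poly R}).[t] = 1 - t by rewrite !hornerE.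
by move: (h _) (_ ^+ (N - k)) => ? ?; ring.
Qed.

Lemma sum_bweight N t : \sum_(k < N.+1) bweight N t k = 1.
Proof.
transitivity ((1 - t + t) ^+ N); last by rewrite subrK expr1n.
rewrite exprDn; apply: eq_bigr => k _.
by rewrite /bweight -[RHS]mulr_natl -mulrA; congr (_ * _); exact: mulrC.
Qed.

Lemma bweight_ge0 N t k : 0 < t < 1 -> 0 <= bweight N t k.
Proof.
by move=> /andP[t0 t1]; rewrite /bweight !mulr_ge0 ?exprn_ge0 // ?subr_ge0 ltW.
Qed.

(** The Bernoulli-sum identity [coef_second_moment] with [y = t] and all roots [1 - t], so that
    every Bernoulli parameter is [t]. *)
Lemma bernstein_variance N t : 0 < t < 1 ->
  \sum_(k < N.+1) bweight N t k * (k%:R - N%:R * t) ^+ 2 <= N%:R.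
Proof.
move=> /andP[t0 t1]; have u0 : 0 < 1 - t by rewrite subr_gt0.
have := @coef_second_moment R N (fun=> 1 - t) t (N%:R * t) t0 (fun=> u0) => /=.
have tt : t + (1 - t) = 1 by rewrite addrC subrK.
have -> : \prod_(k < N) ('X + (1 - t)%:P) = ('X + (1 - t)%:P) ^+ N :> {poly R}.
  by rewrite prodr_const card_ord.
rewrite tt expr1n !divr1 !sumr_const card_ord horner_exp hornerD hornerX hornerC tt expr1n mul1r.
rewrite -[t *+ N]mulr_natl subrr expr0n /= addr0 => V.
have -> : \sum_(k < N.+1) bweight N t k * (k%:R - N%:R * t) ^+ 2 = t * (1 - t) *+ N.
  rewrite -V; apply: eq_bigr => k _; congr (_ * _).
  by rewrite coef_XDC_exp /bweight; ring.
rewrite -mulr_natr ler_piMl // (le_trans _ (ltW t1)) // ler_piMr ?(ltW t0) //.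
by rewrite gerBl ltW.
Qed.

(** Chebyshev's inequality at a single point [t]: only the modulus of continuity there enters, so
    [h] may jump elsewhere, as an extension by 0 does. *)
Lemma bernstein_approx N h t (M eta del : R) : (0 < N)%N -> 0 < t < 1 -> 0 < del -> 0 <= eta ->
  (forall s, `|h s| <= M) -> (forall s, `|s - t| < del -> `|h s - h t| <= eta) ->
  `|(bernstein N h).[t] - h t| <= eta + 2 * M / (del ^+ 2 * N%:R).
Proof.
move=> N0 t01 d0 eta0 hM hd; have n0 : 0 < N%:R :> R by rewrite ltr0n.
have M0 : 0 <= M := le_trans (normr_ge0 _) (hM 0).
have -> : (bernstein N h).[t] - h t = \sum_(k < N.+1) bweight N t k * (h (k%:R / N%:R) - h t).
  rewrite horner_bernstein -[h t in LHS]mul1r -(sum_bweight N t) mulr_suml -sumrB.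
  by apply: eq_bigr => k _; rewrite mulrBr.
apply: (le_trans (ler_norm_sum _ _ _)).
pose K := 2 * M / (del ^+ 2 * N%:R ^+ 2).
have K0 : 0 <= K by rewrite divr_ge0 ?mulr_ge0 // ?exprn_ge0 // ltW.
apply: (@le_trans _ _ (\sum_(k < N.+1) (bweight N t k * eta + K * (bweight N t k * (k%:R - N%:R * t) ^+ 2)))).
  apply: ler_sum => k _; have b0 := bweight_ge0 N k t01.
  rewrite normrM (ger0_norm b0) mulrCA -mulrDr ler_wpM2l //.
  have [sd|ds] := ltP `|k%:R / N%:R - t| del.
    by rewrite (le_trans (hd _ sd)) // lerDl mulr_ge0 ?sqr_ge0.
  apply: (@le_trans _ _ (2 * M)).
    by rewrite (le_trans (ler_normB _ _)) // [leRHS]mulr_natl mulr2n lerD.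
  rewrite ler_wpDl //.
  have -> : K * (k%:R - N%:R * t) ^+ 2 = 2 * M * ((k%:R / N%:R - t) ^+ 2 / del ^+ 2).
    by rewrite /K; field; rewrite !gt_eqF.
  rewrite ler_peMr ?mulr_ge0 // ler_pdivlMr ?exprn_gt0 // mul1r.
  by rewrite -[(_ - t) ^+ 2]real_normK ?num_real // lerXn2r // nnegrE // ltW.
rewrite big_split /= -mulr_suml sum_bweight mul1r -mulr_sumr lerD2l.
apply: (le_trans (ler_wpM2l K0 (bernstein_variance N t01))).
by rewrite /K le_eqVlt; apply/orP; left; apply/eqP; field; rewrite !gt_eqF.
Qed.

Lemma bernstein_bound N h t (M : R) : 0 < t < 1 -> (forall s, `|h s| <= M) ->
  `|(bernstein N h).[t]| <= M.
Proof.
move=> t01 hM; rewrite horner_bernstein (le_trans (ler_norm_sum _ _ _)) //.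
rewrite -[leRHS]mul1r -(sum_bweight N t) mulr_suml; apply: ler_sum => k _.
by rewrite normrM ger0_norm ?bweight_ge0 // ler_wpM2l ?bweight_ge0.
Qed.

Lemma one_sub_exp_ge (x : R) n : 0 <= x <= 1 -> 1 - n%:R * x <= (1 - x) ^+ n.
Proof.
move=> /andP[x0 x1]; elim: n => [|n IH]; first by rewrite mul0r subr0.
rewrite exprS; apply: (@le_trans _ _ ((1 - x) * (1 - n%:R * x))).
  have : 0 <= n%:R * x ^+ 2 by rewrite mulr_ge0 ?sqr_ge0.
  by rewrite -natr1; nra.
by rewrite ler_wpM2l // subr_ge0.
Qed.

(** Compactness is used for [t] alone; [s] may leave [[c, 1 - c]], which uniform continuity on the
    segment would not cover. *)
Lemma uniform_continuity_oo (f : R -> R) (c eta : R) : 0 < c -> 0 < eta ->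
  {within `]0, 1[, continuous f} ->
  exists2 del, 0 < del & forall t s, c <= t <= 1 - c -> `|s - t| < del -> `|f s - f t| <= eta.
Proof.
move=> c0 eta0; rewrite continuous_open_subspace; last exact: interval_open.
move=> fc; have : compact `[c, 1 - c]%classic by exact: segment_compact.
move=> /compact_near_coveringP.
pose P (del t : R) := forall s, `|s - t| < del -> `|f s - f t| <= eta.
move=> /(_ R ((0 : R)^'+) P _) H.
have {}H : \forall del \near (0 : R)^'+, `[c, 1 - c]%classic `<=` P del.
  apply: H => t /=; rewrite in_itv /= => /andP[ct tc].
  have t01 : t \in `]0, 1[%classic.
    by rewrite inE /= in_itv /= (lt_le_trans c0 ct) (le_lt_trans tc) // ltrBlDr ltrDl.
  have /cvgrPdist_lt/(_ (eta / 2)) := fc t t01.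
  rewrite divr_gt0 // => /(_ isT) /nbhs_ballP[rho /= rho0 Hrho].
  have Hr u : `|t - u| < rho -> `|f t - f u| < eta / 2 by move=> h; apply: Hrho.
  exists (ball t (rho / 2), [set d | d <= rho / 2]) => /=.
    split; first by apply: nbhsx_ballx; rewrite divr_gt0.
    by apply: nbhs_right_le; rewrite divr_gt0.
  move=> [u d] /= [tu dr] s sd.
  have tu' : `|t - u| < rho / 2 := tu.
  have h1 : `|f t - f u| < eta / 2.
    by apply: Hr; rewrite (lt_trans tu') // ltr_pdivrMr // ltr_pMr // ltr1n.
  have h2 : `|f t - f s| < eta / 2.
    apply: Hr; have -> : t - s = (t - u) - (s - u) by ring.
    rewrite (le_lt_trans (ler_normB _ _)) // [ltRHS]splitr ltrD //.
    exact: lt_le_trans sd dr.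
  have -> : f s - f u = (f t - f u) - (f t - f s) by ring.
  by rewrite (le_trans (ler_normB _ _)) // [leRHS]splitr lerD // ltW.
near (0 : R)^'+ => del.
exists del; first by near: del; exact: nbhs_right_gt.
move=> t s tc sd; have : `[c, 1 - c]%classic `<=` P del by near: del.
by move=> /(_ t); apply => //=; rewrite in_itv.
Unshelve. all: by end_near. Qed.

End Bernstein.

(** * From moments to bounded continuous functions on the open interval *)

Section WeakLimit.
Variables (R : realType) (z : forall n : nat, 'I_n -> R) (nu : R -> R) (mom : nat -> R).
Hypothesis z01 : forall n (k : 'I_n), (0 < n)%N -> 0 < z k < 1.
Hypothesis nu_ge0 : forall t, 0 <= nu t.
Hypothesis nu_meas : measurable_fun setT nu.
Local Notation mu := (@lebesgue_measure R).
Local Notation D := (`]0%R, 1%R[%classic : set R).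
Hypothesis nu_mom : forall m, (\int[mu]_(t in D) (t ^+ m * nu t)%:E = (mom m)%:E)%E.
Hypothesis z_mom : forall m, zmean z (fun t => t ^+ m) n @[n --> \oo] --> mom m.

Let mD : measurable D. Proof. exact: measurable_itv. Qed.

Let inD t : D t -> 0 < t < 1. Proof. by rewrite /= in_itv. Qed.

Lemma integrable_nu : mu.-integrable D (EFin \o nu).
Proof.
apply/integrableP; split; first by apply/measurable_EFinP; exact: measurable_funS nu_meas.
have := nu_mom 0; under eq_integral do rewrite expr0 mul1r.
by move=> E; under eq_integral do rewrite /= ger0_norm //; rewrite E ltry.
Qed.

Lemma integrable_mul_nu (g : R -> R) (B : R) : measurable_fun D g -> (forall t, 0 < t < 1 -> `|g t| <= B) ->
  mu.-integrable D (EFin \o (fun t => g t * nu t)).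
Proof.
move=> mg gB; apply: (@le_integrable _ _ _ mu D mD _ (fun t => B%:E * (EFin \o nu) t)%E).
- apply/measurable_EFinP; apply: measurable_funM => //; exact: measurable_funS nu_meas.
- move=> t /inD t01; rewrite /= lee_fin !normrM (ger0_norm (nu_ge0 t)).
  by rewrite ler_wpM2r // (le_trans (gB t t01)) // ler_norm.
- exact: integrableZl integrable_nu.
Qed.

Lemma measurable_horner (p : {poly R}) : measurable_fun D (horner p).
Proof.
by apply: measurable_funS (continuous_measurable_fun (@continuous_horner _ p)).
Qed.

Lemma horner_bounded (p : {poly R}) (t : R) : 0 < t < 1 -> `|p.[t]| <= \sum_(i < size p) `|p`_i|.
Proof.
move=> /andP[t0 t1]; rewrite horner_coef (le_trans (ler_norm_sum _ _ _)) //; apply: ler_sum => i _.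
by rewrite normrM normrX ler_piMr // exprn_ile1 // gtr0_norm // ltW.
Qed.

Lemma integrable_horner_nu (p : {poly R}) : mu.-integrable D (EFin \o (fun t => p.[t] * nu t)).
Proof. exact: integrable_mul_nu (measurable_horner p) (@horner_bounded p). Qed.

Lemma Rintegral_horner_nu (p : {poly R}) :
  \int[mu]_(t in D) (p.[t] * nu t) = \sum_(i < size p) p`_i * mom i.
Proof.
have H N (c : nat -> R) : \int[mu]_(t in D) ((\poly_(i < N) c i).[t] * nu t) = \sum_(i < N) c i * mom i.
  elim: N => [|N IH].
    rewrite big_ord0 (_ : \poly_(i < 0) c i = 0); last by rewrite poly_def big_ord0.
    under eq_Rintegral do rewrite horner0 mul0r.
    by rewrite /Rintegral integral0.
  rewrite big_ord_recr /= -IH.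
  have mN : \int[mu]_(t in D) ('X^N.[t] * nu t) = mom N.
    by rewrite /Rintegral; under eq_integral do rewrite hornerXn; rewrite nu_mom.
  rewrite -mN -RintegralZl //; last exact: integrable_horner_nu.
  rewrite -RintegralD //; last 2 first.
  - exact: integrable_horner_nu.
  - have := integrable_horner_nu (c N *: 'X^N).
    by congr (mu.-integrable _ _); apply/funext => t /=; rewrite hornerZ mulrA.
  apply: eq_Rintegral => t _; rewrite !poly_def big_ord_recr /= hornerD hornerZ.
  by rewrite mulrDl mulrA.
by rewrite -{1}[p]coefK H.
Qed.

Lemma zmean_horner_cvg (p : {poly R}) :
  zmean z (horner p) n @[n --> \oo] --> \int[mu]_(t in D) (p.[t] * nu t).
Proof.
rewrite Rintegral_horner_nu.
have -> : zmean z (horner p) = (fun n => \sum_(i < size p) p`_i * zmean z (fun t => t ^+ i) n).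
  apply/funext => n; rewrite -(zmean_sum z (fun i : 'I_(size p) => p`_i) (fun i t => t ^+ i)).
  by congr (zmean z _ n); apply/funext => t; rewrite horner_coef.
apply: cvg_big => [|i _]; first exact: add_continuous.
by apply: cvgM; [exact: cvg_cst|exact: z_mom].
Qed.

Definition tailp N : {poly R} := (1 - 'X *+ 2) ^+ (N.*2).

Lemma horner_tailp N t : (tailp N).[t] = (1 - t *+ 2) ^+ N.*2.
Proof. by rewrite horner_exp !hornerE. Qed.

Lemma tailp_ge0 N t : 0 <= (tailp N).[t].
Proof. by rewrite horner_tailp -muln2 exprM sqr_ge0. Qed.

Lemma tailp_cvg : \int[mu]_(t in D) ((tailp N).[t] * nu t) @[N --> \oo] --> (0 : R).
Proof.
pose f_ N := EFin \o (fun t => (tailp N).[t] * nu t).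
have mf N : measurable_fun D (f_ N) by exact: measurable_int (integrable_horner_nu (tailp N)).
have f0 : {ae mu, forall t, D t -> f_ ^~ t @ \oo --> (cst 0%E : R -> \bar R) t}.
  apply: aeW => t /inD /andP[t0 t1]; apply/cvg_EFin; first by near=> N.
  have -> : fine \o f_^~ t = (fun N => ((1 - t *+ 2) ^+ 2) ^+ N * nu t).
    by apply/funext => N; rewrite /= horner_tailp -exprM mul2n.
  rewrite /= -[X in _ --> X](mul0r (nu t)); apply: cvgM; last exact: cvg_cst.
  apply: cvg_expr; rewrite ger0_norm ?sqr_ge0 //.
  by have : 0 < t * (1 - t); [rewrite mulr_gt0 // subr_gt0|rewrite mulr2n; nra].
have fg : {ae mu, forall t N, D t -> (`|f_ N t| <= (EFin \o nu) t)%E}.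
  apply: aeW => t N /inD /andP[t0 t1]; rewrite /= lee_fin normrM (ger0_norm (nu_ge0 t)).
  rewrite ler_piMl // ger0_norm ?tailp_ge0 // horner_tailp -mul2n exprM.
  rewrite exprn_ile1 ?sqr_ge0 //.
  by have : 0 < t * (1 - t); [rewrite mulr_gt0 // subr_gt0|rewrite mulr2n; nra].
have [_ _] := @dominated_convergence _ _ _ mu D mD f_ (cst 0%E) (EFin \o nu) mf (measurable_cst _) f0 integrable_nu fg.
rewrite integral0 => /fine_cvg; apply: cvg_trans; apply: near_eq_cvg.
by near=> N.
Unshelve. all: by end_near. Qed.

(** At distance [u] from an end, Bernoulli's inequality gives at least [1 - 4 N u], which exceeds
    1/2 when [u < 1 / (8 (N+1))]. *)
Lemma tailp_half N (t : R) : 0 < t < 1 -> ~~ ((8 * N.+1)%:R^-1 <= t <= 1 - (8 * N.+1)%:R^-1) ->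
  2^-1 <= (tailp N).[t].
Proof.
set e := _^-1 => t01; have [t0 t1] := andP t01.
have Ne : 8 * (N%:R + 1) * e = 1.
  by rewrite /e natr1 -natrM mulfV // pnatr_eq0.
have e0 : 0 < e by rewrite invr_gt0 ltr0n.
have N0 : 0 <= N%:R :> R by [].
have e8 : e <= 8^-1 by rewrite /e natrM invfM ler_piMr // invf_le1 // ler1n.
have key u : 0 < u -> u < e -> 2^-1 <= (1 - u *+ 2) ^+ N.*2.
  move=> u0 ue; have := @one_sub_exp_ge R (u *+ 2) N.*2.
  have u2 : 0 <= u *+ 2 <= 1 by rewrite mulr2n; apply/andP; split; lra.
  move=> /(_ u2); apply: le_trans.
  have : N%:R * u <= N%:R * e by rewrite ler_wpM2l // ltW.
  rewrite -mul2n natrM [u *+ 2]mulr2n (_ : 2 * N%:R * (u + u) = 4 * (N%:R * u)); last by ring.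
  have : 8 * (N%:R * e) + 8 * e = 1 by rewrite -[RHS]Ne; ring.
  by move: e0; set Q := N%:R * e; set P := N%:R * u; lra.
rewrite horner_tailp negb_and -!ltNge => /orP[te|te]; first exact: key.
have -> : (1 - t *+ 2) ^+ N.*2 = (1 - (1 - t) *+ 2) ^+ N.*2.
  by rewrite -!mul2n !exprM; congr (_ ^+ _); rewrite !mulr2n; ring.
by apply: key; [rewrite subr_gt0|rewrite ltrBlDr -ltrBlDl].
Qed.

Lemma weak_limit (f : R -> R) (M : R) : {within `]0, 1[, continuous f} ->
  (forall t, 0 < t < 1 -> `|f t| <= M) ->
  zmean z f n @[n --> \oo] --> \int[mu]_(t in D) (f t * nu t).
Proof.
move=> fc fM; have M0 : 0 <= M.
  by apply: le_trans (normr_ge0 _) (fM 2^-1 _); rewrite invr_gt0 ltr0n invf_lt1 // ltr1n.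
have mf : measurable_fun D f.
  apply: open_continuous_measurable_fun; first exact: interval_open.
  by rewrite -continuous_open_subspace //; exact: interval_open.
apply/cvgrPdist_lt => e e0.
pose I p := \int[mu]_(t in D) (p.[t] * nu t).
have m0 : 0 <= mom 0.
  rewrite -lee_fin -nu_mom; apply: integral_ge0 => t _.
  by rewrite lee_fin expr0 mul1r.
pose eta := e / (8 * (1 + mom 0)).
have eta0 : 0 < eta by rewrite divr_gt0 // mulr_gt0 // ltr_wpDr.
have [N HN] : exists N, 4 * M * I (tailp N) < e / 8.
  have : 4 * M * I (tailp N) @[N --> \oo] --> 4 * M * 0.
    by apply: cvgM; [exact: cvg_cst|exact: tailp_cvg].
  rewrite mulr0 => /cvgrPdist_lt/(_ (e / 8)); rewrite divr_gt0 // => /(_ isT) [N _ HN].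
  exists N; have := HN N (leqnn N); rewrite /= sub0r normrN.
  exact: le_lt_trans (ler_norm _).
pose c : R := (8 * N.+1)%:R^-1; have c0 : 0 < c by rewrite invr_gt0 ltr0n.
have [del0 del00 Hdel0] := uniform_continuity_oo c0 (divr_gt0 eta0 (ltr0Sn R 1)) fc.
(* [del <= c] keeps [s] inside []0, 1[], where [h] coincides with [f]. *)
pose del := Num.min del0 c.
have del_gt0 : 0 < del by rewrite lt_min del00.
pose h s := if 0 < s < 1 then f s else 0.
have hM s : `|h s| <= M by rewrite /h; case: ifP => [/fM //|_]; rewrite normr0.
have [K K0 HK] : exists2 K, (0 < K)%N & 2 * M / (del ^+ 2 * K%:R) <= eta / 2.
  have q0 : 0 < del ^+ 2 * (eta / 2) by rewrite mulr_gt0 ?exprn_gt0 // divr_gt0.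
  have HK := archi_boundP (divr_ge0 (mulr_ge0 (ler0n R 2) M0) (ltW q0)).
  set K := Num.bound _ in HK; exists K.+1 => //.
  have K0 : 0 < K.+1%:R :> R by rewrite ltr0n.
  rewrite ler_pdivrMr ?mulr_gt0 ?exprn_gt0 //.
  move: HK; rewrite ltr_pdivrMr // => /ltW /le_trans; apply.
  rewrite [leRHS](_ : _ = K.+1%:R * (del ^+ 2 * (eta / 2))); last by ring.
  by rewrite ler_wpM2r ?(ltW q0) // ler_nat.
(* Near the ends the error is at most [2 M] and [tailp N] at least 1/2, hence the factor [4 M]. The
   majorant [g] is a polynomial, so its means converge as well. *)
pose p1 := bernstein K h; pose g := eta%:P + (4 * M) *: tailp N.
have pg t : 0 < t < 1 -> `|f t - p1.[t]| <= g.[t].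
  move=> t01; have ft : f t = h t by rewrite /h t01.
  rewrite /g hornerD hornerC hornerZ distrC.
  have [tc|tc] := boolP (c <= t <= 1 - c); last first.
    apply: (@le_trans _ _ (2 * M)).
      rewrite (le_trans (ler_normB _ _)) // [leRHS]mulr_natl mulr2n lerD //.
        exact: bernstein_bound.
      exact: fM.
    have := tailp_half t01 tc; move: (tailp N).[t] => T HT.
    by have := ler_wpM2l M0 HT; move: (eta0); lra.
  apply: (@le_trans _ _ eta); last by rewrite lerDl !mulr_ge0 ?tailp_ge0.
  rewrite ft; apply: le_trans (@bernstein_approx R K h t M (eta / 2) del K0 t01 del_gt0 _ hM _) _.
  - by rewrite divr_ge0 // ltW.
  - move=> s; rewrite lt_min => /andP[s1 s2]; rewrite -ft /h.
    have -> : 0 < s < 1.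
      by move: s2 tc; rewrite ltr_norml => /andP[? ?] /andP[? ?]; apply/andP; split; lra.
    exact: Hdel0.
  - by rewrite [leRHS]splitr lerD2l.
have Ig : I g < e / 4.
  have -> : I g = eta * mom 0 + 4 * M * I (tailp N).
    have -> : mom 0 = I 1%:P.
      have := nu_mom 0; under eq_integral do rewrite expr0.
      by move=> E; rewrite /I /Rintegral; under eq_integral do rewrite hornerC; rewrite E.
    rewrite /I -!RintegralZl //; last 2 first.
    - exact: integrable_horner_nu.
    - exact: integrable_horner_nu.
    have iZ (d : R) p : mu.-integrable D (EFin \o (fun t => d * (p.[t] * nu t))).
      have := integrable_horner_nu (d *: p).
      by congr (mu.-integrable _ _); apply/funext => t /=; rewrite hornerZ mulrA.
    rewrite -RintegralD //; apply: eq_Rintegral => t _.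
    by rewrite /g hornerD hornerC hornerZ hornerC; ring.
  have : eta * mom 0 <= e / 8.
    have d0 : 0 < 8 * (1 + mom 0) by rewrite mulr_gt0 // ltr_wpDr.
    rewrite /eta mulrAC ler_pdivrMr //; move: (e0) (m0) => ? ?; lra.
  by move: HN; move: (I (tailp N)) (eta * mom 0) => ? ?; lra.
have If : `|\int[mu]_(t in D) (f t * nu t) - I p1| <= I g.
  have if1 := integrable_mul_nu mf fM.
  have ip q := integrable_horner_nu q.
  have id : mu.-integrable D (EFin \o (fun t => f t * nu t - p1.[t] * nu t)).
    have iB := @integrableB _ _ _ mu D mD _ _ if1 (ip p1).
    by move: iB; congr (mu.-integrable _ _); apply/funext => t /=; rewrite EFinB.
  rewrite /I -RintegralB //; apply: le_trans (le_normr_Rintegral _ _) _ => //.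
  apply: le_Rintegral => //.
    exact: (integrable_norm id).
  move=> t /inD t01; rewrite -mulrBl normrM (ger0_norm (nu_ge0 t)).
  by rewrite ler_wpM2r // pg.
have := @zmean_horner_cvg p1; rewrite -/(I p1) => /cvgrPdist_lt/(_ (e / 4)).
rewrite divr_gt0 // => /(_ isT) H1.
have := @zmean_horner_cvg g; rewrite -/(I g) => /cvgrPdist_lt/(_ (e / 4)).
rewrite divr_gt0 // => /(_ isT) H2.
near=> n.
have n0 : (0 < n)%N by near: n; exact: nbhs_infty_gt.
have L1 : `|I p1 - zmean z (horner p1) n| < e / 4 by near: n.
have L2 : `|I g - zmean z (horner g) n| < e / 4 by near: n.
have fp : `|zmean z f n - zmean z (horner p1) n| <= zmean z (horner g) n.
  rewrite /zmean -mulrBr -sumrB normrM ger0_norm ?invr_ge0 // ler_wpM2l ?invr_ge0 //.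
  by apply: le_trans (ler_norm_sum _ _ _) _; apply: ler_sum => k _; exact/pg/z01.
(* Four quarters of [e]: [Q] bounds [F - P], [L1] bounds [P - B], and [G], which is below
   [Q + e / 4], bounds [A - B]. *)
move: If fp L1 L2 Ig; move: (zmean z f n) (zmean z _ n) (zmean z _ n) (I p1) (I g) => A B G P Q.
move: (\int[mu]_(t in D) _) => F.
rewrite !ler_norml !ltr_norml => /andP[? ?] /andP[? ?] /andP[? ?] /andP[? ?] ?.
by apply/andP; split; lra.
Unshelve. all: by end_near. Qed.

End WeakLimit.

Lemma eq_poly_horner (R : numDomainType) (p q : {poly R}) : (forall y, p.[y] = q.[y]) -> p = q.
Proof.
move=> pq; apply/eqP; rewrite -subr_eq0; apply/eqP.
apply: (@roots_geq_poly_eq0 _ _ [seq i%:R | i <- iota 0 (size (p - q))]).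
- by apply/allP => y _; rewrite rootE hornerD hornerN pq subrr.
- by rewrite map_inj_uniq ?iota_uniq //; exact: mulrIn (oner_neq0 _).
- by rewrite size_map size_iota.
Qed.

(** * Transfer to arbitrary listings of the zeros, and conclusion *)

Section Main.
Variables (R : realType) (r : nat) (a b : 'I_r -> R).
Hypothesis r_gt0 : (0 < r)%N.
Hypothesis a_gt0 : forall i : 'I_r, 0 < a i.
Hypothesis b_gt0 : forall j : 'I_r, 0 < b j.
Hypothesis ab_le : forall i j : 'I_r, (i <= j)%N -> a i < b j.
Hypothesis ab_gt : forall i j : 'I_r, (j.+1 <= i)%N -> a i - 1 < b j.

Lemma zeros_of_hmonic n (z : 'I_n -> R) : (0 < n)%N ->
  zeros_of (Pseq a b n) z <-> hmonic a b n 0 = \prod_k ('X - (z k)%:P).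
Proof.
have E y : (\prod_k ('X - (z k)%:P)).[y] = \prod_k (y - z k).
  by rewrite horner_prod; apply: eq_bigr => k _; rewrite hornerXsubC.
move=> n0; split=> [zP|zE y]; last by rewrite Pseq_hmonic // zE E.
by apply: eq_poly_horner => y; rewrite E -zP Pseq_hmonic.
Qed.

Lemma zeros_of_itv n (z : 'I_n -> R) : (0 < n)%N ->
  zeros_of (Pseq a b n) z -> forall k, 0 < z k < 1.
Proof.
move=> n0 /(zeros_of_hmonic _ n0) zE k.
have [w wE w01] := hmonic_split r_gt0 a_gt0 b_gt0 ab_le ab_gt n.
have : root (hmonic a b n 0) (z k).
  by rewrite zE /root horner_prod (bigD1 k) //= !hornerE subrr mul0r.
rewrite wE rootE horner_prod prodf_seq_eq0 => /hasP[i _] /=.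
by rewrite hornerXsubC subr_eq0 => /eqP ->.
Qed.

Lemma hpoly_zeros_of n (z : 'I_n -> R) : (0 < n)%N ->
  zeros_of (Pseq a b n) z -> hpoly n a (sbeta b n.-1) = \prod_k ('X + (z k)%:P).
Proof.
move=> n0 /(zeros_of_hmonic _ n0); rewrite /hmonic /chain salpha0 addn0 => zE.
transitivity ((-1) ^+ n *: (((-1) ^+ n *: (hpoly n a (sbeta b n.-1) \Po - 'X)) \Po - 'X)).
  rewrite comp_polyZ scalerA -exprMn mulrNN mulr1 expr1n scale1r -comp_polyA.
  by rewrite rmorphN /= comp_polyX opprK comp_polyXr.
rewrite zE rmorph_prod /= -mul_polyC rmorph_sign -{1}[n]card_ord -prodrN.
by apply: eq_bigr => k _; rewrite rmorphB /= comp_polyX comp_polyC opprB opprK addrC.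
Qed.

End Main.

Theorem theorem8p6 (R : realType) (r : nat) (hr : (0 < r)%N)
  (a b : 'I_r -> R)
  (ha : forall i : 'I_r, 0 < a i) (hb : forall j : 'I_r, 0 < b j)
  (hab : forall i j : 'I_r, (i <= j)%N -> a i < b j)
  (hab1 : forall i j : 'I_r, (j.+1 <= i)%N -> a i - 1 < b j) :
  (forall n : nat, (0 < n)%N ->
     exists z : 'I_n -> R,
       zeros_of (Pseq a b n) z /\ (forall k : 'I_n, 0 < z k < 1)) /\
  set_bij `]0, (pi / r.+1%:R : R)[ `]0, (1 : R)[ (xphi r) /\
  exists nu : R -> R,
    [/\ (forall phi : R, 0 < phi < pi / r.+1%:R ->
           nu (xphi r phi) = nuphi r phi),
        (forall t : R, ~~ (0 < t < 1) -> nu t = 0),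
        (forall t : R, 0 <= nu t),
        lebesgue_measure.-integrable setT (EFin \o nu)
      & asymptotic_zero_density (Pseq a b) nu].
Proof.
split=> [n n0|].
  have [z zE z01] := hmonic_split hr ha hb hab hab1 n.
  by exists z; split=> //; apply/(zeros_of_hmonic hr ha hb _ n0).
split; first exact: xphi_bij.
have [psi [psiP psiK]] := xphi_inverse R hr.
have nu_ge0 := nu_of_ge0 hr psiP.
have nu_meas := measurable_nu_of hr psiP psiK.
have nu_mom := integral_moment hr psiP psiK.
have nu_out (t : R) : ~~ (0 < t < 1) -> nu_of r psi t = 0 by rewrite /nu_of => /negPf ->.
exists (nu_of r psi); split=> // [phi phiT||].
- by have [x01 E] := psiK phi phiT; rewrite /nu_of x01 E.
- have nuI := integrable_nu nu_ge0 nu_meas nu_mom.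
  have -> : EFin \o nu_of r psi = (EFin \o nu_of r psi) \_ `]0, 1[.
    apply/funext => t /=; rewrite patchE; case: ifPn => //.
    by rewrite notin_setE /= in_itv /= => /negP/nu_out ->.
  have H := @integrable_mkcond _ _ _ (@lebesgue_measure R) `]0%R, 1%R[%classic (EFin \o nu_of r psi) (measurable_itv _).
  exact: H.1 nuI.
move=> z zP f fc [M fM].
have z01 n (k : 'I_n) : (0 < n)%N -> 0 < z n k < 1.
  by move=> n0; exact: (zeros_of_itv hr ha hb hab hab1 n0 (zP n n0)).
have zE n (n0 : (0 < n)%N) := hpoly_zeros_of hr ha hb n0 (zP n n0).
suff -> : \int[lebesgue_measure]_(t in `[0, 1]) (f t * nu_of r psi t) =
    \int[lebesgue_measure]_(t in `]0, 1[) (f t * nu_of r psi t).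
  have WL := weak_limit z01 nu_ge0 nu_meas nu_mom (moment_cvg hr ha hb z01 zE) fc fM.
  exact: WL.
(* The density is 0 at both endpoints, so the values of [f] there do not matter. *)
rewrite [LHS]Rintegral_mkcond [RHS]Rintegral_mkcond; congr (Rintegral _ _ _).
apply/funext => t; rewrite !patchE !mem_setE !in_itv /=.
have [t01|t01] := boolP (0 < t < 1).
  by have [t0 t1] := andP t01; rewrite !ltW.
by rewrite nu_out // mulr0 if_same.
Qed.
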